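(* Let $N\ge3$ and $2<\alpha<\infty$, and let $\lambda_1$ be the first (i.e. largest) eigenvalue of $(L,D_{p,max}(L))$ (which is the same for all $\frac{N}{N-2}<p\le\infty$). Then the following estimates hold: $$\lambda_1\le -\left(\frac{\alpha-2}{2}\right)^{\frac{2}{\alpha}}\frac{\alpha}{\alpha-2}\,\frac{(N-2)^2}{4}$$ and $$\lambda_1\le -(N-2)\,\frac{\alpha\sin\left(\frac{2}{\alpha}\pi\right)}{\pi}.$$
   Context: $Lu=(1+|x|^\alpha)\Delta u$ on $\mathbb{R}^N$. For $\frac{N}{N-2}<p<\infty$, $L^p=L^p(\mathbb{R}^N)$ with Lebesgue measure and $D_{p,max}(L)=\{u\in L^p\cap W^{2,p}_{loc}(\mathbb{R}^N):\ Lu\in L^p\}$. When $p=\infty$, $L^p$ stands for $C_0(\mathbb{R}^N)$ (continuous functions vanishing at infinity, with the sup-norm) and $D_{p,max}(L)$ for $\{u\in C_0(\mathbb{R}^N)\cap W^{2,q}_{loc}(\mathbb{R}^N)\text{ for all }q<\infty:\ Lu\in C_0(\mathbb{R}^N)\}$. For these $p$ the spectrum of $(L,D_{p,max}(L))$ in $L^p$ consists of a sequence of negative eigenvalues tending to $-\infty$, and is independent of $p$; $\lambda_1$ denotes its largest element. *)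

(* Defs.v *)
From HB Require Import structures.
From mathcomp Require Import all_boot all_order all_algebra.
From mathcomp Require Import all_classical all_reals all_analysis.

Set Implicit Arguments.
Unset Strict Implicit.
Unset Printing Implicit Defensive.

Import Order.TTheory GRing.Theory Num.Theory.
Import numFieldNormedType.Exports.

Local Open Scope classical_set_scope.
Local Open Scope ring_scope.

(* The sigma-algebra on R^n generated by the coordinates (the Borel one),
   as the library does for tuples. *)
Section measurable_rV.
Context {d} {T : sigmaRingType d}.
Variable n : nat.

Let coors : 'I_n -> 'rV[T]_n -> T := fun i x => x ord0 i.

Let rV_set0 : g_sigma_preimage coors set0.
Proof. exact: sigma_algebra0. Qed.

Let rV_setC A : g_sigma_preimage coors A -> g_sigma_preimage coors (~` A).
Proof. exact: sigma_algebraC. Qed.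

Let rV_bigcup (F : _^nat) : (forall i, g_sigma_preimage coors (F i)) ->
  g_sigma_preimage coors (\bigcup_i (F i)).
Proof. exact: sigma_algebra_bigcup. Qed.

HB.instance Definition _ := @isMeasurable.Build (measure_tuple_display d)
  ('rV[T]_n) (g_sigma_preimage coors) rV_set0 rV_setC rV_bigcup.

End measurable_rV.

Section lebesgue_rV.
Context {R : realType}.
Implicit Type n : nat.

Lemma measurable_coord n (i : 'I_n) :
  measurable_fun setT (fun x : 'rV[R]_n => x ord0 i).
Proof.
move=> _ Y mY; rewrite setTI; apply: sub_sigma_algebra => /=.
rewrite -bigcup_seq/=; exists i => /=; first by rewrite mem_index_enum.
by exists Y => //; rewrite setTI.
Qed.

Lemma measurable_fun_rVP d (T : measurableType d) n (f : T -> 'rV[R]_n) :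
  (forall i, measurable_fun setT (fun t => f t ord0 i)) ->
  measurable_fun setT f.
Proof.
move=> mf.
suff H : preimage_set_system setT f (@measurable _ 'rV[R]_n) `<=` measurable.
  by move=> _ A mA; apply: H; exists A.
rewrite /measurable/= -g_sigma_preimage_comp.
apply: smallest_sub; first exact: sigma_algebra_measurable.
case: n => [|n] in f mf *; first by rewrite big_ord0.
by rewrite -bigcup_mkord_ord; apply: bigcup_sub => i Ii A [B mB <-]; exact: mf.
Qed.

Definition rV_cons n (x : measurableTypeR R * 'rV[R]_n) : 'rV[R]_n.+1 :=
  row_mx (x.1 : R)%:M x.2.

Definition rV_uncons n (x : 'rV[R]_n.+1) : measurableTypeR R * 'rV[R]_n :=
  (x ord0 ord0, \row_j x ord0 (lift ord0 j)).

Lemma rV_cons0 n (x : measurableTypeR R * 'rV[R]_n) :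
  rV_cons x ord0 ord0 = x.1.
Proof.
rewrite /rV_cons (_ : ord0 = lshift n (ord0 : 'I_1)); last exact/val_inj.
by rewrite (row_mxEl (x.1%:M)) mxE eqxx mulr1n.
Qed.

Lemma rV_consS n (x : measurableTypeR R * 'rV[R]_n) (j : 'I_n) :
  rV_cons x ord0 (lift ord0 j) = x.2 ord0 j.
Proof.
rewrite /rV_cons (_ : lift ord0 j = rshift 1 j); last exact/val_inj.
by rewrite (row_mxEr (x.1%:M)).
Qed.

Lemma rV_consK n : cancel (@rV_cons n) (@rV_uncons n).
Proof.
move=> x; rewrite [RHS]surjective_pairing; congr pair; first exact: rV_cons0.
by apply/rowP => j; rewrite mxE rV_consS.
Qed.

Lemma measurable_rV_cons n : measurable_fun setT (@rV_cons n).
Proof.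
apply: measurable_fun_rVP => i; case: (unliftP ord0 i) => [j ->|->].
  under eq_fun do rewrite rV_consS.
  exact: (measurableT_comp (measurable_coord j)).
by under eq_fun do rewrite rV_cons0; exact: measurable_fst.
Qed.

Lemma measurable_rV_uncons n : measurable_fun setT (@rV_uncons n).
Proof.
apply/measurable_fun_pairP; split; first exact: measurable_coord.
apply: measurable_fun_rVP => j.
by under eq_fun do rewrite /= mxE; exact: measurable_coord.
Qed.

Section step.
Variables (n : nat) (m : {sigma_finite_measure set 'rV[R]_n -> \bar R}).

Definition lebesgue_rVS : set 'rV[R]_n.+1 -> \bar R :=
  pushforward (lebesgue_measure \x m)%E (@rV_cons n).

HB.instance Definition _ := Measure.copy lebesgue_rVS
  (measure_function_pushforward__canonical__measure_function_Measure
     (lebesgue_measure \x m)%E (@measurable_rV_cons n)).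

Let lebesgue_rVS_sigma_finite : sigma_finite setT lebesgue_rVS.
Proof.
have /sigma_finiteP[F [FT ndF Foo]] := sigma_finiteT (@lebesgue_measure R).
have /sigma_finiteP[G [GT ndG Goo]] := sigma_finiteT m.
exists (fun k => @rV_uncons n @^-1` (F k `*` G k)).
  apply/esym; rewrite -subTset => x _.
  have [i _ Fi] : (\bigcup_k F k) (rV_uncons x).1 by rewrite -FT.
  have [j _ Gj] : (\bigcup_k G k) (rV_uncons x).2 by rewrite -GT.
  exists (maxn i j) => //; split.
    by move: Fi; exact/subsetPset/ndF/leq_maxl.
  by move: Gj; exact/subsetPset/ndG/leq_maxr.
move=> k; have [mF Fk] := Foo k; have [mG Gk] := Goo k; split.
  by rewrite -[X in measurable X]setTI; apply: measurable_rV_uncons => //;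
    exact: measurableX.
rewrite /lebesgue_rVS /pushforward -comp_preimage.
rewrite (_ : _ \o _ = id) ?preimage_id; last by apply/funext; exact: rV_consK.
by rewrite product_measure1E// lte_mul_pinfty// ge0_fin_numE.
Qed.

HB.instance Definition _ := Measure_isSigmaFinite.Build _ _ _ lebesgue_rVS
  lebesgue_rVS_sigma_finite.

End step.

Fixpoint lebesgue_rV n : {sigma_finite_measure set 'rV[R]_n -> \bar R} :=
  match n with
  | 0 => dirac (0 : 'rV[R]_0)
  | n'.+1 => lebesgue_rVS (lebesgue_rV n')
  end.

Lemma lebesgue_rV_box n (A : 'I_n -> set (measurableTypeR R)) :
  (forall i, measurable (A i)) ->
  lebesgue_rV n [set x | forall i, A i (x ord0 i)] =
  (\prod_(i < n) lebesgue_measure (A i))%E.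
Proof.
elim: n A => [|n ih] A mA.
  by rewrite big_ord0 /= diracE mem_set//= => -[].
pose B := [set x : 'rV[R]_n | forall i, A (lift ord0 i) (x ord0 i)].
have mB : measurable B.
  rewrite (_ : B = \bigcap_(i in [set: 'I_n])
      ((fun x : 'rV[R]_n => x ord0 i) @^-1` A (lift ord0 i))); last first.
    by apply/seteqP; split => [x /= Bx i _|x /= Bx i]; [exact: Bx|exact: Bx].
  apply: fin_bigcap_measurable => // i _.
  by rewrite -[X in measurable X]setTI; apply: measurable_coord => //; exact: mA.
rewrite big_ord_recl -ih// -/B -product_measure1E//=.
rewrite /lebesgue_rVS /pushforward.
congr (_ _); apply/seteqP; split => [x /= Ax|x /= [Ax1 Ax2] i].
  split; first by have := Ax ord0; rewrite rV_cons0.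
  by move=> i; have := Ax (lift ord0 i); rewrite rV_consS.
by case: (unliftP ord0 i) => [j ->|->]; rewrite ?rV_consS ?rV_cons0.
Qed.

End lebesgue_rV.

Section sobolev.
Context {R : realType} {N : nat}.
Notation E := 'rV[R]_N.
Notation mu := (@lebesgue_rV R N).
Implicit Types (f g u phi : E -> R) (s : seq 'I_N) (q : R).

(* Euclidean norm; the library's norm on row vectors is the sup norm. *)
Definition enorm (x : E) : R := Num.sqrt (\sum_(i < N) x ord0 i ^+ 2).

(* The sequence s = [:: i1; ...; ik] of indices stands for the derivative
   d_i1 ... d_ik; multi-indices are thus taken with all their orderings. *)
Definition partials s f : E -> R :=
  foldr (fun i g => 'D_(delta_mx ord0 i) g) f s.

Definition smooth f := forall s,
  continuous (partials s f) /\
  forall (i : 'I_N) (x : E), derivable (partials s f) x (delta_mx ord0 i).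

Definition test_function phi :=
  smooth phi /\ compact (closure [set x | phi x != 0]).

Definition Lloc q f := measurable_fun [set: E] f /\
  forall K : set E, compact K -> finite_norm mu q%:E (f \_ K).

Definition is_weak_partial s u g := forall phi, test_function phi ->
  Rintegral mu setT (fun x => u x * partials s phi x) =
  (-1) ^+ size s * Rintegral mu setT (fun x => g x * phi x).

(* W^{k,q}_loc(R^N) *)
Definition Wloc (k : nat) q u := Lloc q u /\
  forall s, (size s <= k)%N -> exists2 g, Lloc q g & is_weak_partial s u g.

(* The weak derivative, a representative of its class modulo a.e. equality
   whenever it exists as a locally integrable function. *)
Definition weak_partial s u : E -> R :=
  get [set g | Lloc 1 g /\ is_weak_partial s u g].

Definition weak_laplacian u : E -> R :=
  fun x => \sum_(i < N) weak_partial [:: i; i] u x.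

Definition C0 f := continuous f /\
  forall e : R, 0 < e ->
    exists2 K : set E, compact K & forall x, ~ K x -> `|f x| < e.

Definition L_op (alpha : R) u : E -> R :=
  fun x => (1 + enorm x `^ alpha) * weak_laplacian u x.

(* D_{p,max}(L). For p = +oo the space is C_0(R^N), and an a.e. class belongs
   to it when it has a representative in C_0(R^N). *)
Definition Dmax (alpha : R) (p : \bar R) u : Prop :=
  match p with
  | r%:E => [/\ u \in Lfun mu r%:E, Wloc 2 r u
              & L_op alpha u \in Lfun mu r%:E]
  | +oo%E => [/\ C0 u, forall q, 1 <= q -> Wloc 2 q u
               & exists2 f, C0 f & L_op alpha u = f %[ae mu]]
  | -oo%E => False
  end.

Definition L_eigenvalue (alpha : R) (p : \bar R) (lambda : R) :=
  exists u, [/\ Dmax alpha p u, ~ (u = cst 0 %[ae mu])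
    & L_op alpha u = (fun x => lambda * u x) %[ae mu]].

End sobolev.

Definition L_first_eigenvalue {R : realType} (N : nat) (alpha : R)
    (p : \bar R) (lambda : R) :=
  @L_eigenvalue R N alpha p lambda /\
  forall l, @L_eigenvalue R N alpha p l -> l <= lambda.

(* Main.v *)
(* Suppose u is an eigenfunction for lambda, with -lambda smaller than one of
   the two bounds.  Write b = alpha/2, m = (N-2)/2, and take radial functions
   as functions of s = |x|^2, for which the Laplacian is 4 s f'' + 2 N f'.

   Below the bound there are a positive decreasing v and eta > 0 with
   Delta v - lambda v / (1+|x|^alpha) <= - eta v / (1+|x|^alpha).  For the first bound
   v = (s + eps)^(-m/2) (Hardy's inequality), combined with the maximum of
   s / (1 + s^b); for the second one v is a regularized Green potential of
   1 / (1+|x|^alpha), bounded by its value at 0, which is (1/(4m)) times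
   \int_0^oo ds / (1 + s^b) = (pi/b) / sin(pi/b).

   Near infinity, a large multiple z of s^(-m) - s^(-m-d), cut off between
   s = S and s = 2S, is a supersolution up to an error of order S^(-N/2) on
   that annulus.  Test the equation of |u| (Kato's inequality) with min(v, z),
   which has compact support: the integral of |u| over any ball is bounded by
   S^(-N/2) times its integral over the annulus, which tends to 0 as S tends
   to infinity, both for u in L^r and for u in C_0.  Hence u = 0.

   Kato's inequality is used in a discrete form: second differences of
   pairings of u with bounded functions are integrals of pairings of the weak
   second derivative, so the merely bounded function sign(u) min(v, z) is
   allowed as a test function. *)

Require Import Defs.
From HB Require Import structures.
From mathcomp Require Import all_boot all_order all_algebra.
From mathcomp Require Import all_classical all_reals all_analysis.
From mathcomp Require Import measurable_realfun ring lra.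
Set Implicit Arguments.
Unset Strict Implicit.
Unset Printing Implicit Defensive.
Import Order.TTheory GRing.Theory Num.Theory.
Import numFieldNormedType.Exports.
Local Open Scope classical_set_scope.
Local Open Scope ring_scope.

(** An eigenfunction need not be continuous and lies in no fixed Hilbert space, so that neither a
    pointwise maximum principle nor a quadratic form is at hand. Every estimate is an integral of
    |u| against a function of compact support, which treats all p alike. A weak derivative is tested
    by smooth functions only. The gap to sign(u) min(v, z) is closed by a property stable under
    bounded pointwise limits, [second_diff]: Taylor's formula with integral remainder for the map t
    -> \int u(x) psi(x + t e_i) dx. It holds for products of smooth bumps, passes to indicators by a
    pi-lambda argument, and then to all bounded measurable functions of compact support. Origin of
    the constants: s^(-m) = |x|^(2-N) is harmonic, and 4 s f'' + 2 N f' sends s^(-m/2) to - m^2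
    s^(-m/2-1), whence the factor m^2 = (N-2)^2/4. The exponent N/2 = m + 1 is both the decay rate
    of the cutoff error and the growth rate of the volume of the annulus, so smallness of u at
    infinity, in a sense common to L^r and C_0, is just enough to conclude. *)

Lemma lebesgue_measure_translate (R : realType) (v : R)
    (A : set (measurableTypeR R)) : measurable A ->
  lebesgue_measure ((fun x : R => x + v) @^-1` A) = lebesgue_measure A.
Proof.
have mv : measurable_fun setT (fun x : measurableTypeR R => (x + v : measurableTypeR R)).
  exact: measurable_funD.
move=> mA; apply/esym.
apply: (lebesgue_measure_unique (mu := measure_function_pushforward__canonical__measure_function_Measure lebesgue_measure mv)) => //.
move=> X [[a b] _ <-]; rewrite /= /pushforward.
rewrite (_ : _ @^-1` _ = `]a - v, b - v]%classic); last first.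
  by apply/seteqP; split => x /=; rewrite !in_itv/= ltrBlDr lerBrDr.
rewrite !lebesgue_measure_itv /= !lte_fin ltrD2r.
by case: ifP => // _; rewrite -!EFinB; congr EFin; ring.
Qed.

(** * Boxes, cubes and translation invariance of Lebesgue measure on R^N *)

Section translation.
Context {R : realType} {N : nat}.
Notation E := 'rV[R]_N.
Notation mu := (@lebesgue_rV R N).

Definition box_sets (P : set (set (measurableTypeR R))) : set (set E) :=
  [set B | exists2 A : 'I_N -> set (measurableTypeR R), (forall i, P (A i)) &
     B = [set x : E | forall i, A i (x ord0 i)]].

Lemma box_sets_setI P : setI_closed P -> setI_closed (box_sets P).
Proof.
move=> PI _ _ [A PA ->] [B PB ->]; exists (fun i => A i `&` B i).
  by move=> i; exact: PI.
by apply/seteqP; split => x /=; [move=> [a b] i|move=> h; split => i; have [] := h i].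
Qed.

Lemma measurable_boxE (A : 'I_N -> set (measurableTypeR R)) :
  (forall i, measurable (A i)) -> measurable [set x : E | forall i, A i (x ord0 i)].
Proof.
move=> mA; rewrite (_ : mkset _ = \bigcap_(i in [set: 'I_N])
      ((fun x : E => x ord0 i) @^-1` A i)); last first.
  by apply/seteqP; split => [x /= Bx i _|x /= Bx i]; [exact: Bx|exact: Bx].
apply: fin_bigcap_measurable => // i _.
by rewrite -[X in measurable X]setTI; apply: measurable_coord => //; exact: mA.
Qed.

Definition cube (r : R) : set E := [set x : E | forall i, `[-r, r]%classic (x ord0 i)].

Lemma cubeP r x : cube r x <-> forall i, `|x ord0 i| <= r.
Proof. by split => h i; have := h i; rewrite /= in_itv/= ler_norml. Qed.

Lemma measurable_cube r : measurable (cube r).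
Proof. by apply: (measurable_boxE (A := fun=> _)) => i; exact: measurable_itv. Qed.

Lemma lebesgue_rV_cube r : 0 <= r -> mu (cube r) = ((2 * r) ^+ N)%:E.
Proof.
move=> r0; rewrite /cube (lebesgue_rV_box (A := fun=> `[-r, r]%classic))//.
rewrite (eq_bigr (fun=> (2 * r)%:E)); last first.
  move=> i _; rewrite lebesgue_measure_itv/= lte_fin.
  by case: ltP => h; rewrite -?EFinB; congr EFin; lra.
by rewrite prodEFin prodr_const card_ord.
Qed.

Lemma cube_fin r : (mu (cube r) < +oo)%E.
Proof.
have [r0|r0] := leP 0 r; first by rewrite lebesgue_rV_cube// ltry.
have m0 : (mu (cube r) <= mu (cube 0))%E.
  apply: le_measure; rewrite ?inE; try exact: measurable_cube.
  move=> x /cubeP h; apply/cubeP => i; exact: le_trans (h i) (ltW r0).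
by apply: le_lt_trans m0 _; rewrite lebesgue_rV_cube// ltry.
Qed.

(** A coordinate cylinder is a countable union of boxes whose other sides exhaust the line, which is
    what the sequence F is for. Applied to all Borel sides (translation invariance) and to open rays
    (approximation by smooth bumps). *)
Lemma measurable_rV_box_sets P : P `<=` measurable ->
  (exists2 F : nat -> set (measurableTypeR R), (forall n, P (F n)) &
     nondecreasing_seq F /\ \bigcup_n F n = setT) ->
  (@measurable _ (measurableTypeR R)) = <<s P >> ->
  (@measurable _ E) = <<s (box_sets P) >>.
Proof.
move=> mP [F PF [ndF FT]] PE; apply/seteqP; split; last first.
  apply: smallest_sub; first exact: sigma_algebra_measurable.
  by move=> _ [A PA ->]; apply: measurable_boxE => i; exact: mP.
apply: smallest_sub; first exact: smallest_sigma_algebra.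
rewrite -bigcup_seq /= => B [i _ [Y mY <-{B}]].
rewrite setTI.
suff : @measurable _ (measurableTypeR R) `<=`
    [set Y | <<s box_sets P >> ((fun x : E => x ord0 i) @^-1` Y)] by exact.
rewrite PE; apply: smallest_sub.
  split => /=.
  - by rewrite preimage_set0; exact: sigma_algebra0.
  - by move=> A hA; rewrite setTD -preimage_setC; exact: sigma_algebraC.
  - by move=> A hA; rewrite preimage_bigcup; exact: sigma_algebra_bigcup.
move=> A PA /=.
rewrite (_ : _ @^-1` _ = \bigcup_n [set x : E | forall j,
   (if j == i then A else F n) (x ord0 j)]).
  apply: sigma_algebra_bigcup => n; apply: sub_sigma_algebra.
  exists (fun j => if j == i then A else F n) => // j.
  by case: ifP.
apply/seteqP; split => [x /= Ax|x [n _ /(_ i)]]; last by rewrite eqxx.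
have h j : exists n, F n (x ord0 j).
  by have [n _ Fn] : (\bigcup_n F n) (x ord0 j); [rewrite FT|exists n].
have [f hf] := choice h.
(* One index serves all coordinates because F is nondecreasing. *)
exists (\max_j f j)%N => // j; case: eqP => [->//|_].
by have /subsetPset := ndF _ _ (leq_bigmax (F:=f) j); apply; exact: hf.
Qed.

Lemma measurable_translate (v : E) : measurable_fun setT (fun x : E => x + v).
Proof.
apply: measurable_fun_rVP => i; under eq_fun do rewrite mxE.
by apply: measurable_funD => //; exact: measurable_coord.
Qed.

(** Uniqueness of measures on the pi-system of boxes with Borel sides: on a box the claim reduces to
    the line, and cubes of finite measure exhaust the space. *)
Lemma lebesgue_rV_translate (v : E) (A : set E) : measurable A ->
  mu ((fun x => x + v) @^-1` A) = mu A.
Proof.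
move=> mA; apply/esym.
pose m2 := measure_function_pushforward__canonical__measure_function_Measure mu
  (measurable_translate v).
pose P := @measurable _ (measurableTypeR R).
pose F n := `[-(n%:R : R), n%:R]%classic : set (measurableTypeR R).
have FT : \bigcup_n F n = setT.
  rewrite -subTset => x _; exists (Num.truncn `|x|).+1 => //=.
  by rewrite /F /= in_itv/= -ler_norml; exact/ltW/truncnS_gt.
have ndF : nondecreasing_seq F.
  move=> m n mn; apply/subsetPset => x; rewrite /F /= !in_itv/= => /andP[a b].
  have mnR : (m%:R : R) <= n%:R by rewrite ler_nat.
  by apply/andP; split; lra.
have mF n : P (F n) by exact: measurable_itv.
apply: (measure_unique (box_sets P) (fun n => [set x : E | forall i, F n (x ord0 i)]) _ _ _ _ mu m2) => //.
- apply: measurable_rV_box_sets => //; first by exists F.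
  by rewrite sigma_algebra_id//; exact: sigma_algebra_measurable.
- by apply: box_sets_setI; move=> ? ?; exact: measurableI.
- by move=> n; exists (fun=> F n).
- rewrite -subTset => x _.
  have h j : exists n, F n (x ord0 j).
    by have [n _ Fn] : (\bigcup_n F n) (x ord0 j); [rewrite FT|exists n].
  have [f hf] := choice h.
  exists (\max_j f j)%N => // j.
  by have /subsetPset := ndF _ _ (leq_bigmax (F:=f) j); apply; exact: hf.
- move=> _ [B mB ->]; rewrite /m2 /= /pushforward.
  rewrite (_ : _ @^-1` _ = [set x : E | forall i,
     ((fun t : R => t + v ord0 i) @^-1` B i) (x ord0 i)]); last first.
    by apply/seteqP; split => x /= h i; have := h i; rewrite mxE.
  rewrite lebesgue_rV_box// (lebesgue_rV_box
    (A := fun i => (fun t : R => t + v ord0 i) @^-1` B i)).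
    by apply: eq_bigr => i _; rewrite lebesgue_measure_translate//; exact: mB.
  move=> i; rewrite -[X in measurable X]setTI.
  by apply: (measurable_funD (f:=id) (g:=cst (v ord0 i))) => //; exact: mB.
- by move=> n; exact: cube_fin.
Qed.

End translation.

(** * Smooth test functions *)

Section calculus.
Context {R : realType}.
Implicit Types (f g : R -> R) (x d C : R).

Lemma is_derive1_add f g x a b : is_derive x 1 f a -> is_derive x 1 g b ->
  is_derive x 1 (fun t => f t + g t) (a + b).
Proof. by move=> fa gb; exact: (is_deriveD fa gb). Qed.

Lemma is_derive1_sub f g x a b : is_derive x 1 f a -> is_derive x 1 g b ->
  is_derive x 1 (fun t => f t - g t) (a - b).
Proof. by move=> fa gb; exact: (is_deriveB fa gb). Qed.

Lemma is_derive1_mul f g x a b : is_derive x 1 f a -> is_derive x 1 g b ->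
  is_derive x 1 (fun t => f t * g t) (f x * b + g x * a).
Proof. by move=> fa gb; exact: (is_deriveM fa gb). Qed.

Lemma is_derive1_scale f c x a : is_derive x 1 f a ->
  is_derive x 1 (fun t => c * f t) (c * a).
Proof. by move=> fa; exact: (is_deriveZ c fa). Qed.

Lemma is_derive1_exp f n x a : is_derive x 1 f a ->
  is_derive x 1 (fun t => f t ^+ n) (n%:R * f x ^+ n.-1 * a).
Proof.
move=> fa; elim: n => [|n IH].
  rewrite !mul0r; under eq_fun do rewrite expr0; exact: is_derive_cst.
have D := is_derive1_mul fa IH.
under eq_fun do rewrite exprS.
apply: (is_derive_eq D).
by case: n {IH D} => [|n]; rewrite /= ?exprS -[in RHS]natr1; ring.
Qed.

Lemma is_derive1_compf f g x a b : is_derive (g x) 1 f a -> is_derive x 1 g b ->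
  is_derive x 1 (fun t => f (g t)) (a * b).
Proof. by move=> fa gb; exact: (is_derive1_comp fa gb). Qed.

Lemma is_derive1_inv f x a : f x != 0 -> is_derive x 1 f a ->
  is_derive x 1 (fun t => (f t)^-1) (- (f x) ^- 2 * a).
Proof. by move=> f0 fa; exact: (is_deriveV f0 fa). Qed.

Lemma is_derive1_expR f x a : is_derive x 1 f a ->
  is_derive x 1 (fun t => expR (f t)) (expR (f x) * a).
Proof. by move=> fa; apply: is_derive1_compf fa; exact: is_derive_expR. Qed.

Lemma is_derive1_affine c d x : is_derive x 1 (fun t => c * t + d) c.
Proof.
apply: (is_derive_eq (is_derive1_add (is_derive1_scale c (is_derive_id x 1)) (is_derive_cst d x 1))).
by rewrite mulr1 addr0.
Qed.

(** A quadratic remainder handles the functions to which no differentiation rule applies: those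
    glued at 0 ([flat], [ramp]) and those given by an integral ([pairing]). *)
Lemma is_derive_quadratic f x d C :
  (forall h, `|h| < 1 -> `|f (x + h) - f x - d * h| <= C * h ^+ 2) ->
  is_derive x 1 f d.
Proof.
move=> H.
have C0 : 0 <= C.
  have := H (1/2); rewrite ger0_norm; last lra.
  move=> /(_ ltac:(lra)) h; have := le_trans (normr_ge0 _) h.
  by rewrite pmulr_lge0// exprn_gt0//; lra.
have L : h^-1 *: (f (h *: 1 + x) - f x) @[h --> 0^'] --> d.
  apply/cvgrPdist_le => e e0; near=> h.
  have h0 : h != 0 by near: h; exact: nbhs_dnbhs_neq.
  have h1 : `|h| < 1 by near: h; apply: dnbhs0_lt.
  have he : `|h| <= e / (C + 1) by near: h; apply: dnbhs0_le; rewrite divr_gt0//; lra.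
  have := H h h1; rewrite -[h *: 1]/(h * 1) -[_ *: (_ - _)]/(_ * _) mulr1 (addrC h).
  move=> K.
  have -> : d - h^-1 * (f (x + h) - f x) = - (h^-1 * (f (x + h) - f x - d * h)).
    by field.
  rewrite normrN normrM normfV mulrC ler_pdivrMr ?normr_gt0//.
  apply: le_trans K _; rewrite -(real_normK (num_real h)) expr2 mulrA ler_wpM2r//.
  move: he; rewrite ler_pdivlMr; last lra.
  by move=> he; have := normr_ge0 h; nra.
by split; [apply/cvg_ex; exists d|exact/cvg_lim].
Unshelve. all: by end_near. Qed.

(** The factor t^-m makes the usual exp(-1/t) part of a family whose span is closed under
    differentiation, see [is_derive_flat]. *)
Definition flat (m : nat) (t : R) : R :=
  if 0 < t then t^-1 ^+ m * expR (- t^-1) else 0.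

Lemma flat_ge0 m t : 0 <= flat m t.
Proof.
rewrite /flat; case: ltP => // t0; rewrite mulr_ge0 ?expR_ge0//.
by rewrite exprn_ge0// invr_ge0 ltW.
Qed.

(** From exp(y) >= (y/n)^n with n = m + 2 and y = 1/t: after cancellation with t^-m a factor t^2 is
    left. *)
Lemma flat_quadratic m t : flat m t <= (m.+2)%:R ^+ m.+2 * t ^+ 2.
Proof.
rewrite /flat; case: ltP => t0; last by rewrite mulr_ge0 ?sqr_ge0// exprn_ge0.
set n := (m.+2)%:R : R; have n0 : 0 < n by rewrite ltr0n.
have y0 : 0 < t^-1 by rewrite invr_gt0.
have H : (t^-1 / n) ^+ m.+2 <= expR (t^-1).
  rewrite [X in expR X](_ : _ = m.+2%:R * (t^-1 / n)); last by rewrite mulrC divfK ?gt_eqF.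
  rewrite expRM_natl.
  rewrite lerXn2r// ?nnegrE ?expR_ge0//; first by rewrite divr_ge0// ltW.
  by apply: le_trans (expR_ge1Dx _); rewrite lerDr.
rewrite expRN -[leLHS]/(_ / _) ler_pdivrMr ?expR_gt0//.
have n1 : 0 < n ^+ m.+2 by rewrite exprn_gt0.
apply: (@le_trans _ _ (n ^+ m.+2 * t ^+ 2 * (t^-1 / n) ^+ m.+2)); last first.
  by rewrite ler_wpM2l// mulr_ge0 ?sqr_ge0// ltW.
rewrite mulrAC -exprMn (mulrC n) divfK ?gt_eqF//.
by rewrite -[m.+2]addn2 exprD -mulrA -exprMn mulVf ?gt_eqF// expr1n mulr1.
Qed.

Lemma is_derive_flat m (t : R) :
  is_derive t 1 (flat m) (flat m.+2 t - m%:R * flat m.+1 t).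
Proof.
have [t0|t0|<-] := ltgtP 0 t.
- rewrite /flat t0.
  have -> : t^-1 ^+ m.+2 * expR (- t^-1) - m%:R * (t^-1 ^+ m.+1 * expR (- t^-1)) =
    t^-1 ^+ m * (expR (- t^-1) * (t^-1 ^+ 2)) + expR (- t^-1) * (m%:R * t^-1 ^+ m.-1 * (- t^-1 ^+ 2)).
    case: m => [|m]; first by rewrite !mul0r !expr0; ring.
    by rewrite /= !exprS; ring.
  apply: (@near_eq_is_derive R R R (fun t : R => t^-1 ^+ m * expR (- t^-1))).
  + near=> s; have -> // : 0 < s.
    by near: s; exact: lt_nbhsr.
  + have tn : t != 0 by rewrite gt_eqF.
    have DV := is_derive1_inv tn (is_derive_id t 1).
    apply: (is_derive_eq (is_derive1_mul (is_derive1_exp m DV) (is_derive1_expR (is_deriveN DV)))).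
    by rewrite -!exprVn; ring.
- rewrite /flat ltNge (ltW t0)/= mulr0 subr0.
  apply: (@near_eq_is_derive R R R (cst 0)).
  + near=> s; rewrite ltNge; have -> // : s <= 0.
    by near: s; exact: (filterS (fun y => @ltW _ _ y 0) (lt_nbhsl t0)).
- rewrite {2 3}/flat ltxx mulr0 subr0.
  apply: (is_derive_quadratic (C := (m.+2)%:R ^+ m.+2)) => h _.
  rewrite add0r mul0r subr0 {2}/flat ltxx subr0 ger0_norm ?flat_ge0//.
  exact: flat_quadratic.
Unshelve. all: by end_near. Qed.

(* A class of functions closed under differentiation, whose members are
   therefore infinitely differentiable. *)
Inductive bumpalg : (R -> R) -> Prop :=
| bumpalg_flat m c d : bumpalg (fun t => flat m (c * t + d))
| bumpalg_cst c : bumpalg (cst c)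
| bumpalg_add f g : bumpalg f -> bumpalg g -> bumpalg (f \+ g)
| bumpalg_mul f g : bumpalg f -> bumpalg g -> bumpalg (f \* g).

Lemma bumpalg_derive f : bumpalg f ->
  exists2 g, bumpalg g & forall t : R, is_derive t 1 f (g t).
Proof.
elim=> {f} [m c d|c|f g bf [f' bf' ff'] bg [g' bg' gg']|f g bf [f' bf' ff'] bg [g' bg' gg']].
- exists (cst c \* ((fun t => flat m.+2 (c * t + d)) \+
      (cst (- m%:R) \* (fun t => flat m.+1 (c * t + d))))).
    by do ! (apply: bumpalg_add || apply: bumpalg_mul || apply: bumpalg_flat || apply: bumpalg_cst).
  move=> t /=.
  apply: (is_derive_eq (@is_derive1_compf (flat m) (fun t => c * t + d) t _ _ (is_derive_flat m (c * t + d)) (is_derive1_affine c d t))).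
  by ring.
- by exists (cst 0); [exact: bumpalg_cst|move=> t; exact: is_derive_cst].
- exists (f' \+ g'); first exact: bumpalg_add.
  by move=> t; exact: is_derive1_add.
- exists ((f \* g') \+ (g \* f')).
    by do ! (apply: bumpalg_add || apply: bumpalg_mul).
  by move=> t; exact: is_derive1_mul.
Qed.

Lemma bumpalg_family f : bumpalg f ->
  exists F : nat -> R -> R, F 0 = f /\
    forall n (t : R), is_derive t 1 (F n) (F n.+1 t).
Proof.
move=> bf.
have H (p : {f | bumpalg f}) : exists q : {f | bumpalg f},
    forall t : R, is_derive t 1 (sval p) (sval q t).
  by case: p => p bp /=; have [q bq pq] := bumpalg_derive bp; exists (exist _ q bq).
have [D hD] := choice H.
by exists (fun n => sval (iter n D (exist _ f bf))); split.
Qed.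

(* F n is the n-th derivative of F 0, and all of them vanish off [-r, r]. *)
Definition cutfam (r : R) (F : nat -> R -> R) :=
  (forall n (t : R), is_derive t 1 (F n) (F n.+1 t)) /\
  (forall n t, r < `|t| -> F n t = 0).

Lemma is_derive_continuous f x a : is_derive x 1 f a -> {for x, continuous f}.
Proof.
by move=> [fx _]; apply: differentiable_continuous; exact/derivable1_diffP.
Qed.

Lemma cutfam_continuous r F n : cutfam r F -> continuous (F n).
Proof. by move=> [dF _] x; exact: is_derive_continuous (dF n x). Qed.

Lemma cutfam_bounded r F n : cutfam r F -> exists C, forall t, `|F n t| <= C.
Proof.
move=> [dF F0].
wlog r0 : r F0 / 0 <= r.
  move=> W; apply: (W `|r|) => // m t; rewrite ltNge => h; apply: F0.
  by rewrite ltNge; apply: contra h => /le_trans; apply; exact: ler_norm.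
have cF : {within `[-r, r], continuous (fun t => `|F n t|)}.
  apply: continuous_subspaceT => x; apply: continuous_comp; last exact: norm_continuous.
  exact: is_derive_continuous (dF n x).
have [c _ hc] := EVT_max (ltac:(lra) : -r <= r) cF.
exists `|F n c| => t; have [translate|translate] := leP `|t| r.
  by apply: hc; rewrite in_itv/= -ler_norml.
by rewrite F0// normr0.
Qed.

Lemma cutfam_of_bump (r : R) f : bumpalg f ->
  (forall t, r < `|t| -> f t = 0) -> exists2 F, cutfam r F & F 0 = f.
Proof.
move=> bf f0; have [F [F0 dF]] := bumpalg_family bf.
exists F => //; split => //; elim=> [|n IH] t rt; first by rewrite F0 f0.
have [dn <-] := dF n t.
have -> : 'D_1 (F n) t = 'D_1 (cst 0 : R -> R) t.
  apply: near_eq_derive; near=> s; rewrite IH//.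
  near: s; exact: (cvgr_gt _ (@norm_continuous _ R t) _ rt).
by rewrite derive_cst.
Unshelve. all: by end_near. Qed.

(** The scaling by n + 1 pushes exp(-1/t) up to 1, so these smooth functions with values in [0, 1]
    tend pointwise to the indicator of the open interval from a to b. *)
Definition flat_bump (n : nat) (a b t : R) : R :=
  flat 0 (n.+1%:R * (t - a)) * flat 0 (n.+1%:R * (b - t)).

Lemma bumpalg_bump n a b : bumpalg (flat_bump n a b).
Proof.
have -> : flat_bump n a b =
   (fun t => flat 0 (n.+1%:R * t + (- (n.+1%:R * a)))) \*
   (fun t => flat 0 (- n.+1%:R * t + n.+1%:R * b)).
  by apply/funext => t; rewrite /flat_bump /=; congr (flat _ _ * flat _ _); ring.
by apply: bumpalg_mul; exact: bumpalg_flat.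
Qed.

Lemma flat0_le1 t : flat 0 t <= 1.
Proof.
rewrite /flat; case: ltP => // t0; rewrite expr0 mul1r -expR0 ler_expR.
by rewrite oppr_le0 invr_ge0 ltW.
Qed.

Lemma bump_bound n a b t : 0 <= flat_bump n a b t <= 1.
Proof. by rewrite mulr_ge0 ?flat_ge0//= mulr_ile1 ?flat_ge0 ?flat0_le1. Qed.

Lemma bump_out n a b t : ~~ (a < t < b) -> flat_bump n a b t = 0.
Proof.
rewrite /flat_bump /flat => h.
have [at_|at_] := ltP a t; last first.
  by rewrite pmulr_rgt0// subr_gt0 ltNge at_/= mul0r.
have [bt|bt] := ltP t b; first by rewrite at_ bt in h.
by rewrite [X in _ * X]ifF ?mulr0// pmulr_rgt0// subr_gt0 ltNge bt.
Qed.

Lemma cvg_flat0 (t : R) : 0 < t -> (flat 0 (n.+1%:R * t)) @[n --> \oo] --> (1 : R).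
Proof.
move=> t0.
have -> : (fun n : nat => flat 0 (n.+1%:R * t)) = (fun n : nat => expR (- (n.+1%:R^-1 * t^-1))).
  by apply/funext => n; rewrite /flat pmulr_rgt0 ?ltr0n// t0 expr0 mul1r invfM.
rewrite -[X in _ --> X](_ : expR (- (0 * t^-1)) = 1); last by rewrite mul0r oppr0 expR0.
apply: (@continuous_cvg _ _ _ _ _ _ expR); [exact: continuous_expR|]; apply: cvgN; apply: cvgMl; exact: cvg_harmonic.
Qed.

Lemma cvg_bump a b t :
  flat_bump n a b t @[n --> \oo] --> (if a < t < b then 1 else 0 : R).
Proof.
case: ifPn => [/andP[at_ tb]|h]; last first.
  by rewrite (_ : (fun n => _) = cst 0); [exact: cvg_cst|apply/funext => n; rewrite bump_out].
rewrite -[X in _ --> X]mulr1; apply: cvgM; apply: cvg_flat0; by rewrite subr_gt0.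
Qed.

End calculus.

Section tensor.
Context {R : realType} {N : nat}.
Notation E := 'rV[R]_N.

Lemma is_derive_line (f : E -> R) (x v : E) (d : R) :
  is_derive (0 : R) 1 (fun t : R => f (x + t *: v)) d -> is_derive x v f d.
Proof.
have e : (fun h : R => h^-1 *: (f (x + (h *: 1 + 0) *: v) - f (x + 0 *: v))) =
    (fun h : R => h^-1 *: (f (h *: v + x) - f x)).
  by apply/funext => h; rewrite addr0 scale0r addr0 [h *: 1]mulr1 (addrC x).
move=> [fx <-]; split; first by move: fx; rewrite /derivable /= e.
by rewrite /derive /= e.
Qed.

(** Recording the order of differentiation in each variable makes every partial derivative again a
    function of this form, so that smoothness follows by induction from one-variable calculus. *)
Definition tens (F : 'I_N -> nat -> R -> R) (m : 'I_N -> nat) (x : E) : R :=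
  \prod_j F j (m j) (x ord0 j).

Definition incr (i : 'I_N) (m : 'I_N -> nat) (j : 'I_N) := if j == i then (m j).+1 else m j.

Lemma line_coord (x : E) (t : R) i j :
  (x + t *: delta_mx ord0 i) ord0 j = x ord0 j + (if j == i then t else 0).
Proof. by rewrite !mxE eqxx /= eq_sym; case: eqP => _; rewrite ?mulr1 ?mulr0. Qed.

Lemma tens_line F m i x t : tens F m (x + t *: delta_mx ord0 i) =
  F i (m i) (x ord0 i + t) * \prod_(j | j != i) F j (m j) (x ord0 j).
Proof.
rewrite /tens (bigD1 i)//= line_coord eqxx; congr (_ * _).
by apply: eq_bigr => j ji; rewrite line_coord (negbTE ji) addr0.
Qed.

Variables (r : R) (F : 'I_N -> nat -> R -> R).
Hypothesis hF : forall i, cutfam r (F i).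

Lemma is_derive_tens_line m i x (t : R) :
  is_derive t 1 (fun t : R => tens F m (x + t *: delta_mx ord0 i))
    (tens F (incr i m) (x + t *: delta_mx ord0 i)).
Proof.
under eq_fun do rewrite tens_line; rewrite tens_line.
have D1 : is_derive t 1 (fun t => x ord0 i + t) 1.
  apply: (is_derive_eq (is_derive1_add (is_derive_cst (x ord0 i) t 1) (is_derive_id t 1))).
  by rewrite add0r.
have [dF _] := hF i.
have D2 := @is_derive1_compf _ (F i (m i)) (fun t => x ord0 i + t) t _ _ (dF (m i) _) D1.
apply: (is_derive_eq (is_derive1_mul D2 (is_derive_cst _ t 1))).
rewrite mulr0 add0r mulr1 mulrC /incr eqxx; congr (_ * _).
by apply: eq_bigr => j /negbTE ->.
Qed.

Lemma is_derive_tens m i x :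
  is_derive x (delta_mx ord0 i) (tens F m) (tens F (incr i m) x).
Proof.
apply: is_derive_line; have := is_derive_tens_line m i x 0.
by rewrite scale0r addr0.
Qed.

Lemma continuous_tens m : continuous (tens F m).
Proof.
rewrite /tens; elim: (index_enum _) => [|j s IH] x.
  have -> : (fun x : E => \prod_(i <- [::]) F i (m i) (x ord0 i)) = cst 1.
    by apply/funext => y; rewrite big_nil.
  exact: cst_continuous.
have -> : (fun x : E => \prod_(i <- j :: s) F i (m i) (x ord0 i)) =
    (fun x => F j (m j) (x ord0 j) * \prod_(i <- s) F i (m i) (x ord0 i)).
  by apply/funext => y; rewrite big_cons.
apply: (@continuousM _ _ (fun x : E => F j (m j) (x ord0 j))); last exact: IH.
apply: (@continuous_comp _ _ _ (fun x : E => x ord0 j)); first exact: coord_continuous.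
exact: cutfam_continuous (hF j) _.
Qed.

Lemma partials_tens s m : exists m', partials s (tens F m) = tens F m'.
Proof.
elim: s => [|i s [m' IH]]; first by exists m.
exists (incr i m') => /=; rewrite IH; apply/funext => x.
by have [_ ->] := is_derive_tens m' i x.
Qed.

Lemma partials2_tens i m : partials [:: i; i] (tens F m) = tens F (incr i (incr i m)).
Proof.
rewrite /partials /=; apply/funext => x.
rewrite (_ : 'D__ (tens F m) = tens F (incr i m)).
  by have [_ ->] := is_derive_tens (incr i m) i x.
by apply/funext => y; have [_ ->] := is_derive_tens m i y.
Qed.

Lemma tens_out m x : ~ cube r x -> tens F m x = 0.
Proof.
move=> h; have [j hj] : exists j, ~ (`|x ord0 j| <= r).
  by apply/existsNP => K; apply: h; apply/cubeP.
have [_ F0] := hF j.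
by rewrite /tens (bigD1 j)//= F0 ?mul0r// ltNge; apply/negP.
Qed.

Lemma compact_cube : compact (cube r : set E).
Proof. by apply: (@rV_compact R N (fun=> `[-r, r]%classic)) => i; exact: segment_compact. Qed.

Lemma closed_cube : closed (cube r : set E).
Proof.
exact: (compact_closed (@norm_hausdorff _ _) compact_cube).
Qed.

Lemma test_function_tens m : test_function (tens F m).
Proof.
split.
  move=> s; have [m' ->] := partials_tens s m; split; first exact: continuous_tens.
  by move=> i x; have [] := is_derive_tens m' i x.
apply: (subclosed_compact (@closed_closure _ _) compact_cube).
rewrite [X in _ `<=` X]((closure_id _).1 closed_cube).
apply: closureS => x /= /eqP h; apply: contrapT => /tens_out.
by move=> /(_ m).
Qed.

Lemma tens_bounded m : exists C, forall x, `|tens F m x| <= C.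
Proof.
have [C hC] := choice (fun j => cutfam_bounded (m j) (hF j)).
exists (\prod_j C j) => x; rewrite /tens normr_prod.
by apply: ler_prod => j _; rewrite normr_ge0 /= hC.
Qed.

Lemma measurable_tens m : measurable_fun setT (tens F m).
Proof.
rewrite /tens; apply: measurable_prod => j _.
apply: (@measurableT_comp _ _ _ _ _ _ (F j (m j))); last exact: measurable_coord.
by apply: continuous_measurable_fun; exact: cutfam_continuous (hF j).
Qed.

End tensor.

(** * Local integrability *)

Section real_integrals.
Context d (T : measurableType d) {R : realType} (m : {measure set T -> \bar R}).

Lemma le_integrableR (f g : T -> R) : measurable_fun setT f ->
  (forall x, `|f x| <= g x) -> m.-integrable setT (EFin \o g) ->
  m.-integrable setT (EFin \o f).
Proof.
move=> mf fg; apply: le_integrable => //; first exact/measurable_EFinP.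
by move=> x _ /=; rewrite lee_fin (le_trans (fg x))// ler_norm.
Qed.

Lemma integrableR_norm (f : T -> R) : m.-integrable setT (EFin \o f) ->
  m.-integrable setT (EFin \o (fun x => `|f x|)).
Proof. exact: integrable_norm. Qed.

Lemma integrableRD (f g : T -> R) : m.-integrable setT (EFin \o f) ->
  m.-integrable setT (EFin \o g) -> m.-integrable setT (EFin \o (fun x => f x + g x)).
Proof. by move=> hf hg; exact: (integrableD measurableT hf hg). Qed.

Lemma integrableRB (f g : T -> R) : m.-integrable setT (EFin \o f) ->
  m.-integrable setT (EFin \o g) -> m.-integrable setT (EFin \o (fun x => f x - g x)).
Proof. by move=> hf hg; exact: (integrableB measurableT hf hg). Qed.

Lemma integrableRZ c (f : T -> R) : m.-integrable setT (EFin \o f) ->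
  m.-integrable setT (EFin \o (fun x => c * f x)).
Proof. by move=> hf; exact: (integrableZl measurableT c hf). Qed.

Lemma integrableR_sum (I : Type) (s : seq I) (f : I -> T -> R) :
  (forall i, m.-integrable setT (EFin \o f i)) ->
  m.-integrable setT (EFin \o (fun x => \sum_(i <- s) f i x)).
Proof.
move=> hf; elim: s => [|i s IH].
  rewrite (_ : _ \o _ = cst 0%E); first exact: integrable0.
  by apply/funext => x /=; rewrite big_nil.
rewrite (_ : _ \o _ = EFin \o (fun x => f i x + \sum_(j <- s) f j x)).
  exact: integrableRD.
by apply/funext => x /=; rewrite big_cons.
Qed.

Lemma Rintegral_sum (I : Type) (s : seq I) (f : I -> T -> R) :
  (forall i, m.-integrable setT (EFin \o f i)) ->
  \int[m]_x (\sum_(i <- s) f i x) = \sum_(i <- s) \int[m]_x f i x.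
Proof.
move=> hf; elim: s => [|i s IH].
  under eq_Rintegral do rewrite big_nil.
  by rewrite big_nil /Rintegral integral0.
under eq_Rintegral do rewrite big_cons.
rewrite big_cons RintegralD//; first by rewrite IH.
exact: (integrableR_sum s hf).
Qed.

Lemma Rintegral_dominated (f_ : nat -> T -> R) (f g : T -> R) :
  (forall n, measurable_fun setT (f_ n)) -> (forall x, f_ n x @[n --> \oo] --> f x) ->
  m.-integrable setT (EFin \o g) -> (forall n x, `|f_ n x| <= g x) ->
  \int[m]_x f_ n x @[n --> \oo] --> \int[m]_x f x.
Proof.
move=> mf cf ig fg.
have mf' : measurable_fun setT f by apply: (measurable_fun_cvg mf) => x _; exact: cf.
have c1 : {ae m, forall x, setT x -> (EFin \o f_ n) x @[n --> \oo] --> (EFin \o f) x}.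
  by apply: aeW => x _; apply: cvg_EFin; [exact: nearW|exact: cf].
have c2 : {ae m, forall x n, setT x -> (`|(EFin \o f_ n) x| <= (EFin \o g) x)%E}.
  by apply: aeW => x n _; rewrite /= lee_fin.
have [_ _ h] := dominated_convergence measurableT
  (fun n => (measurable_EFinP _ _).2 (mf n)) ((measurable_EFinP _ _).2 mf') c1 ig c2.
apply: (fine_cvg (f := fun n => \int[m]_x (f_ n x)%:E)%E).
rewrite fineK//; apply: integrable_fin_num => //.
apply: (le_integrableR mf' _ ig) => x.
have cn : `|f_ n x| @[n --> \oo] --> `|f x| by apply: cvg_norm; exact: cf.
rewrite -(cvg_lim (@Rhausdorff R) cn); apply: limr_le; first exact: cvgP cn.
by apply: nearW => n; exact: fg.
Qed.

Lemma Rintegral0 : \int[m]_x (0 : R) = 0.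
Proof. by rewrite /Rintegral integral0. Qed.

Lemma Rintegral_ae_eq (f g : T -> R) : measurable_fun setT f -> measurable_fun setT g ->
  f = g %[ae m] -> \int[m]_x f x = \int[m]_x g x.
Proof.
move=> mf mg fg; congr fine; apply: ae_eq_integral => //; try exact/measurable_EFinP.
by apply: filterS fg => x h _ /=; rewrite h.
Qed.

End real_integrals.

Section local_integrability.
Context {R : realType} {N : nat}.
Notation E := 'rV[R]_N.
Notation mu := (@lebesgue_rV R N).
Implicit Types (u g psi : E -> R) (r C t e : R).

(** L^1_loc in the form used below: cubes are measurable, have finite measure and exhaust the
    space. *)
Definition locint u := measurable_fun setT u /\
  forall r, mu.-integrable (cube r) (EFin \o u).

Definition bdd r C psi := [/\ measurable_fun setT psi,
  forall x, `|psi x| <= C & forall x, ~ cube r x -> psi x = 0].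

Definition translate (i : 'I_N) t psi : E -> R := fun x => psi (x + t *: delta_mx ord0 i).

Lemma bdd_ge0 r C psi : bdd r C psi -> 0 <= C.
Proof. by move=> [_ h _]; exact: le_trans (h 0). Qed.

Lemma bddW r r' C C' psi : r <= r' -> C <= C' -> bdd r C psi -> bdd r' C' psi.
Proof.
move=> rr CC [mp p1 p2]; split => // [x|x h]; first exact: le_trans (p1 x) _.
apply: p2 => /cubeP k; apply: h; apply/cubeP => i; exact: le_trans (k i) _.
Qed.

Lemma bddD r C C' psi psi' : bdd r C psi -> bdd r C' psi' ->
  bdd r (C + C') (fun x => psi x + psi' x).
Proof.
move=> [m1 a1 b1] [m2 a2 b2]; split.
- exact: measurable_funD.
- by move=> x; rewrite (le_trans (ler_normD _ _))// lerD.
- by move=> x h; rewrite b1// b2// addr0.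
Qed.

Lemma bddZ r C c psi : bdd r C psi -> bdd r (`|c| * C) (fun x => c * psi x).
Proof.
move=> [m1 a1 b1]; split.
- exact: measurable_funM.
- by move=> x; rewrite normrM ler_wpM2l.
- by move=> x h; rewrite b1// mulr0.
Qed.

Lemma bddB r C C' psi psi' : bdd r C psi -> bdd r C' psi' ->
  bdd r (C + C') (fun x => psi x - psi' x).
Proof.
move=> [m1 a1 b1] [m2 a2 b2]; split.
- exact: measurable_funB.
- by move=> x; rewrite (le_trans (ler_normB _ _))// lerD.
- by move=> x h; rewrite b1// b2// subr0.
Qed.

Lemma bdd_tr i t r C psi : `|t| <= 1 -> bdd r C psi -> bdd (r + 1) C (translate i t psi).
Proof.
move=> t1 [m1 a1 b1]; split => [|x|x h]; last 2 first.
- exact: a1.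
- apply: b1 => /cubeP k; apply: h; apply/cubeP => j.
  have := k j; rewrite line_coord; case: eqP => _; rewrite ?addr0; last lra.
  move=> h; rewrite -(addrK t (x ord0 j)) (le_trans (ler_normB _ _))//; lra.
- apply: (@measurableT_comp _ _ _ _ _ _ psi) => //; exact: measurable_translate.
Qed.

Lemma locint_norm u : locint u -> locint (fun x => `|u x|).
Proof.
move=> [mu_ iu]; split; first exact: measurableT_comp.
by move=> r; exact: integrable_norm (iu r).
Qed.

Lemma locint_cube u r : locint u ->
  mu.-integrable setT (EFin \o (fun x => u x * \1_(cube r) x)).
Proof.
move=> [_ iu]; have h := (integrable_mkcond _ (measurable_cube r)).1 (iu r).
apply: (eq_integrable measurableT _ _ _ h) => x _; rewrite /= patchE indicE.
by case: ifP => _; rewrite ?mulr1 ?mulr0.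
Qed.

Lemma locint_mul u r C psi : locint u -> bdd r C psi ->
  mu.-integrable setT (EFin \o (fun x => u x * psi x)).
Proof.
move=> lu [m1 a1 b1]; have mu_ := lu.1.
apply: (le_integrableR _ _ (integrableRZ C (locint_cube r (locint_norm lu)))).
  exact: measurable_funM.
move=> x; rewrite normrM mulrCA ler_wpM2l// indicE.
have [h|h] := pselect (cube r x); first by rewrite mem_set// mulr1.
by rewrite b1// normr0 memNset// mulr0.
Qed.

Lemma locint_cst (c : R) : locint (cst c).
Proof.
split; first exact: measurable_cst.
move=> r; apply: measurable_bounded_integrable => //; first exact: measurable_cube.
- exact: cube_fin.
- by exists `|c|; split => // M hM x _; exact: ltW.
Qed.

Lemma bdd_integrable r C psi : bdd r C psi -> mu.-integrable setT (EFin \o psi).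
Proof.
move=> bp; have h := locint_mul (locint_cst 1) bp.
by apply: (eq_integrable measurableT _ _ _ h) => x _ /=; rewrite mul1r.
Qed.

Lemma Rintegral_tr i t r C psi : bdd r C psi -> (forall x, 0 <= psi x) ->
  \int[mu]_x translate i t psi x = \int[mu]_x psi x.
Proof.
move=> [mp _ _] p0; congr fine.
pose v := t *: delta_mx ord0 i : E.
rewrite -[LHS](@ge0_integral_pushforward _ _ _ _ _ _ (measurable_translate v) mu setT (EFin \o psi))//.
- apply: (eq_measure_integral mu (m1 := measure_function_pushforward__canonical__measure_function_Measure mu (measurable_translate v))) => A mA _.
  exact: lebesgue_rV_translate.
- exact/measurable_EFinP.
- by move=> x _; rewrite /= lee_fin.
Qed.

(** Dominated convergence along integer heights: the integrand at x is eventually 0. *)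
Lemma locint_tail u r e : locint u -> 0 < e -> exists2 M : R, 0 <= M &
  \int[mu]_x (`|u x| * \1_[set x | M < `|u x|] x * \1_(cube r) x) <= e.
Proof.
move=> lu e0; have mu_ := lu.1.
have mS (M : R) : measurable [set x : E | M < `|u x|].
  rewrite -[X in measurable X]setTI.
  apply: (@measurable_fun_ltr _ _ _ _ (cst M) (fun x => `|u x|)) => //.
  exact: measurableT_comp.
have /cvgrPdist_le/(_ e e0)[n _ hn] :
    (\int[mu]_x (`|u x| * \1_[set x | n%:R < `|u x|] x * \1_(cube r) x)) @[n --> \oo] --> (0 : R).
  rewrite -[X in _ --> X](Rintegral0 mu).
  apply: (Rintegral_dominated _ _ (locint_cube r (locint_norm lu))).
  - move=> n; apply: measurable_funM; first apply: measurable_funM.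
    + exact: measurableT_comp.
    + exact/measurable_indicP.
    + by apply: measurable_indic; exact: measurable_cube.
  - move=> x; apply: cvg_near_cst; exists (Num.truncn `|u x|).+1 => // n /= hn.
    rewrite [X in X * _](_ : _ = 0) ?mul0r//.
    rewrite indicE memNset ?mulr0//= => /lt_trans /(_ (truncnS_gt _)).
    by rewrite ltr_nat ltnNge hn.
  - move=> n x; rewrite normrM normrM normr_id !indicE !normr_nat.
    by do 2 case: (x \in _) => /=; rewrite ?mulr1 ?mulr0.
exists n%:R => //; have := hn n (leqnn _).
by rewrite sub0r normrN; apply: le_trans; exact: ler_norm.
Qed.

(** Uniformity in t is the point. Where |u| <= M the difference is at most M times the L^1 norm of
    psi_n - psi, which translations preserve; where |u| > M it is at most 2 C |u|, with small
    integral by [locint_tail]. *)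
Lemma uniform_cvg_tr u r C (psi_ : nat -> E -> R) psi i : locint u ->
  (forall n, bdd r C (psi_ n)) -> bdd r C psi ->
  (forall x, psi_ n x @[n --> \oo] --> psi x) ->
  forall e, 0 < e -> \forall n \near \oo, forall t, `|t| <= 1 ->
    `|\int[mu]_x (u x * translate i t (psi_ n) x) - \int[mu]_x (u x * translate i t psi x)| <= e.
Proof.
move=> lu bn b0 cn e e0; have C0 := bdd_ge0 b0.
(* Half of e for each of the two regions; the added 1 keeps the denominator positive when C = 0. *)
have e1 : 0 < e / (2 * (2 * C + 1)) by rewrite divr_gt0// mulr_gt0//; lra.
have [M M0 hM] := locint_tail (r + 1) lu e1.
pose d n x := `|psi_ n x - psi x|.
have bd n : bdd r (C + C) (d n).
  have [m1 a1 b1] := bddB (bn n) b0; split; first exact: measurableT_comp.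
  - by move=> x; rewrite normr_id.
  - by move=> x h; rewrite /d b1// normr0.
have e2 : 0 < e / (2 * (M + 1)) by rewrite divr_gt0// mulr_gt0//; lra.
have /cvgrPdist_le/(_ _ e2)[n0 _ hn0] : (\int[mu]_x d n x) @[n --> \oo] --> (0 : R).
  rewrite -[X in _ --> X](Rintegral0 mu).
  apply: (Rintegral_dominated _ _ (integrableRZ (C + C) (locint_cube r (locint_cst 1)))).
  - by move=> n; have [] := bd n.
  - move=> x; rewrite /d -(normr0 R) -(subrr (psi x)).
    by apply: cvg_norm; apply: cvgB; [exact: cn|exact: cvg_cst].
  - move=> n x; rewrite mul1r indicE.
    have [_ a1 b1] := bd n; have [h|h] := pselect (cube r x).
      by rewrite mem_set// mulr1.
    by rewrite b1// normr0 memNset// mulr0.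
exists n0 => // n hn t t1.
have I1 := locint_mul lu (bdd_tr i t1 (bn n)).
have I2 := locint_mul lu (bdd_tr i t1 b0).
rewrite -RintegralB//.
apply: le_trans (le_normr_Rintegral measurableT (integrableRB I1 I2)) _.
have bdt := bdd_tr i t1 (bd n).
have I3 := bdd_integrable bdt.
have lu' := locint_norm lu.
have I4 : mu.-integrable setT (EFin \o (fun x => `|u x| * \1_[set x | M < `|u x|] x * \1_(cube (r+1)) x)).
  apply: (le_integrableR _ _ (locint_cube (r+1) lu')).
    apply: measurable_funM; first apply: measurable_funM.
    + exact: lu'.1.
    + apply/measurable_indicP; rewrite -[X in measurable X]setTI.
      apply: (@measurable_fun_ltr _ _ _ _ (cst M) (fun x => `|u x|)) => //.
      exact: lu'.1.
    + by apply: measurable_indic; exact: measurable_cube.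
  move=> x; rewrite normrM normrM normr_id !indicE !normr_nat.
  by do 2 case: (x \in _) => /=; rewrite ?mulr1 ?mulr0.
apply: (@le_trans _ _ (\int[mu]_x (M * translate i t (d n) x + (C + C) *
   (`|u x| * \1_[set x | M < `|u x|] x * \1_(cube (r+1)) x)))).
  apply: le_Rintegral => //.
  - exact/integrableR_norm/integrableRB.
  - by apply: integrableRD; exact: integrableRZ.
  move=> x _; rewrite -mulrBr normrM -[`|_ - _|]/(translate i t (d n) x) !indicE.
  have [_ a1 b1] := bdt.
  have [h|h] := pselect (cube (r+1) x); last by rewrite b1// [in X in _ <= _ + X](memNset h) !mulr0 addr0.
  rewrite [in X in _ <= _ + X](mem_set h) mulr1.
  have d0 : 0 <= translate i t (d n) x by exact: normr_ge0.
  have dC : translate i t (d n) x <= C + C by rewrite (le_trans _ (a1 x))// ler_norm.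
  have u0 : 0 <= `|u x| by [].
  have [hu|hu] := leP `|u x| M.
    rewrite memNset ?mulr0 ?addr0/=; last by apply/negP; rewrite -leNgt.
    by rewrite ler_wpM2r.
  rewrite mem_set//= mulr1; nra.
rewrite RintegralD//; [|exact: integrableRZ|exact: integrableRZ].
rewrite !RintegralZl// (Rintegral_tr i t (bd n)); last by move=> x; exact: normr_ge0.
have := hn0 n hn; rewrite sub0r normrN => /(le_trans (ler_norm _)) h1.
have h2 : M * \int[mu]_x d n x <= e / 2.
  apply: le_trans (ler_wpM2l M0 h1) _.
  rewrite mulrA ler_pdivrMr; last by rewrite mulr_gt0//; lra.
  by nra.
have h3 : (C + C) * (e / (2 * (2 * C + 1))) <= e / 2.
  rewrite mulrA ler_pdivrMr; last by rewrite mulr_gt0//; lra.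
  by nra.
have h4 := ler_wpM2l (addr_ge0 C0 C0) hM.
lra.
Qed.

End local_integrability.

(** * One-variable calculus: fundamental theorem, mean value and Taylor estimates *)

Section mean_value.
Context {R : realType}.
Implicit Types (f F : R -> R) (a b x h C : R).

Lemma within_continuous_pt f a b : (forall x, a <= x <= b -> {for x, continuous f}) ->
  {within `[a, b], continuous f}.
Proof.
move=> cf; apply: continuous_in_subspaceT => x; rewrite inE /= in_itv/= => xab.
exact: cf.
Qed.

Lemma integrable_pt f a b : (forall x, a <= x <= b -> {for x, continuous f}) ->
  lebesgue_measure.-integrable `[a, b] (EFin \o f).
Proof.
move=> cf; apply: continuous_compact_integrable; first exact: segment_compact.
exact: within_continuous_pt.
Qed.

Lemma FTC2_pt f F a b : a < b -> (forall x : R, a <= x <= b -> is_derive x 1 F (f x)) ->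
  (forall x, a <= x <= b -> {for x, continuous f}) ->
  \int[lebesgue_measure]_(x in `[a, b]) f x = F b - F a.
Proof.
move=> ab dF cf; rewrite /Rintegral (@continuous_FTC2 _ f F a b) //.
- exact: within_continuous_pt.
- have cF x : a <= x <= b -> {for x, continuous F}.
    by move=> h; exact: is_derive_continuous (dF x h).
  split => [x|//|//].
  + by rewrite in_itv/= => /andP[h1 h2]; have [] := dF x; rewrite ?(ltW h1) ?(ltW h2).
  + by apply/cvg_at_right_filter; apply: cF; rewrite lexx ltW.
  + by apply/cvg_at_left_filter; apply: cF; rewrite lexx ltW.
- move=> x; rewrite in_itv/= => /andP[h1 h2].
  by rewrite derive1E; have [] := dF x; rewrite ?(ltW h1) ?(ltW h2).
Qed.

Lemma MVT_any f F a b : (forall x : R, Num.min a b <= x <= Num.max a b -> is_derive x 1 F (f x)) ->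
  exists2 c, Num.min a b <= c <= Num.max a b & F b - F a = f c * (b - a).
Proof.
move=> dF; have cF x : Num.min a b <= x <= Num.max a b -> {for x, continuous F}.
  by move=> h; exact: is_derive_continuous (dF x h).
have [ab|ab] := leP a b; rewrite ?(min_idPl ab) ?(max_idPr ab) in dF cF *.
  have [||c] := @MVT_segment _ F f a b ab.
  - by move=> x; rewrite in_itv/= => /andP[h1 h2]; apply: dF; rewrite !ltW.
  - exact: within_continuous_pt.
  by rewrite in_itv/= => h e; exists c.
rewrite (min_idPr (ltW ab)) (max_idPl (ltW ab)) in dF cF *.
have [||c] := @MVT_segment _ F f b a (ltW ab).
- by move=> x; rewrite in_itv/= => /andP[h1 h2]; apply: dF; rewrite !ltW.
- exact: within_continuous_pt.
rewrite in_itv/= => h e; exists c => //.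
by rewrite -opprB e -mulrN opprB.
Qed.

Lemma taylor2 f f1 f2 x h C : (forall y : R, is_derive y 1 f (f1 y)) ->
  (forall y : R, is_derive y 1 f1 (f2 y)) -> (forall y, `|f2 y| <= C) ->
  `|f (x + h) - f x - f1 x * h| <= C * h ^+ 2.
Proof.
move=> d1 d2 hC.
have [c hc e] := @MVT_any f1 f x (x + h) (fun y _ => d1 y).
have [c' hc' e'] := @MVT_any f2 f1 x c (fun y _ => d2 y).
rewrite e addrAC subrr add0r -mulrBl e' !normrM -(real_normK (num_real h)) expr2 mulrA.
rewrite ler_wpM2r// ler_pM//.
by move: hc; case: (lerP x (x + h)) => h1 /andP[h2 h3]; rewrite ler_norml; apply/andP; split;
  have := ler_norm h; have := ler_norm (- h); rewrite normrN; lra.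
Qed.

Lemma second_difference_close (a b c a' b' c' J e : R) :
  `|a' - a| <= e / 6 -> `|b' - b| <= e / 6 -> `|c' - c| <= e / 6 ->
  `|a' + b' - 2 * c' - J| <= e / 3 -> `|a + b - 2 * c - J| <= e.
Proof.
rewrite !ler_norml => /andP[? ?] /andP[? ?] /andP[? ?] /andP[? ?].
by apply/andP; split; lra.
Qed.

End mean_value.

(** * Second differences and Kato's inequality *)

Section second_difference.
Context {R : realType} {N : nat}.
Notation E := 'rV[R]_N.
Notation mu := (@lebesgue_rV R N).
Implicit Types (psi : E -> R) (r C t h e : R).
Variables (u g : E -> R) (i : 'I_N).
Hypotheses (lu : locint u) (lg : locint g).

Definition pairing (f : E -> R) psi t : R := \int[mu]_x (f x * translate i t psi x).

(* Taylor's formula with integral remainder for t |-> pairing u psi t, whose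
   second derivative is pairing g psi when g is the weak derivative d_i d_i u. *)
Definition second_diff psi := (forall t, `|t| < 1 -> {for t, continuous (pairing g psi)}) /\
  forall h, 0 < h < 1 ->
    pairing u psi h + pairing u psi (- h) - 2 * pairing u psi 0 =
    \int[lebesgue_measure]_(t in `[0, h]) ((h - t) * (pairing g psi t + pairing g psi (- t))).

Lemma pairingD f psi psi' r C C' t : locint f -> bdd r C psi -> bdd r C' psi' -> `|t| <= 1 ->
  pairing f (fun x => psi x + psi' x) t = pairing f psi t + pairing f psi' t.
Proof.
move=> lf b1 b2 t1; rewrite /pairing -RintegralD//.
- by apply: eq_Rintegral => x _; rewrite -mulrDr.
- exact: locint_mul (bdd_tr i t1 b1).
- exact: locint_mul (bdd_tr i t1 b2).
Qed.

Lemma pairingZ f psi r C c t : locint f -> bdd r C psi -> `|t| <= 1 ->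
  pairing f (fun x => c * psi x) t = c * pairing f psi t.
Proof.
move=> lf b1 t1; rewrite /pairing -RintegralZl//.
- by apply: eq_Rintegral => x _; rewrite mulrCA.
- exact: locint_mul (bdd_tr i t1 b1).
Qed.

Lemma eq_continuous_near (f f' : R -> R) t : `|t| < 1 -> (forall s, `|s| < 1 -> f s = f' s) ->
  {for t, continuous f} -> {for t, continuous f'}.
Proof.
move=> t1 ff' cf; rewrite /prop_for /continuous_at -ff'//.
apply: cvg_trans cf; apply: near_eq_cvg; near=> s; apply: ff'.
near: s; exact: (cvgr_lt _ (@norm_continuous _ R t) _ t1).
Unshelve. all: by end_near. Qed.

Let kernel_continuous psi h : (forall t, `|t| < 1 -> {for t, continuous (pairing g psi)}) ->
  0 < h < 1 -> forall t, 0 <= t <= h ->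
  {for t, continuous (fun t => (h - t) * (pairing g psi t + pairing g psi (- t)))}.
Proof.
move=> cg /andP[h0 h1] t /andP[t0 th].
have t1 : `|t| < 1 by rewrite ger0_norm// (le_lt_trans th).
apply: continuousM.
  by apply: continuousB; [exact: cst_continuous|by move=> ?; exact: cvg_id].
apply: continuousD; first exact: cg.
apply: (@continuous_comp _ _ _ -%R (pairing g psi)); first exact: opp_continuous.
by apply: cg; rewrite normrN.
Qed.

Lemma second_diffD r C C' psi psi' : bdd r C psi -> bdd r C' psi' ->
  second_diff psi -> second_diff psi' -> second_diff (fun x => psi x + psi' x).
Proof.
move=> b1 b2 [c1 e1] [c2 e2].
have D f t : locint f -> `|t| <= 1 ->
    pairing f (fun x => psi x + psi' x) t = pairing f psi t + pairing f psi' t.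
  by move=> lf t1; exact: (pairingD lf b1 b2 t1).
split => [t t1|h /andP[h0 h1]].
  apply: (@eq_continuous_near (fun t => pairing g psi t + pairing g psi' t)) => //.
    by move=> s s1; rewrite D// ltW.
  by apply: continuousD; [exact: c1|exact: c2].
have hh : 0 < h < 1 by rewrite h0.
have n1 : `|h| <= 1 by rewrite gtr0_norm// ltW.
have := congr2 +%R (e1 h hh) (e2 h hh).
rewrite -[X in _ = X -> _]RintegralD//; last 2 first.
- by apply: integrable_pt => t th; exact: kernel_continuous.
- by apply: integrable_pt => t th; exact: kernel_continuous.
rewrite !D ?normrN ?normr0// => e; rewrite (_ : _ - _ =
  pairing u psi h + pairing u psi (- h) - 2 * pairing u psi 0 +
  (pairing u psi' h + pairing u psi' (- h) - 2 * pairing u psi' 0)); last by ring.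
rewrite e; apply: eq_Rintegral => t; rewrite inE/= in_itv/= => /andP[t0 th].
have t1 : `|t| <= 1 by rewrite ger0_norm// (le_trans th)// ltW.
by rewrite !D ?normrN//; ring.
Qed.

Lemma second_diffZ r C c psi : bdd r C psi ->
  second_diff psi -> second_diff (fun x => c * psi x).
Proof.
move=> b1 [c1 e1].
have D f t : locint f -> `|t| <= 1 ->
    pairing f (fun x => c * psi x) t = c * pairing f psi t.
  by move=> lf t1; exact: (pairingZ c lf b1 t1).
split => [t t1|h /andP[h0 h1]].
  apply: (@eq_continuous_near (fun t => c * pairing g psi t)) => //.
    by move=> s s1; rewrite D// ltW.
  by apply: continuousM; [exact: cst_continuous|exact: c1].
have hh : 0 < h < 1 by rewrite h0.
have n1 : `|h| <= 1 by rewrite gtr0_norm// ltW.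
have := congr1 (fun z => c * z) (e1 h hh).
rewrite -[X in _ = X -> _]RintegralZl//; last first.
  by apply: integrable_pt => t th; exact: kernel_continuous.
rewrite !D ?normrN ?normr0// => e; rewrite (_ : _ - _ =
  c * (pairing u psi h + pairing u psi (- h) - 2 * pairing u psi 0)); last by ring.
rewrite e; apply: eq_Rintegral => t; rewrite inE/= in_itv/= => /andP[t0 th].
have t1 : `|t| <= 1 by rewrite ger0_norm// (le_trans th)// ltW.
by rewrite !D ?normrN//; ring.
Qed.

(** By [uniform_cvg_tr] the pairings with u and with g converge uniformly for |t| <= 1, so both the
    continuity and the integral identity survive. This closure property is what carries the class
    from smooth functions to measurable ones. *)
Lemma second_diff_lim r C (psi_ : nat -> E -> R) psi :
  (forall n, bdd r C (psi_ n)) -> bdd r C psi ->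
  (forall x, psi_ n x @[n --> \oo] --> psi x) ->
  (forall n, second_diff (psi_ n)) -> second_diff psi.
Proof.
move=> bn b0 cn Sn.
have Ug e : 0 < e -> exists n, forall t, `|t| <= 1 ->
    `|pairing u (psi_ n) t - pairing u psi t| <= e /\
    `|pairing g (psi_ n) t - pairing g psi t| <= e.
  move=> e0.
  have h1 := uniform_cvg_tr i lu bn b0 cn e0.
  have h2 := uniform_cvg_tr i lg bn b0 cn e0.
  have [n [k1 k2]] := filter_ex (filterI h1 h2).
  by exists n => t t1; split; [exact: k1|exact: k2].
have cg t : `|t| < 1 -> {for t, continuous (pairing g psi)}.
  move=> t1; apply/cvgrPdist_le => e e0.
  have [n hn] := Ug (e / 3) (ltac:(lra)).
  have [cgn _] := Sn n.
  have /cvgrPdist_le/(_ (e / 3) (ltac:(lra))) H := cgn t t1.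
  near=> s.
  have s1 : `|s| < 1 by near: s; exact: (cvgr_lt _ (@norm_continuous _ R t) _ t1).
  have [_ a1] := hn t (ltW t1).
  have [_ a2] := hn s (ltW s1).
  have a3 : `|pairing g (psi_ n) t - pairing g (psi_ n) s| <= e / 3 by near: s.
  rewrite distrC in a1.
  rewrite (_ : _ - _ = (pairing g psi t - pairing g (psi_ n) t) +
    (pairing g (psi_ n) t - pairing g (psi_ n) s) + (pairing g (psi_ n) s - pairing g psi s)); last by ring.
  apply: le_trans (ler_normD _ _) _.
  apply: le_trans (lerD (ler_normD _ _) (lexx _)) _; lra.
split => // h hh; have /andP[h0 h1] := hh.
apply/eqP; rewrite -subr_eq0 -normr_le0; apply/ler_addgt0Pl => e e0; rewrite addr0.
(* The three pairings with u have weights 1, 1 and 2, at a cost of 4 e / 6; the integral costs e /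
   3, since h < 1. *)
have [n hn] := Ug (e / 6) (ltac:(lra)).
have [cgn en] := Sn n.
have nh : `|h| <= 1 by rewrite gtr0_norm// ltW.
have [a1 _] := hn h nh.
have [a2 _] := hn (- h) (ltac:(by rewrite normrN)).
have [a3 _] := hn 0 (ltac:(by rewrite normr0)).
have I1 := integrable_pt (kernel_continuous cg hh).
have I2 := integrable_pt (kernel_continuous cgn hh).
have I3 : lebesgue_measure.-integrable `[0, h] (EFin \o (fun t : measurableTypeR R =>
    (h - t) * (pairing g (psi_ n) t + pairing g (psi_ n) (- t)) -
    (h - t) * (pairing g psi t + pairing g psi (- t)))).
  apply: integrable_pt => t th; apply: continuousB.
    exact: (kernel_continuous cgn hh th).
  exact: (kernel_continuous cg hh th).
have := en h hh.
set I := Rintegral _ _ _ => eI; set J := Rintegral _ _ _.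
have IJ : `|I - J| <= e / 3.
  rewrite /I /J -RintegralB//.
  apply: le_trans (le_normr_Rintegral _ _) _ => //.
  apply: (@le_trans _ _ (\int[lebesgue_measure]_(t in `[0, h]) (e / 3))).
    apply: le_Rintegral => //.
    - exact: (integrable_norm I3).
    - by apply: integrable_pt => ? _; exact: cst_continuous.
    move=> t; rewrite /= in_itv/= => /andP[t0 th].
    have t1 : `|t| <= 1 by rewrite ger0_norm// (le_trans th)// ltW.
    have [_ b1] := hn t t1; have [_ b2] := hn (- t) (ltac:(by rewrite normrN)).
    rewrite -mulrBr normrM ger0_norm ?subr_ge0//.
    rewrite -[leRHS]mul1r ler_pM// ?subr_ge0//.
      by rewrite lerBlDr (le_trans (ltW h1))// lerDl.
    rewrite opprD addrACA (le_trans (ler_normD _ _))//.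
    by rewrite (_ : e / 3 = e / 6 + e / 6) ?lerD//; field.
  have mh : fine (lebesgue_measure (`[0, h]%classic : set (measurableTypeR R))) = h.
    by rewrite lebesgue_measure_itv /= lte_fin h0 -EFinB /= subr0.
  rewrite Rintegral_cst//; apply: (@le_trans _ _ (e / 3 * h)); first by rewrite -[X in _ <= _ * X]mh.
  by rewrite ler_piMr ?(ltW h1)// divr_ge0// ltW.
rewrite -eI in IJ.
exact: second_difference_close a1 a2 a3 IJ.
Unshelve. all: by end_near. Qed.

End second_difference.

Section second_difference_test.
Context {R : realType} {N : nat}.
Notation E := 'rV[R]_N.
Notation mu := (@lebesgue_rV R N).
Implicit Types (psi : E -> R) (r C t h e : R) (F : 'I_N -> nat -> R -> R).
Variables (u g : E -> R) (i : 'I_N).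
Hypotheses (lu : locint u) (lg : locint g).

Lemma bdd_tens r F m : (forall j, cutfam r (F j)) -> exists C, bdd r C (tens F m).
Proof.
move=> hF; have [C hC] := tens_bounded hF m; exists C; split => //.
- exact: measurable_tens hF m.
- by move=> x h; exact: tens_out hF _ _ h.
Qed.

Definition shift_fam t F j n s := F j n (if j == i then s + t else s).

Lemma cutfam_shift r F t j : cutfam r (F j) -> cutfam (r + `|t|) (shift_fam t F j).
Proof.
move=> [dF F0]; split => [n s|n s h]; rewrite /shift_fam; case: eqP => _.
- have D : is_derive s 1 (fun s : R => s + t) 1.
    by apply: (is_derive_eq (is_derive1_add (is_derive_id s 1) (is_derive_cst t s 1))); rewrite addr0.
  have := @is_derive1_compf _ (F j n) (fun s => s + t) s _ _ (dF n _) D.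
  by rewrite mulr1.
- exact: dF.
- apply: F0; have := ler_normD (s + t) (- t); rewrite addrK normrN; lra.
- by apply: F0; rewrite (le_lt_trans _ h)// lerDl.
Qed.

Lemma tr_tens F m t : translate i t (tens F m) = tens (shift_fam t F) m.
Proof.
apply/funext => x; rewrite /translate /tens; apply: eq_bigr => j _.
by rewrite line_coord /shift_fam; case: eqP => _; rewrite ?addr0.
Qed.

(** Differentiation under the integral sign: the Taylor remainder of the test function is at most C
    h^2 uniformly in x, with support in a fixed cube. *)
Lemma is_derive_pairing f r F m t : locint f -> (forall j, cutfam r (F j)) ->
  is_derive t 1 (pairing i f (tens F m)) (pairing i f (tens F (incr i m)) t).
Proof.
move=> lf hF.
have [C hC] := tens_bounded hF (incr i (incr i m)).
have lf' := locint_norm lf.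
(* This cube contains the supports of the translates by t and by t + h for all |h| < 1. *)
set r' := r + (`|t| + 1).
apply: (@is_derive_quadratic _ _ _ _ (C * \int[mu]_x (`|f x| * \1_(cube r') x))) => h h1.
have hS s : `|s| <= `|t| + 1 -> forall j, cutfam r' (shift_fam s F j).
  move=> st j; have [d0 z0] := cutfam_shift s (hF j); split => // n y hy; apply: z0.
  by rewrite (le_lt_trans _ hy)// lerD2l.
have I s m' : `|s| <= `|t| + 1 -> mu.-integrable setT (EFin \o (fun x => f x * translate i s (tens F m') x)).
  move=> st; rewrite tr_tens; have [C' bC'] := bdd_tens m' (hS _ st).
  exact: locint_mul bC'.
have th : `|t + h| <= `|t| + 1 by rewrite (le_trans (ler_normD _ _))// lerD2l ltW.
have tt : `|t| <= `|t| + 1 by rewrite lerDl.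
rewrite /pairing -(RintegralZr h measurableT (I t (incr i m) tt)) -RintegralB//; [|exact: I|exact: I].
have I1 := integrableRB (I _ m th) (I _ m tt).
have I2 : mu.-integrable setT (EFin \o (fun x => f x * translate i t (tens F (incr i m)) x * h)).
  by apply: (eq_integrable measurableT _ _ _ (integrableRZ h (I _ (incr i m) tt))) => x _ /=; rewrite mulrC.
rewrite -RintegralB//.
apply: le_trans (le_normr_Rintegral measurableT (integrableRB I1 I2)) _.
rewrite mulrAC -RintegralZl//; last exact: locint_cube.
apply: le_Rintegral => //.
- exact/integrableR_norm/(integrableRB I1 I2).
- exact/integrableRZ/locint_cube.
move=> x _; rewrite -mulrBr -mulrA -mulrBr normrM mulrCA ler_wpM2l//.
have [k|k] := pselect (cube r' x).
  rewrite indicE mem_set// mulr1 /translate.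
  apply: (@taylor2 _ (fun s => tens F m (x + s *: delta_mx ord0 i))
    (fun s => tens F (incr i m) (x + s *: delta_mx ord0 i))
    (fun s => tens F (incr i (incr i m)) (x + s *: delta_mx ord0 i)) t h C) => // y.
  - exact: is_derive_tens_line hF m i x y.
  - exact: is_derive_tens_line hF (incr i m) i x y.
rewrite indicE memNset// mulr0 !tr_tens.
by rewrite !(tens_out (hS _ tt))// !(tens_out (hS _ th))// mul0r !subr0 normr0.
Qed.

Hypothesis weak : is_weak_partial [:: i; i] u g.

(** A translate of a tensor product is again a test function, so the definition of the weak
    derivative applies at every t: the second derivative of [pairing i u psi] is
    [pairing i g psi]. *)
Lemma second_diff_tens r F m : (forall j, cutfam r (F j)) -> second_diff u g i (tens F m).
Proof.
move=> hF.
have D0 t := is_derive_pairing m t lu hF.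
have D1 t := is_derive_pairing (incr i m) t lu hF.
have Gc t : {for t, continuous (pairing i g (tens F m))}.
  exact: is_derive_continuous (is_derive_pairing m t lg hF).
have Ge t : pairing i g (tens F m) t = pairing i u (tens F (incr i (incr i m))) t.
  rewrite /pairing !tr_tens.
  have hS j := cutfam_shift t (hF j).
  have := weak (test_function_tens hS m).
  by rewrite (partials2_tens hS) /= expr2 mulrNN mulr1 mul1r.
split => [t _|h /andP[h0 h1]]; first exact: Gc.
(* With U the pairing with u, P = (h - t) (U'(t) - U'(-t)) + U(t) + U(-t) has derivative (h - t)
   (U''(t) + U''(-t)): integration by parts in the remainder. *)
pose P t := (h - t) * (pairing i u (tens F (incr i m)) t - pairing i u (tens F (incr i m)) (- t)) +
    (pairing i u (tens F m) t + pairing i u (tens F m) (- t)).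
transitivity (P h - P 0).
  have RP (a b c d k l : R) : c + d - 2 * l =
      (h - h) * (a - b) + (c + d) - ((h + 0) * (k - k) + (l + l)) by ring.
  by rewrite /P !oppr0; exact: RP.
apply/esym/FTC2_pt => //.
- move=> t _.
  have DN (f f' : R -> R) : (forall t : R, is_derive t 1 f (f' t)) ->
      is_derive t 1 (fun t => f (- t)) (- f' (- t)).
    move=> df; have dN : is_derive t 1 (fun t : R => - t) (- 1).
      exact: is_deriveN.
    by have := is_derive1_compf (df (- t)) dN; rewrite mulrN mulr1.
  have dh : is_derive t 1 (fun t => h - t) (- 1).
    by apply: (is_derive_eq (is_derive1_sub (is_derive_cst h t 1) (is_derive_id t 1))); rewrite sub0r.
  have K1 := is_derive1_sub (D1 t) (DN _ _ D1).
  have K0 := is_derive1_add (D0 t) (DN _ _ D0).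
  have K := is_derive1_add (is_derive1_mul dh K1) K0.
  apply: (is_derive_eq K).
  have R4 (x a b c d : R) : x * (a - - b) + (c - d) * -1 + (c + - d) = x * (a + b) by ring.
  by rewrite !Ge; exact: R4.
- move=> t _; apply: continuousM.
    by apply: continuousB; [exact: cst_continuous|by move=> ?; exact: cvg_id].
  apply: continuousD; first exact: Gc.
  by apply: (@continuous_comp _ _ _ -%R (pairing i g (tens F m))); [exact: opp_continuous|exact: Gc].
Qed.

End second_difference_test.

Section second_difference_bounded.
Context {R : realType} {N : nat}.
Notation E := 'rV[R]_N.
Notation mu := (@lebesgue_rV R N).
Implicit Types (psi : E -> R) (r C t h e : R).
Variables (u g : E -> R) (i : 'I_N).
Hypotheses (lu : locint u) (lg : locint g).
Hypothesis weak : is_weak_partial [:: i; i] u g.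

(** Generators chosen so that a box of rays, cut by [ocube r], is a product of bounded open
    intervals, whose indicator is a limit of products of [flat_bump]. *)
Definition rays : set (set (measurableTypeR R)) := [set A | exists x : R, A = `]-oo, x[%classic].

Definition ocube r : set E := [set x : E | forall j, `]-r, r[%classic (x ord0 j)].

Lemma measurable_ocube r : measurable (ocube r).
Proof. by apply: (measurable_boxE (A := fun=> _)) => j; exact: measurable_itv. Qed.

Lemma ocube_cube r : ocube r `<=` cube r.
Proof.
move=> x h j; have := h j; rewrite /= !in_itv/= => /andP[a b].
by rewrite !ltW.
Qed.

Lemma bdd_indic r (A : set E) : measurable A -> bdd r 1 (\1_(A `&` ocube r)).
Proof.
move=> mA; split.
- by apply: measurable_indic; apply: measurableI => //; exact: measurable_ocube.
- by move=> x; rewrite indicE normr_nat; case: (_ \in _).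
- by move=> x h; rewrite indicE memNset// => -[_ /ocube_cube].
Qed.

Lemma second_diff_box r (A : set E) : box_sets rays A -> second_diff u g i (\1_(A `&` ocube r)).
Proof.
move=> [B hB AE].
have [b hb] := choice hB.
have mA : measurable A.
  by rewrite AE; apply: measurable_boxE => j; rewrite hb; exact: measurable_itv.
pose F0 n j := flat_bump n (- r) (Num.min r (b j)).
have F0out n j t : r < `|t| -> F0 n j t = 0.
  move=> rt; apply: bump_out; apply/negP => /andP[h1]; rewrite lt_min => /andP[h2 _].
  by move: rt; rewrite ltNge ler_norml !ltW.
have hF n j : exists F, cutfam r F /\ F 0 = F0 n j.
  by have [F cF FE] := cutfam_of_bump (bumpalg_bump n (- r) (Num.min r (b j))) (F0out n j); exists F.
have [F hFF] := choice (fun p : nat * 'I_N => hF p.1 p.2).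
pose psi_ n : E -> R := tens (fun j => F (n, j)) (fun=> 0%N).
have psiE n x : psi_ n x = \prod_j F0 n j (x ord0 j).
  by apply: eq_bigr => j _; have [_ ->] := hFF (n, j).
have cF n j : cutfam r (F (n, j)) by have [] := hFF (n, j).
apply: (@second_diff_lim _ _ _ _ _ lu lg r 1 psi_).
- move=> n; split.
  + exact: measurable_tens (cF n) _.
  + move=> x; rewrite psiE normr_prod; apply: prodr_ile1 => j _.
    by rewrite normr_ge0 ger0_norm; have /andP[] := bump_bound n (- r) (Num.min r (b j)) (x ord0 j).
  + by move=> x; exact: tens_out (cF n) _ _.
- exact: bdd_indic.
- move=> x; under eq_fun do rewrite psiE.
  have -> : (\1_(A `&` ocube r) x : R) =
      \prod_j (if - r < x ord0 j < Num.min r (b j) then 1 else 0).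
    rewrite indicE; have [h|h] := pselect ((A `&` ocube r) x).
      rewrite mem_set// big1// => j _; case: h; rewrite AE => /(_ j) + /(_ j).
      by rewrite hb /= !in_itv/= lt_min => -> /andP[-> ->].
    rewrite memNset//; have [j hj] : exists j, ~~ (- r < x ord0 j < Num.min r (b j)).
      apply: contra_notP h => /forallNP h.
      have {}h j : - r < x ord0 j < Num.min r (b j) by apply/negP => /negP; exact: h.
      split; first rewrite AE.
        by move=> j; rewrite hb /= in_itv/=; have := h j; rewrite lt_min => /and3P[].
      by move=> j; rewrite /= in_itv/=; have := h j; rewrite lt_min => /and3P[-> ->].
    by rewrite (bigD1 j)//= ifN// mul0r.
  elim: (index_enum _) => [|j s IH].
    by rewrite big_nil; under eq_fun do rewrite big_nil; exact: cvg_cst.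
  have -> : (fun n => \prod_(k <- j :: s) F0 n k (x ord0 k)) =
      (fun n => F0 n j (x ord0 j) * \prod_(k <- s) F0 n k (x ord0 k)).
    by apply/funext => n; rewrite big_cons.
  by rewrite big_cons; apply: cvgM => //; exact: cvg_bump.
- by move=> n; exact: (second_diff_tens lu lg weak _ (cF n)).
Qed.

Lemma rV_measurable_rays : (@measurable _ E) = <<s (box_sets rays) >>.
Proof.
apply: measurable_rV_box_sets.
- by move=> _ [x ->]; exact: measurable_itv.
- exists (fun n => `]-oo, n%:R[%classic); first by move=> n; exists n%:R.
  split.
    move=> m n mn; apply/subsetPset => x; rewrite /= !in_itv/= => /lt_le_trans; apply.
    by rewrite ler_nat.
  rewrite -subTset => x _; exists (Num.truncn `|x|).+1 => //=.
  by rewrite in_itv/= (le_lt_trans (ler_norm x))//; exact: truncnS_gt.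
- exact: RGenInftyO.measurableE.
Qed.

(** Pi-lambda argument: linearity gives stability under proper differences, [second_diff_lim] under
    increasing unions. The cut by a fixed cube keeps all supports bounded. *)
Lemma second_diff_indic r (A : set E) : measurable A -> second_diff u g i (\1_(A `&` ocube r)).
Proof.
move=> mA.
have G1 : setI_closed (box_sets rays : set (set E)).
  have rI : setI_closed rays.
    move=> _ _ [x ->] [y ->]; exists (Num.min x y).
    by apply/seteqP; split => z /=; rewrite !in_itv/= lt_min => /andP.
  exact: box_sets_setI rI.
pose H : set (set E) := [set A | measurable A /\ second_diff u g i (\1_(A `&` ocube r))].
suff: <<s (box_sets rays) >> `<=` H by move=> /(_ A); rewrite -rV_measurable_rays => /(_ mA)[].
apply: (lambda_system_subset G1 _ _ (fun X _ => @subsetT _ X)).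
- split; first by move=> ? _; exact: subsetT.
  + split; first exact: measurableT.
    (* Inside [ocube r] the whole space coincides with the box of rays ending at r. *)
    rewrite setTI; have := second_diff_box r (A := [set x : E | forall j, `]-oo, r[%classic (x ord0 j)]).
    rewrite (_ : _ `&` ocube r = ocube r).
      by apply; exists (fun=> `]-oo, r[%classic) => // j; exists r.
    apply/seteqP; split => [x []//|x h]; split => // j /=.
    by have := h j; rewrite /= !in_itv/= => /andP[].
  + move=> B D DB [mB hB] [mD hD]; split; first exact: measurableD.
    rewrite (_ : \1_ _ = (fun x => \1_(B `&` ocube r) x + (-1) * \1_(D `&` ocube r) x)).
      apply: (second_diffD lu lg (bdd_indic r mB) (bddZ (-1) (bdd_indic r mD)) hB).
      exact: (second_diffZ lu lg _ (bdd_indic r mD) hD).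
    apply/funext => x; rewrite !indicE.
    have [hO|hO] := pselect (ocube r x); last first.
      by rewrite !memNset ?mulr0 ?addr0// => -[].
    have [h1|h1] := pselect (D x).
      rewrite (mem_set (conj h1 hO : (D `&` ocube r) x)).
      rewrite (mem_set (conj (DB _ h1) hO : (B `&` ocube r) x)) memNset ?mulN1r ?subrr//.
      by case; case.
    have -> : (x \in D `&` ocube r) = false by apply: memNset; case.
    rewrite mulr0 addr0.
    by have [h2|h2] := pselect (B x); [rewrite !mem_set|rewrite !memNset// => -[]//; case].
  + move=> F ndF hF; split; first by apply: bigcup_measurable => k _; have [] := hF k.
    apply: (@second_diff_lim _ _ _ _ _ lu lg r 1 (fun n => \1_(F n `&` ocube r))).
    * by move=> n; apply: bdd_indic; have [] := hF n.
    * by apply: bdd_indic; apply: bigcup_measurable => k _; have [] := hF k.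
    * move=> x; have [[[n _ Fn] hO]|h] := pselect ((\bigcup_n F n `&` ocube r) x).
        apply: cvg_near_cst; exists n => // m /= nm.
        rewrite !indicE !mem_set//; first by split => //; exists n.
        by split => //; move: (ndF _ _ nm) => /subsetPset; apply.
      apply: cvg_near_cst; apply: nearW => n; rewrite !indicE !memNset//.
      by move=> [Fn hO]; apply: h; split => //; exists n.
    * by move=> n; have [] := hF n.
- move=> B hB; split; last exact: second_diff_box.
  by rewrite rV_measurable_rays; exact: sub_sigma_algebra.
Qed.

Lemma sum_lt_nat (K t : nat) : (\sum_(k < K) (k < t)%N = minn K t)%N.
Proof.
elim: K => [|K IH]; first by rewrite big_ord0 min0n.
rewrite big_ord_recr /= IH; have [h|h] := ltnP K t.
  by rewrite (minn_idPl h) addn1.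
by rewrite addn0 (minn_idPr (leqW h)).
Qed.

(** Layer cake: psi rounded down to a multiple of 1/(n+1) is a finite combination of indicators of
    level sets, and differs from psi by at most 1/(n+1). *)
Lemma second_diff_ge0 r C psi : bdd r C psi -> (forall x, 0 <= psi x) -> second_diff u g i psi.
Proof.
move=> bp p0; have C0 := bdd_ge0 bp; have [mp pC pz] := bp.
pose S n k : set E := [set x | k.+1%:R <= n.+1%:R * psi x].
have mS n k : measurable (S n k).
  rewrite -[X in measurable X]setTI.
  apply: (@measurable_fun_ler _ _ _ _ (cst (k.+1%:R)) (fun x => n.+1%:R * psi x)) => //.
  exact: measurable_funM.
pose K n := (Num.truncn (n.+1%:R * C)).+1.
(* The radius r + 1 is there because the support of psi may touch the boundary of [cube r], which
   the open cube of radius r misses. *)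
pose psi_ n x : R := n.+1%:R^-1 * \sum_(k < K n) \1_(S n k `&` ocube (r + 1)) x.
have psiE n x : psi_ n x = n.+1%:R^-1 * (Num.truncn (n.+1%:R * psi x))%:R.
  rewrite /psi_; congr (_ * _).
  transitivity (\sum_(k < K n) ((k < Num.truncn (n.+1%:R * psi x))%N : nat)%:R : R).
    apply: eq_bigr => k _; rewrite indicE; congr (_%:R); congr (nat_of_bool _).
    rewrite truncn_ge_nat -?[_.+1 <= _]/(_ < _)%N; last by rewrite mulr_ge0.
    apply/idP/idP => [/set_mem[]//|h]; apply: mem_set; split => //.
    have : 0 < psi x.
      have := lt_le_trans (ltr0Sn R k) h; rewrite pmulr_rgt0//.
    move=> px j; rewrite /= in_itv/= -ltr_norml.
    have : cube r x by apply: contrapT => /pz e; rewrite e ltxx in px.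
    by move=> /cubeP/(_ j); lra.
  rewrite -natr_sum sum_lt_nat (minn_idPr _)//.
  rewrite /K leqW// le_truncn// ler_wpM2l// (le_trans (ler_norm _))//.
have psiB n x : psi x - n.+1%:R^-1 <= psi_ n x <= psi x.
  rewrite psiE; have n0 : (0 : R) < n.+1%:R by [].
  have y0 : 0 <= n.+1%:R * psi x by rewrite mulr_ge0.
  apply/andP; split.
    rewrite -(@ler_pM2l _ n.+1%:R)// mulrBr !mulrA divff ?gt_eqF// mul1r.
    by rewrite lerBlDr natr1 ltW// truncnS_gt.
  by rewrite -(@ler_pM2l _ n.+1%:R)// !mulrA divff ?gt_eqF// mul1r truncn_le.
have psi_ge0 n x : 0 <= psi_ n x by rewrite psiE mulr_ge0// invr_ge0.
have r1 : r <= r + 1 by lra.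
apply: (@second_diff_lim _ _ _ _ _ lu lg (r + 1) C psi_).
- move=> n; split.
  + apply: measurable_funM => //; apply: measurable_sum => k.
    by apply: measurable_indic; apply: measurableI => //; exact: measurable_ocube.
  + move=> x; rewrite ger0_norm//; have /andP[_ h] := psiB n x.
    by rewrite (le_trans h)// (le_trans (ler_norm _)).
  + move=> x h; apply/eqP; rewrite eq_le psi_ge0 andbT.
    have /andP[_ k] := psiB n x; rewrite (le_trans k)// pz// => hc; apply: h.
    by have [_ _ z] := bddW r1 (lexx 1) (bdd_indic r (@measurableT _ E));
      apply/cubeP => j; rewrite (le_trans ((cubeP _ _).1 hc j)).
- exact: bddW bp.
- move=> x; apply: (@squeeze_cvgr _ _ _ _ (fun n => psi x - n.+1%:R^-1) (fun=> psi x)).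
  + by apply: nearW => n; exact: psiB.
  + rewrite -[X in _ --> X]subr0; apply: cvgB; first exact: cvg_cst.
    exact: cvg_harmonic.
  + exact: cvg_cst.
- move=> n.
  have bS : forall m, bdd (r + 1) m%:R (fun x => \sum_(k < m) \1_(S n k `&` ocube (r + 1)) x) /\
     second_diff u g i (fun x => \sum_(k < m) \1_(S n k `&` ocube (r + 1)) x).
    elim=> [|m [b1 s1]].
      have -> : (fun x => \sum_(k < 0) \1_(S n k `&` ocube (r + 1)) x) =
         (fun x => 0 * \1_(S n 0%N `&` ocube (r+1)) x) :> (E -> R).
        by apply/funext => x; rewrite big_ord0 mul0r.
      split; last exact: (second_diffZ lu lg 0 (bdd_indic _ (mS n 0%N)) (second_diff_indic _ (mS n 0%N))).
      by have := bddZ 0 (bdd_indic (r+1) (mS n 0%N)); rewrite normr0 mul0r.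
    have -> : (fun x => \sum_(k < m.+1) \1_(S n k `&` ocube (r + 1)) x) =
         (fun x => \sum_(k < m) \1_(S n k `&` ocube (r + 1)) x + \1_(S n m `&` ocube (r+1)) x) :> (E -> R).
      by apply/funext => x; rewrite big_ord_recr.
    rewrite -natr1; split; first exact: bddD b1 (bdd_indic _ (mS n m)).
    exact: (second_diffD lu lg b1 (bdd_indic _ (mS n m)) s1 (second_diff_indic _ (mS n m))).
  by have [b1 s1] := bS (K n); exact: (second_diffZ lu lg _ b1 s1).
Qed.

Lemma second_diff_bdd r C psi : bdd r C psi -> second_diff u g i psi.
Proof.
move=> bp; have C0 := bdd_ge0 bp; have [mp pC pz] := bp.
have b1 : bdd r C (fun x => Num.max (psi x) 0).
  split; first exact: measurable_maxr.
  - move=> x; rewrite ger0_norm ?le_max ?lexx ?orbT// ge_max C0 andbT.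
    by rewrite (le_trans (ler_norm _)).
  - by move=> x h; rewrite pz// maxxx.
have b2 : bdd r C (fun x => Num.max (- psi x) 0).
  split; first by apply: measurable_maxr => //; exact: measurableT_comp.
  - move=> x; rewrite ger0_norm ?le_max ?lexx ?orbT// ge_max C0 andbT.
    by rewrite (le_trans (ler_norm _))// normrN.
  - by move=> x h; rewrite pz// oppr0 maxxx.
rewrite (_ : psi = (fun x => Num.max (psi x) 0 + (-1) * Num.max (- psi x) 0)).
  apply: (second_diffD lu lg b1 (bddZ (-1) b2)).
    by apply: (second_diff_ge0 b1) => x; rewrite le_max lexx orbT.
  apply: (second_diffZ lu lg _ b2).
  by apply: (second_diff_ge0 b2) => x; rewrite le_max lexx orbT.
apply/funext => x; rewrite !maxEle oppr_le0.
by have [h|h] := leP 0 (psi x); case: leP; lra.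
Qed.

(** The kernel h - t has mass h^2 / 2 on [0, h] and the two pairings with g are close to their value
    at t = 0, so the quotient is close to that value. *)
Lemma cvg_second_difference r C psi (h_ : nat -> R) : bdd r C psi ->
  (forall n, 0 < h_ n) -> h_ n @[n --> \oo] --> 0 ->
  (pairing i u psi (h_ n) + pairing i u psi (- h_ n) - 2 * pairing i u psi 0) / h_ n ^+ 2
    @[n --> \oo] --> \int[mu]_x (g x * psi x).
Proof.
move=> bp h0 ch; have [cg sd] := second_diff_bdd bp.
have -> : \int[mu]_x (g x * psi x) = pairing i g psi 0.
  by apply: eq_Rintegral => x _; rewrite /translate scale0r addr0.
apply/cvgrPdist_le => e e0.
have /cvgrPdist_le/(_ e e0)/nbhs_ballP[d /= d0 hd] := cg 0 (ltac:(by rewrite normr0)).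
near=> n.
have n1 : h_ n < 1 by near: n; exact: (cvgr_lt _ ch _ ltr01).
have nd : h_ n < d by near: n; exact: (cvgr_lt _ ch _ d0).
set h := h_ n; have hh : 0 < h < 1 by rewrite h0.
have h2 : 0 < h ^+ 2 by rewrite exprn_gt0//; exact: h0.
rewrite (sd h hh).
have ck t : 0 <= t <= h -> {for t, continuous (fun t : R => (h - t) *
    ((pairing i g psi t + pairing i g psi (- t)) - 2 * pairing i g psi 0))}.
  move=> /andP[t0 th]; have t1 : `|t| < 1 by rewrite ger0_norm// (le_lt_trans th).
  apply: continuousM.
    by apply: continuousB; [exact: cst_continuous|by move=> ?; exact: cvg_id].
  apply: continuousB; last exact: cst_continuous.
  apply: continuousD; first exact: cg.
  apply: (@continuous_comp _ _ _ -%R (pairing i g psi)); first exact: opp_continuous.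
  by apply: cg; rewrite normrN.
have c0 c t : {for t, continuous (fun t : R => (h - t) * c)}.
  apply: continuousM; last exact: cst_continuous.
  by apply: continuousB; [exact: cst_continuous|by move=> ?; exact: cvg_id].
have I0 c : \int[lebesgue_measure]_(t in `[0, h]) ((h - t) * c) = h ^+ 2 / 2 * c.
  pose P (t : R) := - ((h - t) ^+ 2 / 2) * c.
  transitivity (P h - P 0); last by rewrite /P; ring.
  apply: (@FTC2_pt _ (fun t => (h - t) * c) P 0 h); [by case/andP: hh| |by []].
  move=> t _.
  have dh : is_derive t 1 (fun t => h - t) (- 1).
    by apply: (is_derive_eq (is_derive1_sub (is_derive_cst h t 1) (is_derive_id t 1))); rewrite sub0r.
  have D := is_derive1_scale (- (c / 2)) (is_derive1_exp 2 dh).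
  have -> : P = (fun t => - (c / 2) * (h - t) ^+ 2) by apply/funext => s; rewrite /P; ring.
  by apply: (is_derive_eq D); rewrite /= expr1; field.
have -> : \int[lebesgue_measure]_(t in `[0, h]) ((h - t) * (pairing i g psi t + pairing i g psi (- t))) =
  \int[lebesgue_measure]_(t in `[0, h]) ((h - t) * ((pairing i g psi t + pairing i g psi (- t)) - 2 * pairing i g psi 0))
   + h ^+ 2 * pairing i g psi 0.
  rewrite (_ : h ^+ 2 * _ = \int[lebesgue_measure]_(t in `[0, h]) ((h - t) * (2 * pairing i g psi 0))); last by rewrite I0; field.
  rewrite -RintegralD//; last 2 first.
  - exact: integrable_pt.
  - by apply: integrable_pt => t _; exact: c0.
  by apply: eq_Rintegral => t _; ring.
rewrite mulrDl mulrAC divff ?gt_eqF// mul1r opprD addrCA subrr addr0 normrN normrM normfV.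
rewrite ler_pdivrMr ?normr_gt0 ?gt_eqF//.
have I1 := integrable_pt ck.
apply: le_trans (le_normr_Rintegral _ _) _ => //.
rewrite (gtr0_norm h2) (_ : e * h ^+ 2 = \int[lebesgue_measure]_(t in `[0, h]) ((h - t) * (2 * e))); last by rewrite I0; field.
apply: le_Rintegral => //.
- exact: (integrable_norm I1).
- by apply: integrable_pt => t _; exact: c0.
move=> t; rewrite /= in_itv/= => /andP[t0 th].
rewrite normrM ger0_norm ?subr_ge0// ler_wpM2l ?subr_ge0//.
have k1 : `|pairing i g psi 0 - pairing i g psi t| <= e.
  by apply: hd; rewrite /ball/= sub0r normrN ger0_norm// (le_lt_trans th).
have k2 : `|pairing i g psi 0 - pairing i g psi (- t)| <= e.
  by apply: hd; rewrite /ball/= sub0r opprK ger0_norm// (le_lt_trans th).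
rewrite -normrN (_ : - (pairing i g psi t + pairing i g psi (- t) - 2 * pairing i g psi 0) = (pairing i g psi 0 - pairing i g psi t) + (pairing i g psi 0 - pairing i g psi (- t))); last by ring.
by rewrite (le_trans (ler_normD _ _))// mulr_natl mulr2n lerD.
Unshelve. all: by end_near. Qed.

End second_difference_bounded.

(** * The discrete Kato inequality *)

Section discrete_kato.
Context {R : realType} {N : nat}.
Notation E := 'rV[R]_N.
Notation mu := (@lebesgue_rV R N).
Implicit Types (psi phi F c : E -> R) (r C h e : R).

Definition dlap h psi x : R :=
  \sum_(i < N) (translate i h psi x + translate i (- h) psi x - 2 * psi x) / h ^+ 2.

Lemma tr0 i psi : translate i 0 psi = psi.
Proof. by apply/funext => x; rewrite /translate scale0r addr0. Qed.

Variables (u c : E -> R) (G : 'I_N -> E -> R).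
Hypotheses (lu : locint u) (lG : forall i, locint (G i)).
Hypothesis weak : forall i, is_weak_partial [:: i; i] u (G i).
Hypothesis mc : measurable_fun setT c.
Hypothesis eqG : (fun x => \sum_(i < N) G i x) = (fun x => c x * u x) %[ae mu].

Lemma bdd_dlap r C psi h : 0 < h <= 1 -> bdd r C psi -> exists C', bdd (r + 1) C' (dlap h psi).
Proof.
move=> /andP[h0 h1] bp.
have b1 i t : `|t| <= 1 -> bdd (r + 1) C (translate i t psi) by move=> t1; exact: bdd_tr.
have hn : `|h| <= 1 by rewrite gtr0_norm.
have b0 : bdd (r + 1) C psi by apply: bddW bp => //; lra.
have bi i : exists C', bdd (r + 1) C' (fun x => (translate i h psi x + translate i (- h) psi x - 2 * psi x) / h ^+ 2).
  have B := bddZ (h ^- 2) (bddB (bddD (b1 i h hn) (b1 i (- h) (ltac:(by rewrite normrN)))) (bddZ 2 b0)).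
  eexists; move: B; congr bdd; apply/funext => x; exact: mulrC.
rewrite /dlap; elim: (index_enum _) => [|i s [C2 b2]].
  exists 0; split.
  - by under eq_fun do rewrite big_nil; exact: measurable_cst.
  - by move=> x; rewrite big_nil normr0.
  - by move=> x _; rewrite big_nil.
have [C1 b3] := bi i; exists (C1 + C2).
by move: (bddD b3 b2); congr bdd; apply/funext => x; rewrite big_cons.
Qed.

Lemma pairing_dlap r C psi h : 0 < h <= 1 -> bdd r C psi ->
  \sum_(i < N) (pairing i u psi h + pairing i u psi (- h) - 2 * pairing i u psi 0) / h ^+ 2 =
  \int[mu]_x (u x * dlap h psi x).
Proof.
move=> /andP[h0 h1] bp.
have hn : `|h| <= 1 by rewrite gtr0_norm.
have hN : `|- h| <= 1 by rewrite normrN.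
have I1 i := locint_mul lu (bdd_tr i hn bp).
have I2 i := locint_mul lu (bdd_tr i hN bp).
have I3 := locint_mul lu bp.
have I4 i := integrableRB (integrableRD (I1 i) (I2 i)) (integrableRZ 2 I3).
have I5 i := integrableRZ (h ^- 2) (I4 i).
transitivity (\int[mu]_x (\sum_(i < N) (h ^- 2 * (u x * translate i h psi x + u x * translate i (- h) psi x - 2 * (u x * psi x))))).
  rewrite Rintegral_sum//; apply: eq_bigr => i _.
  rewrite RintegralZl// RintegralB//; [|exact: integrableRD|exact: integrableRZ].
  by rewrite RintegralD// RintegralZl// /pairing tr0 mulrC.
apply: eq_Rintegral => x _; rewrite /dlap mulr_sumr; apply: eq_bigr => i _.
by ring.
Qed.

(** Take psi = sign(u) phi. At the same point u psi = |u| phi, while u(x) psi(y) <= |u(x)| phi(y)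
    for any y; the central term of the difference is thus an equality, and u times the discrete
    Laplacian of psi is at most |u| times that of phi. The former has integral tending to the
    left-hand side. F only has to dominate the upper limit of the latter, which allows phi to be a
    minimum. *)
Lemma discrete_kato r C C' phi F (h_ : nat -> R) :
  bdd r C phi -> (forall x, 0 <= phi x) -> bdd (r + 1) C' F ->
  (forall n, 0 < h_ n <= 1) -> h_ n @[n --> \oo] --> 0 ->
  (exists K, forall n x, dlap (h_ n) phi x <= K) ->
  (forall x e, 0 < e -> \forall n \near \oo, dlap (h_ n) phi x <= F x + e) ->
  \int[mu]_x (`|u x| * (c x * phi x)) <= \int[mu]_x (`|u x| * F x).
Proof.
move=> bp p0 bF h01 ch [K hK] hF.
have lu' := locint_norm lu.
have [mp pC pz] := bp; have [mF FC Fz] := bF.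
have mu_ := lu.1.
pose psi x := phi x * (\1_[set x | 0 < u x] x - \1_[set x | u x < 0] x).
have psiE x : u x * psi x = `|u x| * phi x.
  rewrite /psi !indicE; have [h|h|h] := ltgtP 0 (u x).
  - rewrite mem_set// memNset/=; last by apply/negP; rewrite -leNgt ltW.
    by rewrite gtr0_norm// [_ - _]subr0 mulr1.
  - rewrite memNset/=; last by apply/negP; rewrite -leNgt ltW.
    by rewrite mem_set// ltr0_norm// [_ - _]sub0r mulrN1 mulrN mulNr.
  - by rewrite -h normr0 !mul0r.
have psiL x : `|psi x| <= phi x.
  rewrite /psi normrM ger0_norm// ler_piMr// !indicE.
  by case: (_ \in _); case: (_ \in _); rewrite /= ?subrr ?subr0 ?sub0r ?normrN ?normr0 ?normr1.
have mS1 : measurable [set x | 0 < u x].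
  rewrite -[X in measurable X]setTI.
  exact: (@measurable_fun_ltr _ _ _ _ (cst 0) u).
have mS2 : measurable [set x | u x < 0].
  rewrite -[X in measurable X]setTI.
  exact: (@measurable_fun_ltr _ _ _ _ u (cst 0)).
have bpsi : bdd r C psi.
  split.
  - apply: measurable_funM => //; apply: measurable_funB; exact: measurable_indic.
  - by move=> x; rewrite (le_trans (psiL x))// (le_trans (ler_norm _)).
  - by move=> x h; apply/eqP; rewrite -normr_le0 (le_trans (psiL x))// pz.
have h0 n : 0 < h_ n by have /andP[] := h01 n.
have cS : (\int[mu]_x (u x * dlap (h_ n) psi x)) @[n --> \oo] --> \int[mu]_x (`|u x| * (c x * phi x)).
  have -> : \int[mu]_x (`|u x| * (c x * phi x)) = \sum_(i < N) \int[mu]_x (G i x * psi x).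
    rewrite -Rintegral_sum; last by move=> i; exact: (locint_mul (lG i) bpsi).
    apply: Rintegral_ae_eq.
    - by apply: measurable_funM; [exact: lu'.1|exact: measurable_funM].
    - apply: measurable_sum => i; apply: measurable_funM; first exact: (lG i).1.
      by have [] := bpsi.
    apply: filterS eqG => x /(_ I) h _.
    by rewrite -mulr_suml h -mulrA psiE; ring.
  have -> : (fun n => \int[mu]_x (u x * dlap (h_ n) psi x)) = (fun n =>
     \sum_(i < N) (pairing i u psi (h_ n) + pairing i u psi (- h_ n) - 2 * pairing i u psi 0) / h_ n ^+ 2).
    by apply/funext => n; rewrite (pairing_dlap (h01 n) bpsi).
  have ci i := cvg_second_difference lu (lG i) (@weak i) bpsi h0 ch.
  elim: (index_enum _) => [|i s IH].
    by rewrite big_nil; under eq_fun do rewrite big_nil; exact: cvg_cst.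
  rewrite big_cons; under eq_fun do rewrite big_cons.
  by apply: cvgD.
have bdl n : exists C', bdd (r + 1) C' (dlap (h_ n) phi) by exact: bdd_dlap bp.
(* The excess over F is bounded and tends to 0 pointwise, so its integral against |u| disappears in
   the limit. *)
pose P n x := Num.max (dlap (h_ n) phi x - F x) 0.
have K0 : 0 <= `|K| + C' by rewrite addr_ge0// (bdd_ge0 bF).
have bP n : bdd (r + 1) (`|K| + C') (P n).
  have [C1 [m1 a1 z1]] := bdl n; split.
  - by apply: measurable_maxr => //; exact: measurable_funB.
  - move=> x; rewrite ger0_norm /P ?le_max ?lexx ?orbT// ge_max K0 andbT lerD//.
      by rewrite (le_trans (hK n x))// ler_norm.
    by rewrite (le_trans (ler_norm _))// normrN.
  - by move=> x h; rewrite /P z1// Fz// subrr maxxx.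
have cT : (\int[mu]_x (`|u x| * P n x)) @[n --> \oo] --> (0 : R).
  rewrite -[X in _ --> X](Rintegral0 mu).
  apply: (Rintegral_dominated _ _ (integrableRZ (`|K| + C') (locint_cube (r+1) lu'))).
  - by move=> n; apply: measurable_funM; [exact: lu'.1|have [] := bP n].
  - move=> x; rewrite -[X in _ --> X](mulr0 `|u x|); apply: cvgMr.
    apply/cvgrPdist_le => e e0; near=> n.
    rewrite sub0r normrN ger0_norm /P ?le_max ?lexx ?orbT// ge_max (ltW e0) andbT lerBlDl.
    by near: n; exact: hF.
  - move=> n x; have [_ a1 z1] := bP n; rewrite normrM normr_id mulrCA ler_wpM2l//.
    have [h|h] := pselect (cube (r+1) x); first by rewrite indicE mem_set// mulr1.
    by rewrite z1// normr0 indicE memNset// mulr0.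
have cU : (\int[mu]_x (`|u x| * F x) + \int[mu]_x (`|u x| * P n x)) @[n --> \oo] --> \int[mu]_x (`|u x| * F x).
  by rewrite -[X in _ --> X]addr0; apply: cvgD => //; exact: cvg_cst.
apply: (ler_cvg_to cS cU); apply: nearW => n.
have [C1 b1] := bdl n.
have [C2 b2] := bdd_dlap (h01 n) bpsi.
rewrite -RintegralD//; [|exact: locint_mul lu' bF|exact: locint_mul lu' (bP n)].
apply: le_Rintegral => //.
- exact: locint_mul lu b2.
- by apply: integrableRD; [exact: locint_mul lu' bF|exact: locint_mul lu' (bP n)].
move=> x _; rewrite -mulrDr; apply: (@le_trans _ _ (`|u x| * dlap (h_ n) phi x)); last first.
  by rewrite ler_wpM2l// -lerBlDl /P le_max lexx.
rewrite /dlap !mulr_sumr; apply: ler_sum => i _.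
rewrite [leLHS]mulrA [leRHS]mulrA ler_wpM2r ?invr_ge0 ?sqr_ge0//.
have le1 y : u x * psi y <= `|u x| * phi y.
  by apply: le_trans (ler_norm _) _; rewrite normrM ler_wpM2l.
rewrite /translate; move: (le1 (x + h_ n *: delta_mx ord0 i)) (le1 (x + - h_ n *: delta_mx ord0 i)) (psiE x).
move: (psi _) (psi _) (psi _) (phi _) (phi _) (phi _) (u x) (`|u x|) => a b c' a' b' d v w; clear => l1 l2 l3.
lra.
Unshelve. all: by end_near. Qed.

End discrete_kato.

(** * The integral of 1 / (1 + s^b) *)

Section cesaro.
Context {R : realType}.
Implicit Types (f : nat -> R) (M : nat).

Lemma cesaro_recr f M : \sum_(k < M.+1) (M.+1 - k)%:R * f k =
  \sum_(k < M) (M - k)%:R * f k + \sum_(k < M.+1) f k.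
Proof.
rewrite !big_ord_recr /= subSnn mul1r addrA -big_split /=; congr (_ + _).
apply: eq_bigr => k _; rewrite subSn; last exact: ltnW.
by rewrite -natr1 mulrDl mul1r.
Qed.

Lemma cesaro_recl f M : \sum_(k < M) (M - k)%:R * f k =
  M%:R * f 0%N + \sum_(k < M) (M - k.+1)%:R * f k.+1.
Proof.
case: M => [|M]; first by rewrite !big_ord0 mul0r addr0.
by rewrite big_ord_recl big_ord_recr /= subn0 subnn mul0r addr0.
Qed.

Lemma cesaro_geometric (z : R) M : (1 + z) ^+ 2 * \sum_(k < M) (M - k)%:R * (- z) ^+ k =
  M%:R * (1 + z) + z * (1 - (- z) ^+ M).
Proof.
elim: M => [|M IH]; first by rewrite big_ord0 expr0; ring.
have G : (1 + z) * \sum_(k < M.+1) (- z) ^+ k = 1 - (- z) ^+ M.+1.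
  by have := subrX1 (- z) M.+1; lra.
rewrite (cesaro_recr (fun k => (- z) ^+ k)) mulrDr IH expr2 -[X in _ + X]mulrA G -natr1 exprS.
by ring.
Qed.

(** The weights M - k give the error a sign: it is z (1 - (-z)^M) / (1 + z)^2, which lies in
    [0, 2 z], whereas plain partial sums oscillate around 1 / (1 + z). *)
Lemma cesaro_geometric_bound (z : R) M : 0 <= z <= 1 ->
  M%:R / (1 + z) <= \sum_(k < M) (M - k)%:R * (- z) ^+ k <= M%:R / (1 + z) + 2 * z.
Proof.
move=> /andP[z0 z1]; have z2 : 0 < (1 + z) ^+ 2 by rewrite exprn_gt0//; lra.
have zM : `|(- z) ^+ M| <= 1 by rewrite normrX normrN ger0_norm// exprn_ile1.
have zn : 1 + z != 0 by rewrite gt_eqF//; lra.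
have E : \sum_(k < M) (M - k)%:R * (- z) ^+ k =
    M%:R / (1 + z) + z * (1 - (- z) ^+ M) / (1 + z) ^+ 2.
  apply: (mulfI (lt0r_neq0 z2)); rewrite cesaro_geometric.
  by field.
move: zM; rewrite ler_norml => /andP[m1 m2].
rewrite E lerDl lerD2l; apply/andP; split.
  by rewrite divr_ge0 ?(ltW z2)// mulr_ge0//; lra.
rewrite ler_pdivrMr//; have k1 : 1 <= (1 + z) ^+ 2 by rewrite exprn_ege1//; lra.
by nra.
Qed.

(** The Fejer kernel is the squared modulus of the sum of exp(i j x) over j < M, split here into
    cosine and sine sums. *)
Lemma fejer_ge0 (x : R) M :
  0 <= M%:R + 2 * \sum_(k < M) (M - k.+1)%:R * cos (k.+1%:R * x).
Proof.
suff -> : M%:R + 2 * \sum_(k < M) (M - k.+1)%:R * cos (k.+1%:R * x) =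
  (\sum_(j < M) cos (j%:R * x)) ^+ 2 + (\sum_(j < M) sin (j%:R * x)) ^+ 2.
  by rewrite addr_ge0// sqr_ge0.
(* Terms of the Dirichlet kernel: by [cesaro_recr], passing from M to M + 1 adds one Dirichlet
   kernel. *)
pose e k : R := if k is k'.+1 then 2 * cos (k'.+1%:R * x) else 1.
have -> : M%:R + 2 * \sum_(k < M) (M - k.+1)%:R * cos (k.+1%:R * x) =
    \sum_(k < M) (M - k)%:R * e k.
  by rewrite cesaro_recl /= mulr1 mulr_sumr; congr (_ + _); apply: eq_bigr => k _; ring.
elim: M => [|M IH]; first by rewrite !big_ord0; ring.
rewrite (cesaro_recr e) IH big_ord_recl /= !big_ord_recr /=.
set C := \sum_(j < M) cos _; set S := \sum_(j < M) sin _.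
have -> : \sum_(k < M) 2 * cos ((lift ord0 k)%:R * x) =
    2 * (C * cos (M%:R * x) + S * sin (M%:R * x)).
  rewrite -mulr_sumr; congr (_ * _); rewrite /C /S !mulr_suml -big_split /=.
  rewrite [LHS](reindex_inj rev_ord_inj); apply: eq_bigr => j _ /=.
  have -> : ((bump 0 (M - j.+1))%:R : R) = M%:R - j%:R.
    by rewrite /bump /= add1n subnSK// natrB// ltnW.
  by rewrite mulrBl cosB mulrC [X in _ + X]mulrC.
by have := cos2Dsin2 (M%:R * x); nra.
Qed.

End cesaro.

Section comparison.
Context {R : realType}.
Implicit Types (f g : R -> R) (a b : R).

(** Comparison of integrals in terms of antiderivatives, the form used for explicit integrands
    below. Derivatives are asked only in the open interval because the powers of [pospow] are
    differentiated away from 0. *)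
Lemma derive_le_increment f g f' g' a b : a <= b ->
  (forall x : R, a < x < b -> is_derive x 1 f (f' x)) ->
  (forall x : R, a < x < b -> is_derive x 1 g (g' x)) ->
  (forall x, a < x < b -> f' x <= g' x) ->
  (forall x, a <= x <= b -> {for x, continuous f}) ->
  (forall x, a <= x <= b -> {for x, continuous g}) ->
  f b - f a <= g b - g a.
Proof.
move=> ab df dg fg cf cg.
have [||c] := @MVT_segment _ (fun x => g x - f x) (fun x => g' x - f' x) a b ab.
- by move=> x; rewrite in_itv/= => xab; exact: is_derive1_sub (dg x xab) (df x xab).
- by apply: within_continuous_pt => x xab; apply: continuousB; [exact: cg|exact: cf].
rewrite in_itv/= => /andP[ac cb] e.
move: ab; rewrite le_eqVlt => /orP[/eqP ->|ab]; first by rewrite !subrr.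
have [||c'] := @MVT _ (fun x => g x - f x) (fun x => g' x - f' x) a b ab.
- by move=> x; rewrite in_itv/= => xab; exact: is_derive1_sub (dg x xab) (df x xab).
- by apply: within_continuous_pt => x xab; apply: continuousB; [exact: cg|exact: cf].
rewrite in_itv/= => h e'.
have : 0 <= (g' c' - f' c') * (b - a).
  by rewrite mulr_ge0// subr_ge0 ?fg// ltW.
by rewrite -e'; lra.
Qed.

Lemma is_derive1_sum (I : Type) (s : seq I) (f f' : I -> R -> R) (x : R) :
  (forall i, is_derive x 1 (f i) (f' i x)) ->
  is_derive x 1 (fun y => \sum_(i <- s) f i y) (\sum_(i <- s) f' i x).
Proof.
move=> df; elim: s => [|i s IH].
  rewrite big_nil; under eq_fun do rewrite big_nil; exact: is_derive_cst.
rewrite big_cons; under eq_fun do rewrite big_cons.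
exact: is_derive1_add.
Qed.

Lemma continuous_sumR (I : Type) (s : seq I) (f : I -> R -> R) (x : R) :
  (forall i, {for x, continuous (f i)}) ->
  {for x, continuous (fun y => \sum_(i <- s) f i y)}.
Proof.
move=> cf; elim: s => [|i s IH].
  have -> : (fun y : R => \sum_(i <- [::]) f i y) = cst 0 by apply/funext => y; rewrite big_nil.
  exact: cst_continuous.
have -> : (fun y : R => \sum_(j <- i :: s) f j y) = (fun y => f i y + \sum_(j <- s) f j y).
  by apply/funext => y; rewrite big_cons.
by apply: continuousD.
Qed.

End comparison.

Section fejer.
Context {R : realType}.

(* The Fejer kernel is nonnegative and cos (c x) <= 1, so its integral against
   cos (c x) over [0, pi] is at most its total mass. *)
Lemma fejer_sum (c : R) (M : nat) : 0 < c < 1 ->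
  sin (c * pi) * (M%:R / c + \sum_(k < M) (M - k.+1)%:R * ((-1) ^+ k.+1 *
     ((k.+1%:R + c)^-1 - (k.+1%:R - c)^-1))) <= M%:R * pi.
Proof.
move=> /andP[c0 c1].
pose Q k x : R := (M - k.+1)%:R * (sin ((k.+1%:R + c) * x) / (k.+1%:R + c) + sin ((k.+1%:R - c) * x) / (k.+1%:R - c)).
pose f x : R := M%:R * (sin (c * x) / c) + \sum_(k < M) Q k x.
pose g x : R := M%:R * x + \sum_(k < M) 2 * ((M - k.+1)%:R * (sin (k.+1%:R * x) / k.+1%:R)).
have ds (w x : R) : w != 0 -> is_derive x 1 (fun x => sin (w * x) / w) (cos (w * x)).
  move=> w0.
  have d1 : is_derive x 1 (fun x => w * x) w.
    by have := is_derive1_scale w (is_derive_id x 1); rewrite mulr1.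
  have d2 := is_derive1_scale w^-1 (is_derive1_compf (is_derive_sin (w * x)) d1).
  have -> : (fun x => sin (w * x) / w) = (fun x => w^-1 * sin (w * x)).
    by apply/funext => y; rewrite mulrC.
  by apply: (is_derive_eq d2); field.
have kc (k : nat) : k.+1%:R + c != 0 by rewrite gt_eqF// addr_gt0.
have kc' (k : nat) : k.+1%:R - c != 0.
  by rewrite gt_eqF// subr_gt0 (lt_le_trans c1)// ler1n.
have dQ k (x : R) : is_derive x 1 (Q k) (2 * ((M - k.+1)%:R * cos (k.+1%:R * x)) * cos (c * x)).
  have := is_derive1_scale (M - k.+1)%:R (is_derive1_add (ds _ x (kc k)) (ds _ x (kc' k))).
  move=> D; apply: (is_derive_eq D).
  by rewrite mulrDl mulrBl cosD cosB; ring.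
have df (x : R) : is_derive x 1 f (M%:R * cos (c * x) + \sum_(k < M) 2 * ((M - k.+1)%:R * cos (k.+1%:R * x)) * cos (c * x)).
  apply: is_derive1_add; first by apply: is_derive1_scale; apply: ds; rewrite gt_eqF.
  exact: (@is_derive1_sum _ _ _ (fun k : 'I_M => Q k)
    (fun k x => 2 * ((M - k.+1)%:R * cos (k.+1%:R * x)) * cos (c * x)) x (fun k => dQ k x)).
have dg (x : R) : is_derive x 1 g (M%:R + \sum_(k < M) 2 * ((M - k.+1)%:R * cos (k.+1%:R * x))).
  apply: is_derive1_add; first by have := is_derive1_scale M%:R (is_derive_id x 1); rewrite mulr1.
  apply: (@is_derive1_sum _ _ _ (fun (k : 'I_M) x => 2 * ((M - k.+1)%:R * (sin (k.+1%:R * x) / k.+1%:R)))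
    (fun k x => 2 * ((M - k.+1)%:R * cos (k.+1%:R * x))) x) => k.
  by do 2 apply: is_derive1_scale; apply: ds; rewrite pnatr_eq0.
have H := @derive_le_increment _ f g _ _ 0 pi (pi_ge0 R) (fun x _ => df x) (fun x _ => dg x) _
  (fun x _ => is_derive_continuous (df x)) (fun x _ => is_derive_continuous (dg x)).
have : f pi - f 0 <= g pi - g 0.
  apply: H => x _; rewrite -mulr_suml -mulrDl -mulr_sumr ler_piMr ?cos_le1//.
  exact: fejer_ge0.
have -> : f 0 = 0.
  rewrite /f mulr0 sin0 mul0r mulr0 add0r big1// => k _.
  by rewrite /Q !mulr0 sin0 !mul0r addr0 mulr0.
have -> : g 0 = 0.
  by rewrite /g mulr0 add0r big1// => k _; rewrite mulr0 sin0 mul0r !mulr0.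
have cn (n : nat) : cos (n%:R * pi) = (-1) ^+ n :> R.
  elim: n => [|n IH]; first by rewrite mul0r cos0 expr0.
  by rewrite -natr1 mulrDl mul1r cosDpi IH exprS mulN1r.
have sn (n : nat) : sin (n%:R * pi) = 0 :> R.
  elim: n => [|n IH]; first by rewrite mul0r sin0.
  by rewrite -natr1 mulrDl mul1r sinDpi IH oppr0.
have -> : g pi = M%:R * pi.
  by rewrite /g big1 ?addr0// => k _; rewrite sn mul0r !mulr0.
rewrite !subr0; apply: le_trans; rewrite le_eqVlt; apply/orP; left; apply/eqP.
rewrite /f mulrDr mulr_sumr; congr (_ + _); first by field; rewrite gt_eqF.
apply: eq_bigr => k _; rewrite /Q [(k.+1%:R + c) * pi]mulrDl [(k.+1%:R - c) * pi]mulrBl sinD sinB sn cn.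
by move: (kc k) (kc' k); move: (k.+1%:R : R) => K h1 h2; field; rewrite h1 h2.
Qed.

End fejer.

Section kernel_integral.
Context {R : realType}.
Variable b : R.
Hypothesis b1 : 1 < b.
Implicit Types (t s : R).

(** Extended by 0 to t <= 0 the power is continuous on the whole line, so an antiderivative of 1 /
    (1 + t^b) can start left of 0 and has a two-sided derivative at 0. *)
Definition pospow t : R := (Num.max t 0) `^ b.

Let b0 : 0 < b. Proof. by rewrite (lt_trans ltr01). Qed.

Lemma pospowE t : 0 <= t -> pospow t = t `^ b.
Proof. by move=> t0; rewrite /pospow (max_idPl t0). Qed.

Lemma pospow_le0 t : t <= 0 -> pospow t = 0.
Proof. by move=> t0; rewrite /pospow (max_idPr t0) powR0// gt_eqF. Qed.

Lemma pospow_ge0 t : 0 <= pospow t. Proof. exact: powR_ge0. Qed.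

Lemma pospow_gt0 t : 0 < t -> 0 < pospow t.
Proof. by move=> t0; rewrite pospowE ?ltW// powR_gt0. Qed.

Lemma pospow1 : pospow 1 = 1. Proof. by rewrite pospowE// powR1. Qed.

Lemma ler_pospow t s : t <= s -> pospow t <= pospow s.
Proof.
move=> ts; apply: (ge0_ler_powR (ltW b0)); try by rewrite nnegrE le_max lexx orbT.
by rewrite ge_max !le_max ts lexx orbT.
Qed.

Lemma is_derive_powR (t c : R) : 0 < t -> is_derive t 1 (fun x => x `^ c) (c * t `^ (c - 1)).
Proof.
move=> t0; apply: DeriveDef.
  by apply: derivable_powR; rewrite in_itv/= t0.
by rewrite -derive1E powR_derive1 ?in_itv/= ?t0.
Qed.

Lemma is_derive_pospow t : 0 < t -> is_derive t 1 pospow (b * pospow t / t).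
Proof.
move=> t0; apply: (@near_eq_is_derive R R R (fun x => x `^ b)).
  by near=> x; rewrite pospowE//; near: x; exact: (filterS (fun y => @ltW _ _ 0 y) (lt_nbhsr t0)).
apply: (is_derive_eq (is_derive_powR b t0)).
by rewrite pospowE ?ltW// powRB ?gt_eqF ?implybT// powRr1 ?ltW// mulrA.
Unshelve. all: by end_near. Qed.

Lemma continuous_pospow : continuous pospow.
Proof.
move=> t; have [t0|t0|<-] := ltgtP 0 t.
- exact: is_derive_continuous (is_derive_pospow t0).
- rewrite /continuous_at (pospow_le0 (ltW t0)); apply: cvg_near_cst; near=> x.
  apply/eqP; rewrite pospow_le0//; near: x.
  exact: (filterS (fun y => @ltW _ _ y 0) (lt_nbhsl t0)).
- apply/cvgrPdist_le => e e0; rewrite (pospow_le0 (lexx 0)); near=> x.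
  rewrite sub0r normrN ger0_norm ?pospow_ge0//.
  have xe : `|x| <= e by near: x; apply: (cvgr_le _ (@norm_continuous _ R 0)); rewrite normr0.
  have x1 : `|x| <= 1 by near: x; apply: (cvgr_le _ (@norm_continuous _ R 0)); rewrite normr0.
  have [x0|x0] := leP x 0; first by rewrite pospow_le0// ltW.
  rewrite (pospowE (ltW x0)); apply: le_trans xe; rewrite gtr0_norm// in x1 *.
  by rewrite ge1r_powR ?x0 ?x1// ltW.
Unshelve. all: by end_near. Qed.

Lemma pow_mul_decay e : 0 < e -> exists2 s, 1 <= s & s / pospow s <= e.
Proof.
move=> e0; pose d := b - 1; have d0 : 0 < d by rewrite subr_gt0.
exists (Num.max 1 (e^-1 `^ d^-1)); first by rewrite le_max lexx.
set s := Num.max _ _; have s1 : 1 <= s by rewrite le_max lexx.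
have s0 : 0 < s by exact: lt_le_trans s1.
rewrite (pospowE (ltW s0)) (_ : s `^ b = s * s `^ d); last first.
  by rewrite -{2}(powRr1 (ltW s0)) -powRD ?gt_eqF ?implybT// /d addrC subrK.
rewrite invfM mulrA divff ?gt_eqF// mul1r -[leRHS]invrK lef_pV2 ?posrE ?powR_gt0 ?invr_gt0//.
rewrite -[leLHS](_ : (e^-1 `^ d^-1) `^ d = _).
  apply: (ge0_ler_powR (ltW d0)); [exact: powR_ge0|exact: ltW|by rewrite /s le_max lexx orbT].
by rewrite -powRrM mulVf ?gt_eqF// powRr1// invr_ge0 ltW.
Qed.

(* Both sums are Cesaro means of the alternating series obtained by expanding
   the integrand in powers of t^b on [0, 1] and of t^-b beyond. *)
Lemma kernel_bound_cesaro (A : R -> R) M s : (forall t, 0 <= t -> is_derive t 1 A (1 + pospow t)^-1) -> 0 <= s ->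
  M%:R * (A s - A 0) <= \sum_(k < M) (M - k)%:R * ((-1) ^+ k / (b * k%:R + 1)) +
    \sum_(k < M) (M - k.+1)%:R * ((-1) ^+ k / (b * k.+1%:R - 1)) + 2 / (b - 1).
Proof.
move=> dA s0.
have cA t : 0 <= t -> {for t, continuous A} by move=> t0; exact: is_derive_continuous (dA t t0).
pose P1 t : R := \sum_(k < M) ((M - k)%:R * (-1) ^+ k / (b * k%:R + 1)) * (t * pospow t ^+ k).
(* The last summand integrates the error 2 z of [cesaro_geometric_bound] for z = t^-b. It is needed
   only beyond 1, where 1 / (1 + t^b) = 1 - 1 / (1 + z) calls for the upper estimate; on [0, 1] the
   lower estimate has no error. *)
pose P2 t : R := \sum_(k < M) ((M - k.+1)%:R * (-1) ^+ k / (1 - b * k.+1%:R)) * (t * (pospow t)^-1 ^+ k.+1)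
   + (2 / (1 - b)) * (t * (pospow t)^-1 ^+ 1).
have cid t : {for t, continuous (fun x : R => x)} by exact: cvg_id.
have cP1 t : {for t, continuous P1}.
  apply: (@continuous_sumR _ _ _ (fun (k : 'I_M) t => ((M - k)%:R * (-1) ^+ k / (b * k%:R + 1)) * (t * pospow t ^+ k))) => k.
  apply: continuousM; first exact: cst_continuous.
  apply: continuousM; first exact: cid.
  apply: (@continuous_comp _ _ _ pospow (fun x => x ^+ k)); first exact: continuous_pospow.
  exact: exprn_continuous.
have dpk k t : 0 < t -> is_derive t 1 (fun t => t * pospow t ^+ k) ((b * k%:R + 1) * pospow t ^+ k).
  move=> t0; have tn : t != 0 by rewrite gt_eqF.
  have D := is_derive1_mul (is_derive_id t 1) (is_derive1_exp k (is_derive_pospow t0)).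
  apply: (is_derive_eq D); case: k {D} => [|k]; first by rewrite !expr0; ring.
  by rewrite /= exprS; field.
have dpV k t : 0 < t -> is_derive t 1 (fun t => t * (pospow t)^-1 ^+ k) ((1 - b * k%:R) * (pospow t)^-1 ^+ k).
  move=> t0; have tn : t != 0 by rewrite gt_eqF.
  have pn : pospow t != 0 by rewrite gt_eqF// pospow_gt0.
  have D := is_derive1_mul (is_derive_id t 1) (is_derive1_exp k (is_derive1_inv pn (is_derive_pospow t0))).
  apply: (is_derive_eq D); case: k {D} => [|k]; first by rewrite !expr0; ring.
  by rewrite /= ![(pospow t)^-1 ^+ k.+1]exprS; move: ((pospow t)^-1 ^+ k) pn => Y pn; field; rewrite ?tn ?pn.
have nb k : b * k%:R + 1 != 0 by rewrite gt_eqF// ltr_wpDl// mulr_ge0// ltW.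
have bk (k : nat) : 1 < b * k.+1%:R.
  by rewrite (lt_le_trans b1)// ler_peMr ?ler1n// ltW.
have nb2 (k : nat) : 1 - b * k.+1%:R != 0 by rewrite lt_eqF// subr_lt0.
have dP1 t : 0 < t -> is_derive t 1 P1 (\sum_(k < M) (M - k)%:R * (- pospow t) ^+ k).
  move=> t0.
  apply: (@is_derive1_sum _ _ _ (fun (k : 'I_M) t => ((M - k)%:R * (-1) ^+ k / (b * k%:R + 1)) * (t * pospow t ^+ k))
    (fun (k : 'I_M) t => (M - k)%:R * (- pospow t) ^+ k) t) => k.
  apply: (is_derive_eq (is_derive1_scale _ (dpk k t t0))).
  by rewrite [in RHS]exprNn; field.
have dP2 t : 0 < t -> is_derive t 1 P2
    (\sum_(k < M) (M - k.+1)%:R * ((-1) ^+ k * (pospow t)^-1 ^+ k.+1) + 2 * (pospow t)^-1).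
  move=> t0; apply: is_derive1_add.
    apply: (@is_derive1_sum _ _ _ (fun (k : 'I_M) t => ((M - k.+1)%:R * (-1) ^+ k / (1 - b * k.+1%:R)) * (t * (pospow t)^-1 ^+ k.+1))
    (fun (k : 'I_M) t => (M - k.+1)%:R * ((-1) ^+ k * (pospow t)^-1 ^+ k.+1)) t) => k.
    apply: (is_derive_eq (is_derive1_scale _ (dpV k.+1 t t0))).
    by move: (nb2 k); move: (b * k.+1%:R) => K hK; field.
  apply: (is_derive_eq (is_derive1_scale _ (dpV 1%N t t0))).
  have h : 1 - b != 0 by rewrite lt_eqF// subr_lt0.
  by rewrite expr1 mulr1; move: (pospow t)^-1 => z; field.
have step1 t : 0 <= t <= 1 -> M%:R * (A t - A 0) <= P1 t - P1 0.
  move=> /andP[t0 t1].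
  have := @derive_le_increment _ (fun t => M%:R * A t) P1 (fun t => M%:R * (1 + pospow t)^-1)
    (fun t => \sum_(k < M) (M - k)%:R * (- pospow t) ^+ k) 0 t t0.
  rewrite -mulrBr; apply.
  - by move=> x /andP[x0 _]; apply: is_derive1_scale; apply: dA; exact: ltW.
  - by move=> x /andP[x0 _]; exact: dP1.
  - move=> x /andP[x0 x1]; have px : 0 <= pospow x <= 1.
      by rewrite pospow_ge0/= -pospow1 ler_pospow// ltW// (lt_le_trans x1).
    by have /andP[] := cesaro_geometric_bound M px.
  - by move=> x /andP[x0 _]; apply: continuousM; [exact: cst_continuous|exact: cA].
  - by move=> x _; exact: cP1.
have step2 t : 1 <= t -> M%:R * (A t - A 1) <= P2 t - P2 1.
  move=> t1.
  have := @derive_le_increment _ (fun t => M%:R * A t) P2 (fun t => M%:R * (1 + pospow t)^-1)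
    (fun t => \sum_(k < M) (M - k.+1)%:R * ((-1) ^+ k * (pospow t)^-1 ^+ k.+1) + 2 * (pospow t)^-1) 1 t t1.
  rewrite -mulrBr; apply.
  - by move=> x /andP[x0 _]; apply: is_derive1_scale; apply: dA; lra.
  - by move=> x /andP[x0 _]; apply: dP2; lra.
  - move=> x /andP[x0 x1]; have p1 : 1 <= pospow x by rewrite -pospow1 ler_pospow// ltW.
    have p0 : 0 < pospow x by exact: lt_le_trans p1.
    set z := (pospow x)^-1.
    have z0 : 0 <= z <= 1 by rewrite invr_ge0 ltW//= invf_le1.
    have /andP[_] := cesaro_geometric_bound M z0.
    rewrite cesaro_recl expr0 mulr1.
    have -> : M%:R / (1 + pospow x) = M%:R - M%:R / (1 + z).
      by rewrite /z; field; rewrite !gt_eqF//; lra.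
    have -> : \sum_(k < M) (M - k.+1)%:R * ((-1) ^+ k * z ^+ k.+1) = - \sum_(k < M) (M - k.+1)%:R * (- z) ^+ k.+1.
      by rewrite -sumrN; apply: eq_bigr => k _; rewrite [(- z) ^+ _]exprNn [(-1) ^+ k.+1]exprS; ring.
    by lra.
  - by move=> x /andP[x0 _]; apply: continuousM; [exact: cst_continuous|apply: cA; lra].
  - by move=> x /andP[x0 _]; apply: is_derive_continuous (dP2 x _); lra.
have mA t t' : 0 <= t -> t <= t' -> A t <= A t'.
  move=> t0 tt.
  have := @derive_le_increment _ (cst 0) A (cst 0) (fun t => (1 + pospow t)^-1) t t' tt.
  rewrite subrr subr_ge0; apply.
  - by move=> x /andP[x0 _]; apply: dA; lra.
  - by move=> x _; rewrite invr_ge0 addr_ge0// pospow_ge0.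
  - by move=> x _; exact: cst_continuous.
  - by move=> x /andP[x0 _]; apply: cA; lra.
have P10 : P1 0 = 0 by rewrite /P1 big1// => k _; rewrite mul0r mulr0.
have P11 : P1 1 = \sum_(k < M) (M - k)%:R * ((-1) ^+ k / (b * k%:R + 1)).
  by apply: eq_bigr => k _; rewrite pospow1 expr1n !mulr1 mulrA.
have P21 : - P2 1 = \sum_(k < M) (M - k.+1)%:R * ((-1) ^+ k / (b * k.+1%:R - 1)) + 2 / (b - 1).
  rewrite /P2 pospow1 invr1 opprD -sumrN; congr (_ + _).
    apply: eq_bigr => k _; rewrite expr1n !mulr1 -[b * _ - 1]opprB invrN; ring.
  by rewrite expr1n !mulr1 -[b - 1]opprB invrN mulrN.
(* Every term of [P2] is of order t^(1-b) or smaller, so only the value at 1 remains as t tends to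
   infinity. *)
have [C C0 hC] : exists2 C, 0 <= C & forall t, 1 <= t -> P2 t <= C * (t / pospow t).
  exists (\sum_(k < M) `|(M - k.+1)%:R * (-1) ^+ k / (1 - b * k.+1%:R)|); first exact: sumr_ge0.
  move=> t t1; have p1 : 1 <= pospow t by rewrite -pospow1 ler_pospow.
  have p0 : 0 < pospow t by exact: lt_le_trans p1.
  have tp : 0 <= t / pospow t by rewrite divr_ge0 ?(ltW p0)//; lra.
  rewrite -[leRHS]addr0 lerD//; last first.
    rewrite expr1 mulr_le0_ge0//; apply: mulr_ge0_le0 => //; by rewrite invr_le0 subr_le0 ltW.
  rewrite mulr_suml; apply: ler_sum => k _; apply: le_trans (ler_norm _) _.
  rewrite normrM ler_wpM2l// exprS mulrA normrM ger0_norm// ger0_norm ?exprn_ge0 ?invr_ge0 ?(ltW p0)//.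
  by rewrite ler_piMr// exprn_ile1 ?invr_ge0 ?(ltW p0)// invf_le1.
apply/ler_addgt0Pr => e e0.
have e1 : 0 < e / (C + 1) by rewrite divr_gt0//; lra.
have [s' s'1 hs'] := pow_mul_decay e1.
(* A is nondecreasing, so s may be replaced by any larger t. *)
have [t t1 [ts ht]] : exists2 t, 1 <= t & s <= t /\ t / pospow t <= e / (C + 1).
  exists (Num.max s s'); first by rewrite le_max s'1 orbT.
  split; first by rewrite le_max lexx.
  apply: le_trans hs'; set t := Num.max s s'.
  have t1 : s' <= t by rewrite le_max lexx orbT.
  have := @derive_le_increment _ (fun t => t * (pospow t)^-1 ^+ 1) (cst 0)
     (fun t => (1 - b * 1%:R) * (pospow t)^-1 ^+ 1) (cst 0) s' t t1.
  rewrite subrr subr_le0 !expr1; apply.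
  - by move=> x /andP[x0 _]; apply: dpV; lra.
  - by move=> x /andP[x0 _]; rewrite mulr_le0_ge0 ?invr_ge0 ?pospow_ge0// mulr1 subr_le0 ltW.
  - by move=> x /andP[x0 _]; apply: is_derive_continuous (dpV 1%N x _); lra.
  - by move=> x _; exact: cst_continuous.
have h1 := step1 1 (ltac:(by rewrite ler01 lexx)).
have h2 := step2 t t1.
have h3 := hC t t1.
have h4 : C * (t / pospow t) <= e.
  apply: le_trans (ler_wpM2l C0 ht) _; rewrite mulrA ler_pdivrMr; last lra.
  by nra.
have h5 : M%:R * (A s - A 0) <= M%:R * (A t - A 0).
  by rewrite ler_wpM2l// lerD2r mA.
move: P11 P21 P10 h1 h2 h3 h4 h5; clear => *; lra.
Qed.

(** The upper half of \int_0^oo ds / (1 + s^b) = (pi/b) / sin(pi/b). With c = 1/b the sums of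
    [kernel_bound_cesaro] are exactly c times those of [fejer_sum], and the fixed term 2 / (b - 1)
    is lost after division by a large M. *)
Lemma kernel_bound (A : R -> R) s : (forall t, 0 <= t -> is_derive t 1 A (1 + pospow t)^-1) -> 0 <= s ->
  A s - A 0 <= (pi / b) / sin (pi / b).
Proof.
move=> dA s0; pose c := b^-1.
have c01 : 0 < c < 1 by rewrite invr_gt0 b0 invf_lt1.
have sc : 0 < sin (pi / b).
  apply: sin_gt0_pi; rewrite divr_gt0 ?pi_gt0//= ltr_pdivrMr// ltr_pMr ?pi_gt0//.
apply/ler_addgt0Pr => e e0.
have [M M0 hM] : exists2 M : nat, (0 < M)%N & 2 / (b - 1) / M%:R <= e.
  have b10 : 0 < b - 1 by rewrite subr_gt0.
  exists (Num.truncn (2 / (b - 1) / e)).+1 => //.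
  rewrite ler_pdivrMr ?ltr0n// [leRHS]mulrC -ler_pdivrMr//; exact: (ltW (truncnS_gt _)).
have MR : (0 : R) < M%:R by rewrite ltr0n.
have F := fejer_sum M c01.
have := kernel_bound_cesaro M dA s0.
rewrite (cesaro_recl (fun k => (-1) ^+ k / (b * k%:R + 1))) => K.
rewrite -(@ler_pM2l _ M%:R)//; apply: le_trans K _.
rewrite mulrDr lerD//; last first.
  by move: hM; rewrite ler_pdivrMr// [X in _ <= X -> _]mulrC.
have -> : M%:R * (pi / b / sin (pi / b)) = c * (M%:R * pi) / sin (pi / b).
  by rewrite /c; field; rewrite !gt_eqF.
rewrite ler_pdivlMr//.
have c0 : 0 <= c by rewrite ltW//; case/andP: c01.
apply: le_trans (ler_wpM2l c0 F); rewrite le_eqVlt; apply/orP; left; apply/eqP.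
rewrite [c * pi]mulrC -/(pi / b) [RHS]mulrCA [RHS]mulrC; congr (_ * _).
rewrite -addrA -big_split /= mulrDr; congr (_ + _).
  by rewrite mulr0 add0r expr0 /c; field; rewrite gt_eqF.
rewrite mulr_sumr; apply: eq_bigr => k _.
have bk : 1 < b * k.+1%:R by rewrite (lt_le_trans b1)// ler_peMr ?ler1n// ltW.
rewrite exprS /c; move: bk b0; move: (k.+1%:R : R) => K' bk bb.
by field; rewrite !gt_eqF//; lra.
Qed.

End kernel_integral.

(** * Radial barriers *)

Section taylor_upper.
Context {R : realType}.

(** Two mean values: subtracting the quadratic from f leaves an increment (f2(z) - c) (x - s) (y -
    s) with x between s and y, hence nonpositive on either side of s. *)
Lemma taylor_upper (f f1 f2 : R -> R) (s y c : R) :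
  (forall t : R, Num.min s y <= t <= Num.max s y -> is_derive t 1 f (f1 t)) ->
  (forall t : R, Num.min s y <= t <= Num.max s y -> is_derive t 1 f1 (f2 t)) ->
  (forall t : R, Num.min s y <= t <= Num.max s y -> f2 t <= c) ->
  f y <= f s + f1 s * (y - s) + c / 2 * (y - s) ^+ 2.
Proof.
move=> d1 d2 hc.
pose k t := f t - (f1 s * t + c / 2 * (t - s) ^+ 2).
have dk (t : R) : Num.min s y <= t <= Num.max s y -> is_derive t 1 k (f1 t - (f1 s + c * (t - s))).
  move=> ht; apply: is_derive1_sub; first exact: d1.
  apply: is_derive1_add.
    by have := is_derive1_scale (f1 s) (is_derive_id t 1); rewrite mulr1.
  have D0 := is_derive1_sub (is_derive_id t 1) (is_derive_cst s t 1).
  have D := is_derive1_scale (c / 2) (is_derive1_exp 2 D0).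
  by apply: (is_derive_eq D); rewrite /= expr1; field.
have [x hx e] := @MVT_any _ (fun t => f1 t - (f1 s + c * (t - s))) k s y dk.
have [sx|sx] := leP s y.
  rewrite (min_idPl sx) (max_idPr sx) in hx d2 hc.
  have /andP[x1 x2] := hx.
  have [|z] := @MVT_any _ f2 f1 s x.
    by move=> t; rewrite (min_idPl x1) (max_idPr x1) => /andP[t1 t2]; apply: d2; rewrite t1 (le_trans t2).
  rewrite (min_idPl x1) (max_idPr x1) => /andP[z1 z2] e2.
  have hz : f2 z <= c by apply: hc; rewrite z1 (le_trans z2).
  have : (f1 x - (f1 s + c * (x - s))) * (y - s) <= 0.
    rewrite mulr_le0_ge0 ?subr_ge0// opprD addrA e2 -mulrBl.
    by rewrite mulr_le0_ge0 ?subr_ge0// subr_le0.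
  rewrite -e /k; lra.
have sx' := ltW sx.
rewrite (min_idPr sx') (max_idPl sx') in hx d2 hc.
have /andP[x1 x2] := hx.
have [|z] := @MVT_any _ f2 f1 s x.
  by move=> t; rewrite (min_idPr x2) (max_idPl x2) => /andP[t1 t2]; apply: d2; rewrite t2 (le_trans x1).
rewrite (min_idPr x2) (max_idPl x2) => /andP[z1 z2] e2.
have hz : f2 z <= c by apply: hc; rewrite z2 (le_trans x1).
have : (f1 x - (f1 s + c * (x - s))) * (y - s) <= 0.
  rewrite mulr_ge0_le0 ?subr_le0// opprD addrA e2 -mulrBl.
  by rewrite mulr_le0 ?subr_le0.
by rewrite -e /k; lra.
Qed.

End taylor_upper.

Section radial.
Context {R : realType} {N : nat}.
Notation E := 'rV[R]_N.
Notation mu := (@lebesgue_rV R N).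

Definition nsq (x : E) : R := \sum_(i < N) x ord0 i ^+ 2.

Lemma nsq_ge0 x : 0 <= nsq x.
Proof. by apply: sumr_ge0 => i _; exact: sqr_ge0. Qed.

Lemma nsq_line x i t : nsq (x + t *: delta_mx ord0 i) = nsq x + (2 * t * x ord0 i + t ^+ 2).
Proof.
rewrite /nsq (bigD1 i)//= [in RHS](bigD1 i)//= line_coord eqxx.
rewrite (eq_bigr (fun j => x ord0 j ^+ 2)); first by ring.
by move=> j /negbTE ji; rewrite line_coord ji addr0.
Qed.

Lemma measurable_nsq : measurable_fun setT nsq.
Proof.
by apply: measurable_sum => i; apply: measurable_funX; exact: measurable_coord.
Qed.

Lemma nsq_cube (x : E) r : 0 <= r -> nsq x <= r ^+ 2 -> cube r x.
Proof.
move=> r0 h; apply/cubeP => i; rewrite -ler_sqr ?nnegrE// real_normK ?num_real//.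
apply: le_trans h; rewrite /nsq (bigD1 i)//= lerDl.
by apply: sumr_ge0 => j _; exact: sqr_ge0.
Qed.

Lemma cube_nsq (x : E) r : cube r x -> nsq x <= N%:R * r ^+ 2.
Proof.
move=> /cubeP h; rewrite /nsq mulr_natl -[X in _ *+ X]card_ord -sumr_const.
apply: ler_sum => i _; rewrite -real_normK ?num_real// lerXn2r ?nnegrE//.
exact: le_trans (h i).
Qed.

(** A step of h or -h along e_i moves |x|^2 by 2 h x_i + h^2 or - 2 h x_i + h^2; adding the two
    Taylor bounds and summing over i gives the radial Laplacian. It suffices that f lies above w and
    touches it at |x|^2: f will be the active branch of a minimum. *)
Lemma dlap_radial_le (w f f1 f2 : R -> R) (x : E) (h rho c : R) :
  0 < h -> (forall i, 2 * h * `|x ord0 i| + h ^+ 2 < rho) ->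
  (forall y : R, 0 <= y -> `|y - nsq x| < rho -> is_derive y 1 f (f1 y)) ->
  (forall y : R, 0 <= y -> `|y - nsq x| < rho -> is_derive y 1 f1 (f2 y)) ->
  (forall y : R, 0 <= y -> `|y - nsq x| < rho -> f2 y <= c) ->
  (forall y : R, 0 <= y -> `|y - nsq x| < rho -> w y <= f y) ->
  w (nsq x) = f (nsq x) ->
  dlap h (w \o nsq) x <= 2 * N%:R * f1 (nsq x) + 4 * c * nsq x + N%:R * c * h ^+ 2.
Proof.
move=> h0 hr d1 d2 hc wf ws; set s := nsq x in d1 d2 hc wf ws *.
have s0 : 0 <= s by exact: nsq_ge0.
have T y : 0 <= y -> `|y - s| < rho -> w y <= f s + f1 s * (y - s) + c / 2 * (y - s) ^+ 2.
  move=> y0 ys; apply: le_trans (wf _ y0 ys) _.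
  have B t : Num.min s y <= t <= Num.max s y -> 0 <= t /\ `|t - s| < rho.
    move=> /andP[t1 t2]; have [sy|sy] := leP s y.
      rewrite (min_idPl sy) (max_idPr sy) in t1 t2.
      split; first exact: le_trans t1.
      by apply: le_lt_trans ys; rewrite !ger0_norm ?subr_ge0// lerD2r.
    have sy' := ltW sy; rewrite (min_idPr sy') (max_idPl sy') in t1 t2.
    split; first exact: le_trans t1.
    by apply: le_lt_trans ys; rewrite !ler0_norm ?subr_le0// lerN2 lerD2r.
  exact: (@taylor_upper _ f f1 f2 s y c (fun t ht => d1 t (B t ht).1 (B t ht).2)
    (fun t ht => d2 t (B t ht).1 (B t ht).2) (fun t ht => hc t (B t ht).1 (B t ht).2)).
have -> : 2 * N%:R * f1 s + 4 * c * s + N%:R * c * h ^+ 2 =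
    \sum_(i < N) (2 * f1 s + 4 * c * x ord0 i ^+ 2 + c * h ^+ 2).
  rewrite !big_split /= !sumr_const card_ord -mulr_sumr -/(nsq x) -/s -[(2 * f1 s) *+ N]mulr_natl -[(c * h ^+ 2) *+ N]mulr_natl; ring.
apply: ler_sum => i _; rewrite /translate /= !nsq_line -/s ws.
have b0 t : `|t| = h -> `|2 * t * x ord0 i + t ^+ 2| < rho.
  move=> th; apply: le_lt_trans (hr i); rewrite (le_trans (ler_normD _ _))//.
  by rewrite normrX normrM normrM th ger0_norm.
have b1 : `|2 * h * x ord0 i + h ^+ 2| < rho by apply: b0; exact: gtr0_norm.
have b2 : `|2 * - h * x ord0 i + (- h) ^+ 2| < rho by apply: b0; rewrite normrN gtr0_norm.
have n1 : 0 <= s + (2 * h * x ord0 i + h ^+ 2) by rewrite -nsq_line nsq_ge0.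
have n2 : 0 <= s + (2 * - h * x ord0 i + (- h) ^+ 2) by rewrite -nsq_line nsq_ge0.
have := T _ n1; rewrite [s + _ - s]addrAC subrr add0r => /(_ b1) T1.
have := T _ n2; rewrite [s + _ - s]addrAC subrr add0r => /(_ b2) T2.
rewrite ler_pdivrMr ?exprn_gt0//.
move: T1 T2; move: (x ord0 i) (f1 s) (f s) (w _) (w _) => X q p a b; clear => T1 T2.
apply: le_trans (lerD (lerD T1 T2) (lexx _)) _; rewrite le_eqVlt; apply/orP; left; apply/eqP.
by field.
Qed.

End radial.

Lemma step_small (R : realType) (a r h t : R) : t <= r + 1 -> h <= a -> 0 < h -> 0 <= t ->
  a * (2 * (r + 2)) = 1 -> 1 <= r -> 2 * h * t + h ^+ 2 < 1.
Proof. by move=> *; nra. Qed.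

Lemma second_order_error (R : realType) (n a s f F h e1 e : R) :
  e1 * (4 * s + n * (F + 1) + 1) <= e -> h <= n * (F + 1) * e1 -> 0 < e1 ->
  2 * n * a + 4 * (f + e1) * s + h <= 2 * n * a + 4 * s * f + e.
Proof. by move=> *; nra. Qed.

Lemma unit_ball_bounds (R : realType) (S s T y : R) : 0 < S -> 0 <= s -> S + 1 <= s -> s <= T ->
  `|y - s| < 1 -> S < y /\ y <= T + 1 + S.
Proof. by rewrite ltr_norml => ? ? ? ? /andP[? ?]; split; lra. Qed.

Lemma step_lt (R : realType) (X t h rho : R) : t <= X -> 0 <= t -> 0 < h -> h <= 1 ->
  h < rho / (2 * X + 1) -> 2 * h * t + h ^+ 2 < rho.
Proof.
move=> tX t0 h0 h1; rewrite ltr_pdivlMr => [hr|]; last lra.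
by nra.
Qed.

(** * Testing Kato's inequality with the minimum of two barriers *)

Section barrier.
Context {R : realType} {N : nat}.
Notation E := 'rV[R]_N.
Notation mu := (@lebesgue_rV R N).
Variables (u : E -> R) (G : 'I_N -> E -> R) (q : R -> R) (B : R).
Hypotheses (lu : locint u) (lG : forall i, locint (G i)).
Hypothesis weak : forall i, is_weak_partial [:: i; i] u (G i).
Hypothesis mq : measurable_fun setT (q \o @nsq R N).
Hypothesis qB : forall y : R, 0 <= y -> `|q y| <= B.
Hypothesis eqG : (fun x => \sum_(i < N) G i x) = (fun x => q (nsq x) * u x) %[ae mu].

(** [v] is the inner barrier and [z] the outer one, with [z] used from S1 on and zero from S2 on;
    [Fr] bounds the Laplacian minus the potential term for whichever of the two is active. *)
Variables (v v1 v2 z z1 z2 Fr : R -> R) (S1 S2 : R).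
Hypotheses (S10 : 0 < S1) (S12 : S1 <= S2).
Hypothesis dv : forall y : R, 0 <= y -> is_derive y 1 v (v1 y).
Hypothesis dv1 : forall y : R, 0 <= y -> is_derive y 1 v1 (v2 y).
Hypothesis cv2 : forall y : R, 0 <= y -> {for y, continuous v2}.
Hypothesis dz : forall y : R, 0 < y -> is_derive y 1 z (z1 y).
Hypothesis dz1 : forall y : R, 0 < y -> is_derive y 1 z1 (z2 y).
Hypothesis cz2 : forall y : R, 0 < y -> {for y, continuous z2}.
Hypothesis v0 : forall y : R, 0 <= y -> 0 <= v y.
Hypothesis z0 : forall y : R, S1 <= y -> 0 <= z y.
Hypothesis zS2 : forall y : R, S2 <= y -> z y = 0.
Hypothesis vz : forall y : R, S1 <= y <= S1 + 1 -> v y < z y.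
Hypothesis mF : measurable_fun setT (Fr \o @nsq R N).
Hypothesis FB : forall y : R, 0 <= y -> `|Fr y| <= B.
Hypothesis F0 : forall y : R, S2 < y -> Fr y = 0.
Hypothesis FA : forall y : R, 0 <= y -> (y < S1 \/ v y <= z y) ->
  2 * N%:R * v1 y + 4 * y * v2 y - q y * v y <= Fr y.
Hypothesis FZ : forall y : R, S1 + 1 <= y -> z y < v y ->
  2 * N%:R * z1 y + 4 * y * z2 y - q y * z y <= Fr y.

Arguments qB {y} _.
Arguments dv {y} _.
Arguments dv1 {y} _.
Arguments cv2 {y} _.
Arguments dz {y} _.
Arguments dz1 {y} _.
Arguments cz2 {y} _.
Arguments v0 {y} _.
Arguments z0 {y} _.
Arguments zS2 {y} _.
Arguments vz {y} _.
Arguments FB {y} _.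
Arguments F0 {y} _.
Arguments FA {y} _ _.
Arguments FZ {y} _ _.

(** Truncating the arguments changes nothing for y >= 0; it makes both branches continuous on the
    whole line, hence w measurable. *)
Let w (y : R) : R := if y < S1 then v (Num.max y 0)
  else Num.min (v (Num.max y 0)) (z (Num.max y S1)).

Let wlt y : 0 <= y -> y < S1 -> w y = v y.
Proof. by move=> y0 yS; rewrite /w yS (max_idPl y0). Qed.

Let wge y : S1 <= y -> w y = Num.min (v y) (z y).
Proof.
move=> yS; rewrite /w ltNge yS /= (max_idPl yS) (max_idPl _)//.
by rewrite (le_trans _ yS)// ltW.
Qed.

Let w_le_v y : 0 <= y -> w y <= v y.
Proof.
move=> y0; have [yS|yS] := ltP y S1; first by rewrite wlt.
by rewrite wge// ge_min lexx.
Qed.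

Let w_ge0 y : 0 <= y -> 0 <= w y.
Proof.
move=> y0; have [yS|yS] := ltP y S1; first by rewrite wlt// v0.
by rewrite wge// le_min v0//= z0.
Qed.

Let w_S2 y : S2 <= y -> w y = 0.
Proof.
move=> yS; have y1 : S1 <= y by exact: le_trans yS.
by rewrite wge// zS2// (min_idPr _)// v0// (le_trans (ltW S10)).
Qed.

Let phi : E -> R := w \o @nsq R N.

(** By [vz] the outer branch can be active only from S1 + 1 on, so that w <= z in a unit
    neighbourhood of such a point, as [dlap_radial_le] requires. *)
Let branch (x : E) :
  (w (nsq x) = v (nsq x) /\ (nsq x < S1 \/ v (nsq x) <= z (nsq x))) \/
  [/\ w (nsq x) = z (nsq x), S1 + 1 <= nsq x & z (nsq x) < v (nsq x)].
Proof.
set s := nsq x; have s0 : 0 <= s by exact: nsq_ge0.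
have [sS|sS] := ltP s S1; first by left; rewrite wlt//; split => //; left.
have [h|h] := leP (v s) (z s).
  by left; rewrite wge// (min_idPl h); split => //; right.
right; split => //; first by rewrite wge// (min_idPr (ltW h)).
rewrite leNgt; apply/negP => s1.
have hs : S1 <= s <= S1 + 1 by rewrite sS ltW.
by have := vz hs; rewrite ltNge (ltW h).
Qed.

Let cont_max (f : R -> R) (b : R) : (forall y, b <= y -> {for y, continuous f}) ->
  continuous (fun y => f (Num.max y b)).
Proof.
move=> cf y; apply: (@continuous_comp _ _ _ (fun y => Num.max y b) f).
  by apply: continuous_max; [exact: cvg_id|exact: cst_continuous].
by apply: cf; rewrite le_max lexx orbT.
Qed.

Let mw : measurable_fun setT w.
Proof.
have m1 : measurable_fun setT (fun y : R => v (Num.max y 0)).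
  apply: continuous_measurable_fun; apply: cont_max => y y0.
  exact: is_derive_continuous (dv y0).
have m2 : measurable_fun setT (fun y : R => z (Num.max y S1)).
  apply: continuous_measurable_fun; apply: cont_max => y y0.
  by apply: is_derive_continuous (dz _); rewrite (lt_le_trans S10).
apply: measurable_fun_ifT => //; last exact: measurable_minr.
exact: measurable_fun_ltr.
Qed.

Let bound_on (f : R -> R) (a b : R) : a <= b -> (forall y, a <= y <= b -> {for y, continuous f}) ->
  exists K, forall y, a <= y <= b -> f y <= K.
Proof.
move=> ab cf; have [c _ hc] := EVT_max ab (within_continuous_pt cf).
by exists (f c) => y yab; apply: hc; rewrite in_itv.
Qed.

(* The test function is min(v, z), equal to v near the origin where z may be
   singular; as a minimum of two C^2 functions its second differences are
   bounded from above by those of the active branch. *)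
Lemma barrier_integral : 0 <= \int[mu]_x (`|u x| * Fr (nsq x)).
Proof.
pose r := S2 + 1.
have S20 : 0 < S2 by exact: lt_le_trans S12.
have S1p := S10.
have r1 : 1 <= r by rewrite /r lerDr ltW.
have rr : S2 <= r ^+ 2 by rewrite /r; nra.
have ccube x : ~ cube r x -> S2 < nsq x.
  move=> h; rewrite ltNge; apply/negP => k; apply: h; apply: nsq_cube; first lra.
  exact: le_trans k rr.
have [Kv hKv] : exists K, forall y, 0 <= y <= S2 -> v y <= K.
  apply: bound_on; first exact: ltW.
  by move=> y /andP[y0 _]; exact: is_derive_continuous (dv y0).
have Kv0 : 0 <= Kv by apply: le_trans (hKv 0 _); rewrite ?v0// lexx ltW.
have bphi : bdd r Kv phi.
  split.
  - by apply: measurableT_comp => //; exact: measurable_nsq.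
  - move=> x; rewrite /phi /= ger0_norm ?w_ge0 ?nsq_ge0//.
    have [h|h] := leP (nsq x) S2; last by rewrite w_S2// ltW.
    by rewrite (le_trans (w_le_v (nsq_ge0 x)))// hKv// nsq_ge0.
  - by move=> x /ccube h; rewrite /phi /= w_S2// ltW.
have phi_ge0 x : 0 <= phi x by rewrite /phi /= w_ge0// nsq_ge0.
(* [discrete_kato] bounds the integral of |u| q phi by that of |u| F; the common term cancels and
   leaves [Fr]. *)
pose F x := Fr (nsq x) + q (nsq x) * phi x.
have B0 : 0 <= B by exact: le_trans (normr_ge0 _) (qB (lexx 0)).
have bF : bdd (r + 1) (B + B * Kv) F.
  have [mp pK pz] := bphi; split.
  - by apply: measurable_funD => //; exact: measurable_funM.
  - move=> x; rewrite (le_trans (ler_normD _ _))// lerD// ?FB ?nsq_ge0//.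
    by rewrite normrM ler_pM// ?qB ?nsq_ge0.
  - move=> x h; have h' : ~ cube r x.
      by move=> /cubeP k; apply: h; apply/cubeP => i; rewrite (le_trans (k i))// lerDl.
    by rewrite /F pz// mulr0 addr0 F0//; exact: ccube.
pose T := N%:R * (r + 1) ^+ 2.
have T0 : 0 <= T by rewrite mulr_ge0// sqr_ge0.
have [K1 hK1] : exists K, forall y, 0 <= y <= T -> v1 y <= K.
  by apply: bound_on => // y /andP[y0 _]; exact: is_derive_continuous (dv1 y0).
have [K2 hK2] : exists K, forall y, 0 <= y <= T + 1 -> v2 y <= K.
  by apply: bound_on => [|y /andP[y0 _]]; [lra|exact: cv2].
have [K3 hK3] : exists K, forall y, S1 <= y <= T + S1 -> z1 y <= K.
  apply: bound_on => [|y /andP[y0 _]]; first lra.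
  by apply: is_derive_continuous (dz1 _); exact: lt_le_trans y0.
have [K4 hK4] : exists K, forall y, S1 <= y <= T + 1 + S1 -> z2 y <= K.
  by apply: bound_on => [|y /andP[y0 _]]; [lra|apply: cz2; exact: lt_le_trans y0].
(* Small enough that one step from a point of [cube (r + 1)] changes |x|^2 by less than 1, the width
   allowed by [branch]. *)
pose h_ n : R := (2 * (r + 2))^-1 * n.+1%:R^-1.
have h0 n : 0 < h_ n by rewrite mulr_gt0// invr_gt0//; lra.
have hle n : h_ n <= (2 * (r + 2))^-1.
  by rewrite ler_piMr ?invr_ge0 ?invf_le1 ?ler1n//; lra.
have hh : (2 * (r + 2))^-1 * (2 * (r + 2)) = 1 by rewrite mulVf// gt_eqF//; lra.
have hh0 : 0 < (2 * (r + 2))^-1 by rewrite invr_gt0//; lra.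
have h1 n : 0 < h_ n <= 1.
  by rewrite h0 (le_trans (hle n))//; nra.
have ch : h_ n @[n --> \oo] --> 0.
  by rewrite -[X in _ --> X](mulr0 (2 * (r + 2))^-1); apply: cvgMr; exact: cvg_harmonic.
have small n (x : E) i : cube (r + 1) x -> 2 * h_ n * `|x ord0 i| + h_ n ^+ 2 < 1.
  by move=> /cubeP/(_ i) hx; exact: (step_small hx (hle n) (h0 n) (normr_ge0 _) hh r1).
have K : exists K, forall n x, dlap (h_ n) phi x <= K.
  pose KK : R := 2 * N%:R * (`|K1| + `|K3|) + (4 * T + N%:R) * (`|K2| + `|K4|).
  have N0 : 0 <= N%:R :> R by [].
  have a1 : 0 <= `|K1| + `|K3| by rewrite addr_ge0.
  have a2 : 0 <= `|K2| + `|K4| by rewrite addr_ge0.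
  have a3 : 0 <= 4 * T + N%:R by rewrite addr_ge0// mulr_ge0.
  have KK0 : 0 <= KK by rewrite /KK addr_ge0// mulr_ge0// mulr_ge0.
  exists KK => n x; have [hx|hx] := pselect (cube (r + 1) x); last first.
    by have [C [_ _ ->]] := bdd_dlap (h1 n) bphi.
  have s0 := nsq_ge0 x.
  have sT : nsq x <= T by exact: cube_nsq.
  have fin (a c : R) : a <= `|K1| + `|K3| -> c <= `|K2| + `|K4| ->
      2 * N%:R * a + 4 * c * nsq x + N%:R * c * h_ n ^+ 2 <= KK.
    move=> ha hc; have hn2 : h_ n ^+ 2 <= 1 by have /andP[? ?] := h1 n; rewrite exprn_ile1 // ltW.
    have p1 : 2 * N%:R * a <= 2 * N%:R * (`|K1| + `|K3|) by rewrite ler_wpM2l// mulr_ge0.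
    have p2 : 4 * c * nsq x <= 4 * T * (`|K2| + `|K4|).
      rewrite -[4 * c * _]mulrA -[4 * T * _]mulrA ler_wpM2l//.
      apply: (@le_trans _ _ ((`|K2| + `|K4|) * nsq x)); first by rewrite ler_wpM2r.
      by rewrite [leRHS]mulrC ler_wpM2l.
    have p3 : N%:R * c * h_ n ^+ 2 <= N%:R * (`|K2| + `|K4|).
      rewrite -mulrA ler_wpM2l//; apply: (@le_trans _ _ ((`|K2| + `|K4|) * h_ n ^+ 2)).
        by rewrite ler_wpM2r// sqr_ge0.
      by rewrite ler_piMr.
    by rewrite /KK [(_ + N%:R) * _]mulrDl addrA lerD// lerD.
  have [[ws _]|[ws sS zv]] := branch x.
    apply: le_trans (fin (v1 (nsq x)) (`|K2|) _ _).
    - apply: (@dlap_radial_le _ _ w v v1 v2 x (h_ n) 1 `|K2|) => // [i|y y0 _|y y0 _|y y0 ys|y y0 _].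
      + exact: small.
      + exact: dv.
      + exact: dv1.
      + rewrite (le_trans _ (ler_norm _))// hK2// y0 /=.
        by rewrite -[leLHS](subrK (nsq x)) addrC lerD// (le_trans (ler_norm _))// ltW.
      + exact: w_le_v.
    - by rewrite (le_trans (hK1 _ _)) ?s0// (le_trans (ler_norm _))// lerDl.
    - by rewrite lerDl.
  have far y : `|y - nsq x| < 1 -> S1 < y /\ y <= T + 1 + S1.
    exact: unit_ball_bounds S10 s0 sS sT.
  apply: le_trans (fin (z1 (nsq x)) (`|K4|) _ _).
  - apply: (@dlap_radial_le _ _ w z z1 z2 x (h_ n) 1 `|K4|) => // [i|y y0 /far[? ?]|y y0 /far[? ?]|y y0 /far[? ?]|y y0 /far[? ?]].
    + exact: small.
    + by apply: dz; exact: lt_trans S10 _.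
    + by apply: dz1; exact: lt_trans S10 _.
    + by rewrite (le_trans _ (ler_norm _))// hK4// ltW//.
    + by rewrite wge ?ge_min ?lexx ?orbT// ltW.
  - have hs : S1 <= nsq x <= T + S1.
      by rewrite (le_trans _ sS) ?lerDl//= (le_trans sT)// lerDl ltW.
    by apply: le_trans (hK3 _ hs) _; apply: le_trans (ler_norm _) _; rewrite lerDr.
  - by rewrite lerDr.
(* At a fixed point, continuity of f2 allows the bound c = f2 + e1 near |x|^2; [D] below collects
   what multiplies e1 in the resulting error. *)
have lim_branch (x : E) (f f1 f2 : R -> R) (e rho0 : R) : 0 < e -> 0 < rho0 ->
   (forall y : R, 0 <= y -> `|y - nsq x| < rho0 -> is_derive y 1 f (f1 y)) ->
   (forall y : R, 0 <= y -> `|y - nsq x| < rho0 -> is_derive y 1 f1 (f2 y)) ->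
   (forall y : R, 0 <= y -> `|y - nsq x| < rho0 -> w y <= f y) ->
   {for nsq x, continuous f2} -> w (nsq x) = f (nsq x) ->
   \forall n \near \oo, dlap (h_ n) phi x <= 2 * N%:R * f1 (nsq x) + 4 * nsq x * f2 (nsq x) + e.
  move=> e0 rho00 d1 d2 wf cf ws.
  have s0 := nsq_ge0 x.
  pose D : R := 4 * nsq x + N%:R * (`|f2 (nsq x)| + 1) + 1.
  have N0 : 0 <= N%:R :> R by [].
  have D0 : 0 < D by rewrite /D; have := normr_ge0 (f2 (nsq x)); nra.
  pose e1 := Num.min 1 (e / D).
  have e10 : 0 < e1 by rewrite lt_min ltr01 divr_gt0.
  have /cvgrPdist_le/(_ e1 e10)/nbhs_ballP[rho1 /= rho10 hr1] := cf.
  pose rho := Num.min rho0 rho1.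
  have rho_0 : 0 < rho by rewrite lt_min rho00.
  pose X := \sum_(i < N) `|x ord0 i|.
  have hX i : `|x ord0 i| <= X by rewrite /X (bigD1 i)//= lerDl sumr_ge0.
  have X0 : 0 <= X by exact: sumr_ge0.
  near=> n.
  have hn1 : h_ n < rho / (2 * X + 1).
    by near: n; apply: (cvgr_lt _ ch); rewrite divr_gt0// ltr_wpDl// mulr_ge0.
  have hn2 : h_ n <= e1 by near: n; apply: (cvgr_le _ ch).
  have hn0 := h0 n; have /andP[_ hn3] := h1 n.
  have c1 : f2 (nsq x) + e1 <= `|f2 (nsq x)| + 1.
    by rewrite lerD ?ler_norm// ge_min lexx.
  apply: le_trans (@dlap_radial_le _ _ w f f1 f2 x (h_ n) rho (f2 (nsq x) + e1) _ _ _ _ _ _ _) _ => //.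
  - by move=> i; exact: step_lt (hX i) (normr_ge0 _) hn0 hn3 hn1.
  - by move=> y y0 yr; apply: d1 => //; rewrite (lt_le_trans yr)// ge_min lexx.
  - by move=> y y0 yr; apply: d2 => //; rewrite (lt_le_trans yr)// ge_min lexx.
  - move=> y y0 yr; have : `|f2 (nsq x) - f2 y| <= e1.
      by apply: hr1; rewrite /ball/= distrC (lt_le_trans yr)// ge_min lexx orbT.
    by move=> h; rewrite -lerBlDl (le_trans (ler_norm _))// distrC.
  - by move=> y y0 yr; apply: wf => //; rewrite (lt_le_trans yr)// ge_min lexx.
  have e2 : e1 * D <= e by rewrite -ler_pdivlMr// ge_min lexx orbT.
  have t1 : N%:R * (f2 (nsq x) + e1) * h_ n ^+ 2 <= N%:R * (`|f2 (nsq x)| + 1) * e1.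
    apply: (@le_trans _ _ (N%:R * (`|f2 (nsq x)| + 1) * h_ n ^+ 2)).
      by rewrite ler_wpM2r ?sqr_ge0// ler_wpM2l.
    rewrite ler_wpM2l ?mulr_ge0 ?addr_ge0//.
    by rewrite expr2 (le_trans _ hn2)// ler_piMr// ltW.
  exact: second_order_error e2 t1 e10.
have hF x e : 0 < e -> \forall n \near \oo, dlap (h_ n) phi x <= F x + e.
  move=> e0; have s0 := nsq_ge0 x.
  have [[ws vS]|[ws sS zv]] := branch x.
    have := @lim_branch x v v1 v2 e 1 e0 ltr01 (fun y y0 _ => dv y0) (fun y y0 _ => dv1 y0)
      (fun y y0 _ => w_le_v y0) (cv2 s0) ws.
    apply: filterS => n /le_trans; apply; rewrite lerD2r /F /phi /= ws.
    by have := FA s0 vS; lra.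
  have far y : `|y - nsq x| < 1 -> S1 < y.
    by rewrite ltr_norml => /andP[a b]; lra.
  have pos y : `|y - nsq x| < 1 -> 0 < y by move=> /far; exact: lt_trans S10.
  have := @lim_branch x z z1 z2 e 1 e0 ltr01 (fun y _ yx => dz (pos y yx)) (fun y _ yx => dz1 (pos y yx)).
  have wz y : 0 <= y -> `|y - nsq x| < 1 -> w y <= z y.
    by move=> _ /far yS; rewrite wge ?ge_min ?lexx ?orbT// ltW.
  have xpos : 0 < nsq x by rewrite (lt_le_trans _ sS)// ltr_pwDr// ltW.
  move=> /(_ wz (cz2 xpos) ws).
  apply: filterS => n /le_trans; apply; rewrite lerD2r /F /phi /= ws.
  by have := FZ sS zv; lra.
have Kato := @discrete_kato _ _ u (q \o @nsq R N) G lu lG weak mq eqG r Kv (B + B * Kv) phi F h_ bphi phi_ge0 bF h1 ch K hF.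
have lu' := locint_norm lu.
have [mFF FFK FFz] := bF.
have bFr : bdd (r + 1) B (fun x : E => Fr (nsq x)).
  split; [exact: mF|by move=> x; rewrite FB// nsq_ge0|].
  move=> x h; rewrite F0//; apply: ccube => /cubeP k; apply: h; apply/cubeP => i.
  by rewrite (le_trans (k i))// lerDl.
have bqp : bdd (r + 1) (B * Kv) (fun x => q (nsq x) * phi x).
  have [mp pK pz] := bphi; split.
  - exact: measurable_funM.
  - by move=> x; rewrite normrM ler_pM// ?qB ?nsq_ge0.
  - move=> x h; rewrite pz ?mulr0// => /cubeP k; apply: h; apply/cubeP => i.
    by rewrite (le_trans (k i))// lerDl.
have I1 := locint_mul lu' bqp.
have I2 := locint_mul lu' bF.
rewrite (_ : (fun x => _) = (fun x => `|u x| * F x - `|u x| * (q (nsq x) * phi x))); last first.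
  by apply/funext => x; rewrite /F; ring.
by rewrite RintegralB// subr_ge0.
Unshelve. all: by end_near. Qed.

End barrier.

(** * The outer barrier and its cutoff *)

Section outer.
Context {R : realType}.

Definition ramp (n : nat) (t : R) : R := Num.max t 0 ^+ n.

Lemma ramp_ge0 n t : 0 <= ramp n t.
Proof. by rewrite exprn_ge0// le_max lexx orbT. Qed.

Lemma ramp_le0 n t : t <= 0 -> ramp n.+1 t = 0.
Proof. by move=> t0; rewrite /ramp (max_idPr t0) expr0n. Qed.

Lemma ramp_le1 n t : t <= 1 -> ramp n t <= 1.
Proof. by move=> t1; rewrite exprn_ile1 ?ge_max ?t1 ?ler01 ?le_max ?lexx ?orbT. Qed.

Lemma is_derive_ramp n (t : R) : is_derive t 1 (ramp n.+2) (n.+2%:R * ramp n.+1 t).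
Proof.
have [t0|t0|<-] := ltgtP 0 t.
- apply: (@near_eq_is_derive R R R (fun x => x ^+ n.+2)).
    near=> x; rewrite /ramp (max_idPl _)//; near: x.
    exact: (filterS (fun y => @ltW _ _ 0 y) (lt_nbhsr t0)).
  apply: (is_derive_eq (is_derive1_exp n.+2 (is_derive_id t 1))).
  by rewrite mulr1 /ramp (max_idPl (ltW t0)).
- apply: (@near_eq_is_derive R R R (cst 0)).
    near=> x; rewrite ramp_le0//; near: x.
    exact: (filterS (fun y => @ltW _ _ y 0) (lt_nbhsl t0)).
  by rewrite ramp_le0 ?mulr0 ?(ltW t0)//; exact: is_derive_cst.
- rewrite ramp_le0// mulr0; apply: (is_derive_quadratic (C := 1)) => h h1.
  rewrite add0r mul0r subr0 (ramp_le0 _ (lexx 0)) subr0 mul1r ger0_norm ?ramp_ge0//.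
  have [h0|h0] := leP h 0; first by rewrite ramp_le0// sqr_ge0.
  rewrite /ramp (max_idPl (ltW h0)) -addn2 exprD ler_piMl ?sqr_ge0// exprn_ile1 ?(ltW h0)//.
  by rewrite (le_trans (ler_norm _))// ltW.
Unshelve. all: by end_near. Qed.

Lemma continuous_ramp n : continuous (ramp n).
Proof.
move=> t; apply: (@continuous_comp R R R (fun y => Num.max y 0) (fun x => x ^+ n)).
  by apply: continuous_max; [exact: cvg_id|exact: cst_continuous].
exact: exprn_continuous.
Qed.

Variable S : R.
Hypothesis S0 : 0 < S.

(** Cubes of positive parts are C^2, and so is their composite: 1 up to S, 0 from 2 S on, with first
    and second derivatives controlled at scales 1/S and 1/S^2. *)
Definition cutoff y := ramp 3 (1 - ramp 3 (y / S - 1)).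
Definition cutoff1 y := - (3 * ramp 2 (1 - ramp 3 (y / S - 1))) * (3 * ramp 2 (y / S - 1)) / S.
Definition cutoff2 y := (3 * (2 * ramp 1 (1 - ramp 3 (y / S - 1))) * (3 * ramp 2 (y / S - 1)) ^+ 2
   - (3 * ramp 2 (1 - ramp 3 (y / S - 1))) * (3 * (2 * ramp 1 (y / S - 1)))) / S ^+ 2.

Let dtau (y : R) : is_derive y 1 (fun y => y / S - 1) S^-1.
Proof.
have D := is_derive1_affine S^-1 (-1) y.
have -> : (fun y => y / S - 1) = (fun t => S^-1 * t + -1) by apply/funext => t; rewrite mulrC.
exact: D.
Qed.

Let dinner (y : R) : is_derive y 1 (fun y => 1 - ramp 3 (y / S - 1)) (- (3 * ramp 2 (y / S - 1) / S)).
Proof.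
have D := is_derive1_sub (is_derive_cst (1 : R) y 1)
  (@is_derive1_compf _ (ramp 3) (fun y => y / S - 1) y _ _ (is_derive_ramp 1 _) (dtau y)).
by apply: (is_derive_eq D); rewrite sub0r.
Qed.

Lemma is_derive_cutoff (y : R) : is_derive y 1 cutoff (cutoff1 y).
Proof.
have D := @is_derive1_compf _ (ramp 3) (fun y => 1 - ramp 3 (y / S - 1)) y _ _ (is_derive_ramp 1 _) (dinner y).
by apply: (is_derive_eq D); rewrite /cutoff1; ring.
Qed.

Lemma is_derive_cutoff1 (y : R) : is_derive y 1 cutoff1 (cutoff2 y).
Proof.
have D1 := @is_derive1_compf _ (ramp 2) (fun y => 1 - ramp 3 (y / S - 1)) y _ _ (is_derive_ramp 0 _) (dinner y).
have D2 := @is_derive1_compf _ (ramp 2) (fun y => y / S - 1) y _ _ (is_derive_ramp 0 _) (dtau y).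
have D := is_derive1_scale (- (9 / S)) (is_derive1_mul D1 D2).
have -> : cutoff1 = (fun y => - (9 / S) * (ramp 2 (1 - ramp 3 (y / S - 1)) * ramp 2 (y / S - 1))).
  by apply/funext => t; rewrite /cutoff1; ring.
apply: (is_derive_eq D); rewrite /cutoff2; field.
by rewrite gt_eqF.
Qed.

Lemma continuous_cutoff2 : continuous cutoff2.
Proof.
have ct : continuous (fun y : R => y / S - 1).
  by move=> y; exact: is_derive_continuous (dtau y).
have ci : continuous (fun y : R => 1 - ramp 3 (y / S - 1)).
  by move=> y; exact: is_derive_continuous (dinner y).
have cc n (f : R -> R) : continuous f -> continuous (fun y : R => ramp n (f y)).
  by move=> cf y; apply: (@continuous_comp R R R f (ramp n)); [exact: cf|exact: continuous_ramp].
have cz c (f : R -> R) : continuous f -> continuous (fun y : R => c * f y).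
  by move=> cf y; apply: continuousM; [exact: cst_continuous|exact: cf].
have A1 := cz 3 _ (cz 2 _ (cc 1%N _ ci)).
have A2 := cz 3 _ (cc 2%N _ ct).
have A3 := cz 3 _ (cc 2%N _ ci).
have A4 := cz 3 _ (cz 2 _ (cc 1%N _ ct)).
move=> y; apply: (@continuousM _ _ (fun y : R => 3 * (2 * ramp 1 (1 - ramp 3 (y / S - 1))) *
  (3 * ramp 2 (y / S - 1)) ^+ 2 - (3 * ramp 2 (1 - ramp 3 (y / S - 1))) *
  (3 * (2 * ramp 1 (y / S - 1)))) (fun=> (S ^+ 2)^-1)); last exact: cst_continuous.
apply: continuousB; last by apply: continuousM; [exact: A3|exact: A4].
apply: continuousM; first exact: A1.
apply: (@continuous_comp R R R (fun y => 3 * ramp 2 (y / S - 1)) (fun x => x ^+ 2)); first exact: A2.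
exact: exprn_continuous.
Qed.

Lemma cutoff_in y : y <= S -> [/\ cutoff y = 1, cutoff1 y = 0 & cutoff2 y = 0].
Proof.
move=> yS; have t0 : y / S - 1 <= 0 by rewrite subr_le0 ler_pdivrMr// mul1r.
rewrite /cutoff /cutoff1 /cutoff2 !(ramp_le0 _ t0) subr0 /ramp (max_idPl ler01) !expr1n.
by split; ring.
Qed.

Lemma cutoff_out y : 2 * S <= y -> [/\ cutoff y = 0, cutoff1 y = 0 & cutoff2 y = 0].
Proof.
move=> yS; have t1 : 1 <= y / S - 1 by rewrite lerBrDr ler_pdivlMr//; lra.
have t0 : 1 - ramp 3 (y / S - 1) <= 0.
  by rewrite subr_le0 /ramp (max_idPl (le_trans ler01 t1)) exprn_ege1.
rewrite /cutoff /cutoff1 /cutoff2 !(ramp_le0 _ t0).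
by split; ring.
Qed.

Lemma cutoff_bound y : y <= 2 * S ->
  [/\ 0 <= cutoff y <= 1, - (9 / S) <= cutoff1 y <= 0 & cutoff2 y <= 54 / S ^+ 2].
Proof.
move=> yS; have t1 : y / S - 1 <= 1 by rewrite lerBlDr ler_pdivrMr//; lra.
set t := y / S - 1 in t1 *.
have r3 := ramp_le1 3 t1; have p3 := ramp_ge0 3 t.
have r2 := ramp_le1 2 t1; have p2 := ramp_ge0 2 t.
have r1 := ramp_le1 1 t1; have p1 := ramp_ge0 1 t.
have x1 : 1 - ramp 3 t <= 1 by rewrite lerBlDr lerDl.
have q3 := ramp_le1 3 x1; have o3 := ramp_ge0 3 (1 - ramp 3 t).
have q2 := ramp_le1 2 x1; have o2 := ramp_ge0 2 (1 - ramp 3 t).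
have q1 := ramp_le1 1 x1; have o1 := ramp_ge0 1 (1 - ramp 3 t).
rewrite /cutoff /cutoff1 /cutoff2 -/t.
move: r2 p2 r1 p1 q2 o2 q1 o1; rewrite q3 o3.
move: (ramp 2 t) (ramp 1 t) (ramp 2 (1 - ramp 3 t)) (ramp 1 (1 - ramp 3 t)) => a b c e a1 a0 b1 b0 c1 c0 e1 e0.
split => //.
  have si : 0 < S^-1 by rewrite invr_gt0.
  have h : c * a <= 1 by exact: mulr_ile1.
  have h0 : 0 <= c * a by rewrite mulr_ge0.
  apply/andP; split; first by rewrite -[leLHS]mulNr ler_pM2r//; lra.
  by apply: mulr_le0_ge0 (ltW si); lra.
rewrite ler_pM2r ?invr_gt0 ?exprn_gt0//.
have a21 : a ^+ 2 <= 1 by rewrite exprn_ile1.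
have : e * a ^+ 2 <= 1 by apply: mulr_ile1 => //; exact: sqr_ge0.
have : 0 <= c * b by rewrite mulr_ge0.
by lra.
Qed.

Variables (m d : R).
Hypotheses (m0 : 0 < m) (d0 : 0 < d).

(* y^-m is harmonic; the correction - y^(-m-d) makes tail a supersolution for
   large y since the potential decays like y^-(1+2d). *)
Definition tail y := y `^ (- m) - y `^ (- m) * y `^ (- d).
Definition tail1 y := (- m * y `^ (- m) + (m + d) * (y `^ (- m) * y `^ (- d))) / y.
Definition tail2 y := (m * (m + 1) * y `^ (- m) - (m + d) * (m + d + 1) * (y `^ (- m) * y `^ (- d))) / y ^+ 2.

Lemma is_derive_powRx (c y : R) : 0 < y -> is_derive y 1 (fun x => x `^ c) (c * y `^ c / y).
Proof.
move=> y0; apply: (is_derive_eq (is_derive_powR c y0)).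
have yn : y != 0 by rewrite gt_eqF.
by rewrite powRB ?yn ?implybT// powRr1 ?(ltW y0)// mulrA.
Qed.

Lemma is_derive_tail (y : R) : 0 < y -> is_derive y 1 tail (tail1 y).
Proof.
move=> y0; have yn : y != 0 by rewrite gt_eqF.
have Dp := is_derive_powRx (- m) y0; have Dg := is_derive_powRx (- d) y0.
have D := is_derive1_sub Dp (is_derive1_mul Dp Dg).
apply: (is_derive_eq D); rewrite /tail1; move: (y `^ (- m)) (y `^ (- d)) => p g.
by field.
Qed.

Lemma is_derive_tail1 (y : R) : 0 < y -> is_derive y 1 tail1 (tail2 y).
Proof.
move=> y0; have yn : y != 0 by rewrite gt_eqF.
have Dp := is_derive_powRx (- m) y0; have Dg := is_derive_powRx (- d) y0.
have D := is_derive1_mul (is_derive1_add (is_derive1_scale (- m) Dp) (is_derive1_scale (m + d) (is_derive1_mul Dp Dg)))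
  (is_derive1_inv yn (is_derive_id y 1)).
apply: (is_derive_eq D); rewrite /tail2; move: (y `^ (- m)) (y `^ (- d)) => p g.
by field.
Qed.

Lemma continuous_powRx (c y : R) : 0 < y -> {for y, continuous (fun x => x `^ c)}.
Proof. by move=> y0; exact: is_derive_continuous (is_derive_powRx c y0). Qed.

Lemma continuous_tail2 (y : R) : 0 < y -> {for y, continuous tail2}.
Proof.
move=> y0; have cp := @continuous_powRx (- m) y y0; have cg := @continuous_powRx (- d) y y0.
have cz c (f : R -> R) : {for y, continuous f} -> {for y, continuous (fun y : R => c * f y)}.
  by move=> cf; apply: continuousM; [exact: cst_continuous|exact: cf].
apply: (@continuousM _ _ (fun y : R => m * (m + 1) * y `^ (- m) -
  (m + d) * (m + d + 1) * (y `^ (- m) * y `^ (- d))) (fun y : R => (y ^+ 2)^-1)).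
  apply: continuousB; first exact: cz.
  by apply: cz; apply: continuousM.
apply: (@continuous_comp R R R (fun x => x ^+ 2) (fun x => x^-1)); first exact: exprn_continuous.
by apply: inv_continuous; rewrite expf_neq0// gt_eqF.
Qed.

Lemma tail_laplacian y : 0 < y ->
  4 * (m + 1) * tail1 y + 4 * y * tail2 y = - (4 * d * (m + d) * (y `^ (- m) * y `^ (- d) / y)).
Proof.
move=> y0; have yn : y != 0 by rewrite gt_eqF.
by rewrite /tail1 /tail2; move: (y `^ (- m)) (y `^ (- d)) => p g; field.
Qed.

(** The correction gains 4 d (m + d) y^(-m-d-1), while the potential term is at most mu y^(-1-2d)
    y^(-m), that is mu y^-d times the same power. The last hypothesis lets it consume at most half
    of the gain. *)
Lemma tail_supersolution (mu y : R) : 0 < y -> 0 <= mu -> y `^ (- d) <= 1 -> mu * y `^ (- d) <= 2 * d * (m + d) ->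
  4 * (m + 1) * tail1 y + 4 * y * tail2 y + mu * (1 + pospow (1 + 2 * d) y)^-1 * tail y <=
  - (2 * d * (m + d) * (y `^ (- m) * y `^ (- d) / y)).
Proof.
move=> y0 mu0 g1 mg; rewrite tail_laplacian// (pospowE _ (ltW y0)).
have p0 : 0 < y `^ (- m) by rewrite powR_gt0.
have g0 : 0 < y `^ (- d) by rewrite powR_gt0.
have yn : y != 0 by rewrite gt_eqF.
have yb : y `^ (1 + 2 * d) = y * (y `^ (- d)) ^- 2.
  rewrite powRD ?yn ?implybT// powRr1 ?(ltW y0)//; congr (_ * _).
  by rewrite mulrC powRrM powRN exprVn invrK powR_mulrn// powR_ge0.
rewrite /tail yb; move: p0 g0 g1 mg; move: (y `^ (- m)) (y `^ (- d)) => p g p0 g0 g1 mg.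
have gn : g != 0 by rewrite gt_eqF.
have i0 : 0 < g ^- 2 by rewrite invr_gt0 exprn_gt0.
have a1 : (1 + y * g ^- 2)^-1 <= g ^+ 2 / y.
  rewrite -[leRHS]invrK lef_pV2 ?posrE ?invr_gt0 ?divr_gt0 ?exprn_gt0 ?addr_gt0 ?mulr_gt0//.
  by rewrite invf_div lerDr.
have b1 : mu * (1 + y * g ^- 2)^-1 * (p - p * g) <= mu * (g ^+ 2 / y) * p.
  have k0 : 0 <= (1 + y * g ^- 2)^-1 by rewrite invr_ge0 addr_ge0// mulr_ge0// ltW.
  have k1 : 0 <= p - p * g by rewrite subr_ge0 ler_piMr// ltW.
  have k2 : p - p * g <= p by rewrite lerBlDr lerDl mulr_ge0// ltW.
  apply: ler_pM => //; first exact: mulr_ge0.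
  exact: ler_wpM2l.
have E : mu * (g ^+ 2 / y) * p = mu * g * (p * g / y) by field.
rewrite E in b1.
have c0 : 0 < p * g / y by rewrite divr_gt0// mulr_gt0.
have := ler_wpM2r (ltW c0) mg.
move: b1; move: (p * g / y) (mu * (1 + y * g ^- 2)^-1 * _) (mu * g) => Y X Z b1 h; clear -b1 h.
lra.
Qed.

Lemma tail_bounds y : 0 < y -> y `^ (- d) <= 1 / 2 -> y `^ (- m) / 2 <= tail y <= y `^ (- m).
Proof.
move=> y0 g2; have p0 : 0 < y `^ (- m) by rewrite powR_gt0.
have g0 : 0 < y `^ (- d) by rewrite powR_gt0.
by rewrite /tail; move: p0 g0 g2; move: (y `^ (- m)) (y `^ (- d)) => p g *; apply/andP; split; nra.
Qed.

Variable C : R.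
Hypothesis C0 : 0 < C.

Definition outer y := C * (tail y * cutoff y).
Definition outer1 y := C * (tail y * cutoff1 y + cutoff y * tail1 y).
Definition outer2 y := C * (tail y * cutoff2 y + 2 * (tail1 y * cutoff1 y) + cutoff y * tail2 y).

Lemma is_derive_outer (y : R) : 0 < y -> is_derive y 1 outer (outer1 y).
Proof.
move=> y0; exact: (is_derive1_scale C (is_derive1_mul (is_derive_tail y0) (is_derive_cutoff y))).
Qed.

Lemma is_derive_outer1 (y : R) : 0 < y -> is_derive y 1 outer1 (outer2 y).
Proof.
move=> y0; have D1 := is_derive1_mul (is_derive_tail y0) (is_derive_cutoff1 y).
have D2 := is_derive1_mul (is_derive_cutoff y) (is_derive_tail1 y0).
apply: (is_derive_eq (is_derive1_scale C (is_derive1_add D1 D2))).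
by rewrite /outer2; ring.
Qed.

Lemma continuous_outer2 (y : R) : 0 < y -> {for y, continuous outer2}.
Proof.
move=> y0.
have c1 : {for y, continuous tail} by exact: is_derive_continuous (is_derive_tail y0).
have c2 : {for y, continuous tail1} by exact: is_derive_continuous (is_derive_tail1 y0).
have c3 := continuous_tail2 y0.
have e1 : {for y, continuous cutoff} by exact: is_derive_continuous (is_derive_cutoff y).
have e2 : {for y, continuous cutoff1} by exact: is_derive_continuous (is_derive_cutoff1 y).
have e3 : {for y, continuous cutoff2} by exact: continuous_cutoff2.
apply: (@continuousM _ _ (fun=> C) (fun y => tail y * cutoff2 y + 2 * (tail1 y * cutoff1 y) + cutoff y * tail2 y)).
  exact: cst_continuous.
apply: continuousD; last exact: continuousM.
apply: continuousD; first exact: continuousM.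
by apply: continuousM; [exact: cst_continuous|exact: continuousM].
Qed.

Lemma outer_ge0 y : 0 < y -> y `^ (- d) <= 1 / 2 -> 0 <= outer y.
Proof.
move=> y0 g2; rewrite mulr_ge0 ?(ltW C0)// mulr_ge0 ?ramp_ge0//.
by have /andP[h _] := tail_bounds y0 g2; apply: le_trans h; rewrite divr_ge0// powR_ge0.
Qed.

Lemma outer_eq0 y : 2 * S <= y -> outer y = 0.
Proof. by move=> /cutoff_out[h _ _]; rewrite /outer h !mulr0. Qed.

Lemma outer_ge y : 0 < y -> y <= S -> y `^ (- d) <= 1 / 2 -> C / 2 * y `^ (- m) <= outer y.
Proof.
move=> y0 yS g2; rewrite /outer; have [-> _ _] := cutoff_in yS.
have /andP[h _] := tail_bounds y0 g2.
by rewrite mulr1 -mulrA ler_pM2l// mulrC.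
Qed.

Lemma outer_in (mu y : R) : 0 < y -> y <= S -> 0 <= mu -> y `^ (- d) <= 1 -> mu * y `^ (- d) <= 2 * d * (m + d) ->
  4 * (m + 1) * outer1 y + 4 * y * outer2 y + mu * (1 + pospow (1 + 2 * d) y)^-1 * outer y <=
  - (C * (2 * d * (m + d) * (y `^ (- m) * y `^ (- d) / y))).
Proof.
move=> y0 yS mu0 g1 mg; rewrite /outer /outer1 /outer2; have [-> -> ->] := cutoff_in yS.
have := ler_wpM2l (ltW C0) (tail_supersolution y0 mu0 g1 mg).
rewrite mulrN; apply: le_trans; rewrite le_eqVlt; apply/orP; left; apply/eqP.
by ring.
Qed.

Lemma outer_out y : 2 * S <= y -> outer1 y = 0 /\ outer2 y = 0.
Proof.
by move=> /cutoff_out[h0 h1 h2]; rewrite /outer1 /outer2 h0 h1 h2; split; ring.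
Qed.

(** Only two cutoff terms can be positive: the cross term, at most 8 y (m y^-m / y) (9 / S), giving
    72 m, and the one with [cutoff2], at most 4 (2 S) S^-m (54 / S^2), giving 432. The remaining
    term with [cutoff1] is nonpositive because the cutoff decreases. *)
Lemma outer_transition (mu y : R) : S <= y <= 2 * S -> 0 <= mu -> y `^ (- d) <= 1 / 2 -> mu * y `^ (- d) <= 2 * d * (m + d) ->
  4 * (m + 1) * outer1 y + 4 * y * outer2 y + mu * (1 + pospow (1 + 2 * d) y)^-1 * outer y <=
  C * ((72 * m + 432) * (S `^ (- m) / S)).
Proof.
move=> /andP[Sy yS] mu0 g2 mg; have y0 : 0 < y by exact: lt_le_trans S0 Sy.
have g1 : y `^ (- d) <= 1 by apply: le_trans g2 _; lra.
have T := tail_supersolution y0 mu0 g1 mg.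
have /andP[t1 t2] := tail_bounds y0 g2.
have [/andP[c0 c1] /andP[e0 e1] f1] := cutoff_bound yS.
have p0 : 0 < y `^ (- m) by rewrite powR_gt0.
have g0 : 0 < y `^ (- d) by rewrite powR_gt0.
have pS : y `^ (- m) <= S `^ (- m).
  rewrite !powRN lef_pV2 ?posrE ?powR_gt0//.
  by apply: (ge0_ler_powR (ltW m0)) => //; rewrite nnegrE ltW.
have T1 : - (m * y `^ (- m) / y) <= tail1 y.
  rewrite /tail1 -mulNr -mulNr ler_pM2r ?invr_gt0// lerDl !mulr_ge0 ?(ltW p0) ?(ltW g0)//.
  by rewrite addr_ge0 ?(ltW m0) ?(ltW d0).
have Tn : 4 * (m + 1) * tail1 y + 4 * y * tail2 y + mu * (1 + pospow (1 + 2 * d) y)^-1 * tail y <= 0.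
  apply: le_trans T _; rewrite oppr_le0 !mulr_ge0 ?invr_ge0 ?(ltW y0) ?(ltW p0) ?(ltW g0) ?(ltW d0)//.
  by rewrite addr_ge0 ?(ltW m0) ?(ltW d0).
have tp : 0 <= tail y by apply: le_trans t1; rewrite divr_ge0// ltW.
have yn : y != 0 by rewrite gt_eqF.
have Sn : S != 0 by rewrite gt_eqF.
have h1 : 8 * y * (tail1 y * cutoff1 y) <= 72 * m * (S `^ (- m) / S).
  have k1 : tail1 y * cutoff1 y <= m * y `^ (- m) / y * (9 / S).
    have q0 : 0 <= m * y `^ (- m) / y by rewrite !mulr_ge0 ?invr_ge0 ?(ltW y0) ?(ltW p0) ?(ltW m0).
    have q1 : 0 <= 9 / S by rewrite divr_ge0 ?(ltW S0).
    by move: T1 e0 e1 q0 q1; move: (tail1 y) (cutoff1 y) (m * _ / y) (9 / S); clear => a b c e *; nra.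
  have y8 : 0 <= 8 * y by rewrite mulr_ge0// ltW.
  apply: le_trans (ler_wpM2l y8 k1) _.
  have -> : 8 * y * (m * y `^ (- m) / y * (9 / S)) = 72 * m * (y `^ (- m) / S).
    by move: (y `^ (- m)) => p; field; rewrite ?yn ?Sn.
  have m72 : 0 <= 72 * m by rewrite mulr_ge0// ltW.
  by apply: (ler_wpM2l m72); rewrite ler_pM2r// invr_gt0.
have h2 : 4 * y * (tail y * cutoff2 y) <= 432 * (S `^ (- m) / S).
  have s2 : 0 < 54 / S ^+ 2 by rewrite divr_gt0// exprn_gt0.
  have k1 : tail y * cutoff2 y <= S `^ (- m) * (54 / S ^+ 2).
    apply: le_trans (ler_wpM2l tp f1) _.
    by apply: (ler_wpM2r (ltW s2)); exact: le_trans t2 pS.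
  have y4 : 0 <= 4 * y by rewrite mulr_ge0// ltW.
  apply: le_trans (ler_wpM2l y4 k1) _.
  apply: (@le_trans _ _ (4 * (2 * S) * (S `^ (- m) * (54 / S ^+ 2)))).
    have q0 : 0 <= S `^ (- m) * (54 / S ^+ 2) by rewrite mulr_ge0 ?powR_ge0// ltW.
    by apply: (ler_wpM2r q0); lra.
  rewrite le_eqVlt; apply/orP; left; apply/eqP.
  by move: (S `^ (- m)) => p; field.
have h3 : cutoff y * (4 * (m + 1) * tail1 y + 4 * y * tail2 y + mu * (1 + pospow (1 + 2 * d) y)^-1 * tail y) <= 0.
  by rewrite mulr_ge0_le0.
have h4 : 4 * (m + 1) * (tail y * cutoff1 y) <= 0.
  by apply: mulr_ge0_le0; [rewrite mulr_ge0// addr_ge0// ltW|exact: mulr_ge0_le0].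
rewrite /outer /outer1 /outer2.
rewrite (_ : _ + _ = C * (cutoff y * (4 * (m + 1) * tail1 y + 4 * y * tail2 y + mu * (1 + pospow (1 + 2 * d) y)^-1 * tail y)
  + 8 * y * (tail1 y * cutoff1 y) + 4 * y * (tail y * cutoff2 y) + 4 * (m + 1) * (tail y * cutoff1 y))); last by ring.
rewrite ler_pM2l//.
have F (a b c e w : R) : b <= 72 * m * w -> c <= 432 * w -> a <= 0 -> e <= 0 ->
    a + b + c + e <= (72 * m + 432) * w by move=> *; lra.
exact: F h1 h2 h3 h4.
Qed.

End outer.

Lemma antiderivative (R : realType) (f : R -> R) (a : R) : continuous f ->
  exists F : R -> R, forall t : R, a < t -> is_derive t 1 F (f t).
Proof.
move=> cf; exists (fun x => \int[lebesgue_measure]_(t in `[a, x]) f t) => t at_.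
have t1 : t < t + 1 by rewrite ltrDl.
have I : lebesgue_measure.-integrable `[a, t + 1] (EFin \o f).
  by apply: integrable_pt => x _; exact: cf.
have [D1 D2] := continuous_FTC1_closed t1 I at_ (cf t).
by apply: DeriveDef; [exact: D1|rewrite -derive1E; exact: D2].
Qed.

(** The same t serves as [eta] and as the shift e of both inner barriers. For t <= 1 the product
    exceeds mu K by at most t (2 mu + K + 2), which fixes the witness. *)
Lemma strict_margin (R : realType) (mu K M : R) : 0 <= mu -> 0 < K -> mu * K < M ->
  exists t, [/\ 0 < t, t <= 1 & (mu + t) * (K + 2 * t) <= M].
Proof.
move=> mu0 K0 h; have D0 : 0 < 2 * mu + K + 2 by lra.
exists (Num.min 1 ((M - mu * K) / (2 * mu + K + 2))).
have [t1|t1] := leP 1 ((M - mu * K) / (2 * mu + K + 2)).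
  split => //; rewrite ler_pdivlMr// in t1; lra.
have t0 : 0 < (M - mu * K) / (2 * mu + K + 2) by rewrite divr_gt0// subr_gt0.
split => //; first exact: ltW.
set t := _ / _ in t0 t1 *.
have e : t * (2 * mu + K + 2) = M - mu * K by rewrite /t mulfVK// gt_eqF.
nra.
Qed.

(** * The inner barriers for the two bounds *)

Section inner.
Context {R : realType}.
Variables (b m : R).
Hypotheses (b1 : 1 < b) (m0 : 0 < m).

Let a y := (1 + pospow b y)^-1.

Let a_gt0 y : 0 < a y. Proof. by rewrite invr_gt0 ltr_wpDr// pospow_ge0. Qed.

Let a_le1 y : a y <= 1.
Proof. by rewrite invf_le1 ?lerDl ?pospow_ge0// ltr_wpDr// pospow_ge0. Qed.

Let a_anti y z : y <= z -> a z <= a y.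
Proof.
move=> yz; rewrite lef_pV2 ?posrE ?ltr_wpDr ?pospow_ge0// lerD2l.
exact: ler_pospow.
Qed.

Let continuous_a : continuous a.
Proof.
move=> y; apply: (@continuous_comp R R R (fun y => 1 + pospow b y) (fun x => x^-1)).
  by apply: continuousD; [exact: cst_continuous|exact: continuous_pospow].
by apply: inv_continuous; rewrite gt_eqF// ltr_wpDr// pospow_ge0.
Qed.

(** Young's inequality with exponents b and b / (b - 1) for the product of t y and 1, where t^b = b
    - 1. This t gives equality at the maximum point y^b = 1 / (b - 1), so the bound is sharp. *)
Lemma mul_kernel_le y : 0 <= y ->
  y * a y <= (b - 1) / b / (b - 1) `^ b^-1.
Proof.
move=> y0; pose q := b / (b - 1); have c0 : 0 < b - 1 by rewrite subr_gt0.
have b0 : 0 < b by lra.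
pose t := (b - 1) `^ b^-1; have t0 : 0 < t by rewrite powR_gt0.
have bn : b != 0 by rewrite gt_eqF.
have tb : t `^ b = b - 1 by rewrite /t -powRrM mulVf// powRr1// ltW.
have := @conjugate_powR R (t * y) 1 b q.
rewrite mulr1 powR1 powRM ?(ltW t0)// tb => /(_ _ ler01 b0).
have q0 : 0 < q by rewrite divr_gt0.
have e : b^-1 + q^-1 = 1 by rewrite /q; field; rewrite bn gt_eqF.
move=> /(_ (mulr_ge0 (ltW t0) y0) q0 e) h.
rewrite /a pospowE// ler_pdivrMr; last by rewrite ltr_wpDr// powR_ge0.
rewrite -/t -(ler_pM2l t0); apply: le_trans h _; rewrite /q le_eqVlt; apply/orP; left; apply/eqP.
by move: (y `^ b) => Y; field; rewrite !gt_eqF.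
Qed.

(* The last condition is Delta v + (mu + eta) v / (1+|x|^alpha) <= 0 in the
   variable y = |x|^2, with 2N = 4(m+1). *)
Definition inner_barrier (mu : R) (v v1 v2 : R -> R) (V0 eta : R) : Prop :=
  [/\ forall y : R, 0 <= y ->
        [/\ is_derive y 1 v (v1 y), is_derive y 1 v1 (v2 y) & {for y, continuous v2}],
      forall y : R, 0 <= y -> 0 < v y <= V0,
      0 < eta &
      forall y : R, 0 <= y -> 4 * (m + 1) * v1 y + 4 * y * v2 y + (mu + eta) * a y * v y <= 0].

(* v = (y + e)^(-m/2). *)
Lemma inner_barrier_hardy (mu : R) : 0 <= mu ->
  mu < m ^+ 2 * ((b - 1) `^ b^-1 * (b / (b - 1))) ->
  exists v v1 v2 V0 eta, inner_barrier mu v v1 v2 V0 eta.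
Proof.
move=> mu0 mub; have c0 : 0 < b - 1 by rewrite subr_gt0.
have b0 : 0 < b by lra.
pose t := (b - 1) `^ b^-1; have t0 : 0 < t by rewrite powR_gt0.
pose M0 := (b - 1) / b / t.
have M00 : 0 < M0 by rewrite !divr_gt0.
have mM : mu * M0 < m ^+ 2.
  rewrite -ltr_pdivlMr//; apply: lt_le_trans mub _.
  rewrite le_eqVlt; apply/orP; left; apply/eqP; rewrite -/t /M0; field.
  by rewrite !gt_eqF.
have [e [e0 e1 he]] := strict_margin mu0 M00 mM.
pose s := m / 2; have s0 : 0 < s by rewrite divr_gt0.
pose p y := (y + e) `^ (- s).
exists p, (fun y => - s * p y / (y + e)), (fun y => s * (s + 1) * p y / (y + e) ^+ 2), (e `^ (- s)), e.
have ye (y : R) : 0 <= y -> 0 < y + e by move=> y0; rewrite ltr_wpDl.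
have yen (y : R) : 0 <= y -> y + e != 0 by move=> /ye h; rewrite gt_eqF.
have da (y : R) : is_derive y 1 (fun y => y + e) 1.
  by have := is_derive1_affine 1 e y; under eq_fun do rewrite mul1r.
have dp (y : R) : 0 <= y -> is_derive y 1 p (- s * p y / (y + e)).
  move=> y0; have D := @is_derive1_compf _ (fun x => x `^ (- s)) (fun y => y + e) y _ _
    (is_derive_powRx (- s) (ye y y0)) (da y).
  by apply: (is_derive_eq D); rewrite mulr1.
have cp (y : R) : 0 <= y -> {for y, continuous p} by move=> /dp D; exact: is_derive_continuous D.
split.
- move=> y y0; have yn := yen y y0; split; first exact: dp.
  + have D := is_derive1_mul (is_derive1_scale (- s) (dp y y0)) (@is_derive1_inv _ (fun y => y + e) y _ yn (da y)).
    by apply: (is_derive_eq D); move: (p y) => P; field.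
  + apply: (@continuousM _ _ (fun y => s * (s + 1) * p y) (fun y => ((y + e) ^+ 2)^-1)).
      by apply: continuousM; [exact: cst_continuous|exact: cp].
    have yn2 : (y + e) ^+ 2 != 0 by rewrite expf_neq0.
    exact: is_derive_continuous (@is_derive1_inv _ (fun y => (y + e) ^+ 2) y _ yn2 (@is_derive1_exp _ (fun y => y + e) 2 y _ (da y))).
- move=> y y0; rewrite powR_gt0 ?ye//= /p !powRN lef_pV2 ?posrE ?powR_gt0 ?ye//.
  by apply: (ge0_ler_powR (ltW s0)); rewrite ?nnegrE ?(ltW e0) ?(ltW (ye y y0)) ?lerDr.
- by [].
- move=> y y0; have Y0 := ye y y0; have p0 : 0 < p y by rewrite powR_gt0.
  have h1 := mul_kernel_le y0.
  have h2 : (mu + e) * a y * (y + e) <= m ^+ 2.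
    apply: le_trans he; rewrite -mulrA ler_wpM2l ?addr_ge0 ?(ltW e0)//.
    rewrite -/t -/M0 in h1; have := a_le1 y; have := a_gt0 y => ? ?; nra.
  (* The Hardy term - m^2 (y + e) absorbs the potential by h2; the shift only adds the favourable -
     m (m + 2) e. *)
  have -> : 4 * (m + 1) * (- s * p y / (y + e)) + 4 * y * (s * (s + 1) * p y / (y + e) ^+ 2) +
      (mu + e) * a y * p y = p y / (y + e) ^+ 2 *
      ((mu + e) * a y * (y + e) * (y + e) - m ^+ 2 * (y + e) - m * (m + 2) * e).
    by rewrite /s; move: (p y) (a y) => P A; field; rewrite yen.
  rewrite mulr_ge0_le0 ?divr_ge0 ?(ltW p0) ?sqr_ge0//.
  have := ler_wpM2r (ltW Y0) h2.
  have : 0 <= m * (m + 2) * e by rewrite !mulr_ge0 ?addr_ge0 ?(ltW m0) ?(ltW e0).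
  by move: (_ * (y + e)) => X; lra.
Qed.

(* v solves v' = - (y+e)^(-m-1) g with g' = (y+e)^m / (4(1+y^b)): the Green
   potential of the weight, up to the shift e that keeps it smooth at 0. *)
Lemma inner_barrier_kernel (mu : R) : 0 <= mu ->
  mu * (pi / b / sin (pi / b)) < 4 * m ->
  exists v v1 v2 V0 eta, inner_barrier mu v v1 v2 V0 eta.
Proof.
move=> mu0 mub; have b0 : 0 < b by exact: lt_trans ltr01 b1.
pose K : R := pi / b / sin (pi / b).
have K0 : 0 < K.
  rewrite divr_gt0 ?divr_gt0 ?pi_gt0// sin_gt0_pi// divr_gt0 ?pi_gt0//=.
  by rewrite ltr_pdivrMr// ltr_pMr ?pi_gt0.
have [e [e0 e1 he]] := strict_margin mu0 K0 mub.
(* Equal to (t + e)^m for t >= - e/2 and continuous on the whole line, as [antiderivative]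
   requires. *)
pose Q t := Num.max (t + e) (e / 2) `^ m.
have e20 : 0 < e / 2 by lra.
have cQ : continuous Q.
  move=> t; apply: (@continuous_comp R R R (fun t => Num.max (t + e) (e / 2)) (fun x => x `^ m)).
    apply: continuous_max; last exact: cst_continuous.
    by apply: continuousD; [exact: cvg_id|exact: cst_continuous].
  by apply: continuous_powRx; rewrite lt_max e20 orbT.
have QE t : - (e / 2) <= t -> Q t = (t + e) `^ m by move=> h; rewrite /Q (max_idPl _)//; lra.
have [A dA] := antiderivative (- e) continuous_a.
have cf : continuous (fun t => 4^-1 * (Q t * a t)).
  move=> t; apply: (@continuousM _ _ (fun=> 4^-1) (fun t => Q t * a t)); first exact: cst_continuous.
  by apply: (@continuousM _ _ Q a); [exact: cQ|exact: continuous_a].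
have [G dG] := antiderivative (- e) cf.
have ee : - e < - (e / 2) by rewrite ltrN2; lra.
pose W t := (t + e) * (t + e) `^ m.
have da (y : R) : is_derive y 1 (fun y => y + e) 1.
  by have := is_derive1_affine 1 e y; under eq_fun do rewrite mul1r.
have dp c (y : R) : - e < y -> is_derive y 1 (fun y => (y + e) `^ c) (c * (y + e) `^ c / (y + e)).
  move=> y0; have y1 : 0 < y + e by lra.
  have D := @is_derive1_compf _ (fun x => x `^ c) (fun y => y + e) y _ _ (is_derive_powRx c y1) (da y).
  by apply: (is_derive_eq D); rewrite mulr1.
have dW (y : R) : - e < y -> is_derive y 1 W ((m + 1) * (y + e) `^ m).
  move=> y0; have y1 : y + e != 0 by rewrite gt_eqF//; lra.
  apply: (is_derive_eq (is_derive1_mul (da y) (dp m y y0))).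
  by move: ((y + e) `^ m) => X; field.
(* The integral of (t + e)^m / 4 from - e to - e/2, where the weight a is 1; thus g is the integral
   of (t + e)^m a(t) / 4 from - e. *)
pose g0 := W (- (e / 2)) / (4 * (m + 1)).
pose g y := G y - G (- (e / 2)) + g0.
have dg (y : R) : - e < y -> is_derive y 1 g (4^-1 * (Q y * a y)).
  move=> y0; have D := is_derive1_add (is_derive1_sub (dG y y0) (is_derive_cst (G (- (e / 2))) y 1)) (is_derive_cst g0 y 1).
  by apply: (is_derive_eq D); rewrite subr0 addr0.
have k0 : 0 < m + 1 by rewrite addr_gt0.
have kn : m + 1 != 0 by rewrite gt_eqF.
have gs : g (- (e / 2)) = g0 by rewrite /g subrr add0r.
have Ws : 0 < W (- (e / 2)) by rewrite mulr_gt0 ?powR_gt0//; lra.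
have Q0 y : 0 <= Q y by exact: powR_ge0.
(* The weight decreases, so it may be replaced by its value at y under the integral. *)
have glow y : 0 <= y -> a y * W y / (4 * (m + 1)) <= g y.
  move=> y0; have ey : - (e / 2) <= y by lra.
  have := @derive_le_increment _ (fun t => a y / (4 * (m + 1)) * W t) g
    (fun t => 4^-1 * ((t + e) `^ m * a y)) (fun t => 4^-1 * (Q t * a t)) _ _ ey.
  have H1 (x : R) : - (e / 2) <= x -> is_derive x 1 (fun t => a y / (4 * (m + 1)) * W t) (4^-1 * ((x + e) `^ m * a y)).
    move=> x0; have x1 : - e < x by lra.
    apply: (is_derive_eq (is_derive1_scale (a y / (4 * (m + 1))) (dW x x1))).
    by move: ((x + e) `^ m) => X; field.
  have H2 (x : R) : - (e / 2) <= x -> is_derive x 1 g (4^-1 * (Q x * a x)).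
    by move=> x0; apply: dg; lra.
  move=> /(_ (fun x h => H1 x (ltW (andP h).1)) (fun x h => H2 x (ltW (andP h).1))).
  move=> /(_ _ (fun x h => is_derive_continuous (H1 x (andP h).1)) (fun x h => is_derive_continuous (H2 x (andP h).1))).
  have H3 (x : R) : - (e / 2) < x < y -> 4^-1 * ((x + e) `^ m * a y) <= 4^-1 * (Q x * a x).
    move=> /andP[x0 x1]; rewrite ler_pM2l// QE ?(ltW x0)// ler_wpM2l ?powR_ge0//.
    by apply: a_anti; exact: ltW.
  move=> /(_ H3); rewrite gs /g0.
  have : a y * (W (- (e / 2)) / (4 * (m + 1))) <= W (- (e / 2)) / (4 * (m + 1)).
    have w0 : 0 <= W (- (e / 2)) / (4 * (m + 1)) by rewrite divr_ge0 ?(ltW Ws)// mulr_ge0// ltW.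
    by rewrite ler_piMl ?a_le1.
  rewrite ![a y / _ * _]mulrAC ![a y * (_ / _)]mulrA; lra.
have gup : g 0 <= W 0 / (4 * (m + 1)).
  have ey : - (e / 2) <= 0 by lra.
  have H1 (x : R) : - (e / 2) <= x -> is_derive x 1 (fun t => (4 * (m + 1))^-1 * W t) (4^-1 * (x + e) `^ m).
    move=> x0; have x1 : - e < x by lra.
    apply: (is_derive_eq (is_derive1_scale (4 * (m + 1))^-1 (dW x x1))).
    by move: ((x + e) `^ m) => X; field.
  have H2 (x : R) : - (e / 2) <= x -> is_derive x 1 g (4^-1 * (Q x * a x)).
    by move=> x0; apply: dg; lra.
  have H3 (x : R) : - (e / 2) < x < 0 -> 4^-1 * (Q x * a x) <= 4^-1 * (x + e) `^ m.
    by move=> /andP[x0 x1]; rewrite ler_pM2l// QE ?(ltW x0)// ler_piMr ?powR_ge0 ?a_le1.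
  have := @derive_le_increment _ g (fun t => (4 * (m + 1))^-1 * W t) _ _ _ _ ey
    (fun x h => H2 x (ltW (andP h).1)) (fun x h => H1 x (ltW (andP h).1)) H3
    (fun x h => is_derive_continuous (H2 x (andP h).1)) (fun x h => is_derive_continuous (H1 x (andP h).1)).
  rewrite gs /g0 ![(4 * (m + 1))^-1 * _]mulrC; lra.
pose P y := (y + e) `^ (- m).
have PW y : 0 <= y -> P y * W y = y + e.
  move=> y0; rewrite /P /W powRN mulrCA mulVf ?mulr1// gt_eqF// powR_gt0//; lra.
have P0 y : 0 <= y -> 0 < P y by move=> y0; rewrite powR_gt0//; lra.
have PQ y : 0 <= y -> P y * Q y = 1.
  move=> y0; rewrite QE; last lra.
  by rewrite /P powRN mulVf// gt_eqF// powR_gt0//; lra.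
have ge0 y : 0 <= y -> 0 <= g y.
  move=> y0; apply: le_trans (glow y y0); rewrite divr_ge0 ?mulr_ge0 ?powR_ge0 ?(ltW k0) ?(ltW (a_gt0 y))//; lra.
pose v1 y := - (P y * g y / (y + e)).
pose v2 y := (m + 1) * (P y * g y) / (y + e) ^+ 2 - a y / (4 * (y + e)).
(* An explicit antiderivative of [v1], because P g has derivative a / 4 - m P g / (y + e). The
   constant makes v >= e / (4 m), since A y - A 0 <= K by [kernel_bound]. *)
pose v y := m^-1 * (P y * g y + 4^-1 * (A 0 + K + e - A y)).
have mn : m != 0 by rewrite gt_eqF.
have lt0 (y : R) : 0 <= y -> - e < y by move=> ?; lra.
have dPg (y : R) : 0 <= y -> is_derive y 1 (fun y => P y * g y) (a y / 4 - m * (P y * g y) / (y + e)).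
  move=> y0; have y1 : y + e != 0 by rewrite gt_eqF//; lra.
  apply: (is_derive_eq (is_derive1_mul (dp (- m) y (lt0 y y0)) (dg y (lt0 y y0)))).
  rewrite -/(P y); have := PQ y y0; move: (P y) (Q y) (g y) => p q G' pq.
  rewrite (_ : p * (4^-1 * (q * a y)) = p * q * a y / 4); last by ring.
  by rewrite pq; field.
have dv (y : R) : 0 <= y -> is_derive y 1 v (v1 y).
  move=> y0; have y1 : y + e != 0 by rewrite gt_eqF//; lra.
  have D := is_derive1_scale m^-1 (is_derive1_add (dPg y y0) (is_derive1_scale 4^-1
    (is_derive1_sub (is_derive_cst (A 0 + K + e) y 1) (dA y (lt0 y y0))))).
  by apply: (is_derive_eq D); rewrite /v1; move: (P y * g y) (a y) => X Y; field; rewrite ?mn ?y1.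
have dv1 (y : R) : 0 <= y -> is_derive y 1 v1 (v2 y).
  move=> y0; have y1 : y + e != 0 by rewrite gt_eqF//; lra.
  have D := is_derive1_scale (-1) (is_derive1_mul (dPg y y0) (@is_derive1_inv _ (fun y => y + e) y _ y1 (da y))).
  rewrite (_ : v1 = (fun y => -1 * (P y * g y * (y + e)^-1))); last by apply/funext => t; rewrite mulN1r.
  by apply: (is_derive_eq D); rewrite /v2; move: (P y * g y) (a y) => X Y; field; rewrite ?mn ?y1.
have cv2 (y : R) : 0 <= y -> {for y, continuous v2}.
  move=> y0; have y1 : y + e != 0 by rewrite gt_eqF//; lra.
  apply: (@continuousB _ _ _ (fun y => (m + 1) * (P y * g y) / (y + e) ^+ 2) (fun y => a y / (4 * (y + e)))).
    apply: (@continuousM _ _ (fun y => (m + 1) * (P y * g y)) (fun y => ((y + e) ^+ 2)^-1)).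
      exact: is_derive_continuous (is_derive1_scale (m + 1) (dPg y y0)).
    have yn2 : (y + e) ^+ 2 != 0 by rewrite expf_neq0.
    exact: is_derive_continuous (@is_derive1_inv _ (fun y => (y + e) ^+ 2) y _ yn2 (@is_derive1_exp _ (fun y => y + e) 2 y _ (da y))).
  apply: (@continuousM _ _ a (fun y => (4 * (y + e))^-1)); first exact: continuous_a.
  have yn2 : 4 * (y + e) != 0 by rewrite mulf_neq0.
  exact: is_derive_continuous (@is_derive1_inv _ (fun y => 4 * (y + e)) y _ yn2 (is_derive1_scale 4 (da y))).
have vlow y : 0 <= y -> e / (4 * m) <= v y.
  move=> y0; have h1 := @kernel_bound _ b b1 A y (fun t t0 => dA t (lt0 t t0)) y0.
  have h2 : 0 <= P y * g y by rewrite mulr_ge0 ?ge0 ?(ltW (P0 y y0)).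
  rewrite (_ : e / (4 * m) = m^-1 * (4^-1 * e)); last by field.
  rewrite -/K in h1; rewrite ler_pM2l ?invr_gt0//; lra.
have vup y : 0 <= y -> v y <= (K + 2 * e) / (4 * m).
  move=> y0; apply: (@le_trans _ _ (v 0)).
    have := @derive_le_increment _ v (cst 0) v1 (cst 0) 0 y y0.
    rewrite subrr subr_le0; apply.
    - by move=> x /andP[x0 _]; apply: dv; exact: ltW.
    - by move=> x /andP[/ltW x0 _]; rewrite oppr_le0 divr_ge0 ?mulr_ge0 ?ge0 ?(ltW (P0 x x0))//; lra.
    - by move=> x /andP[x0 _]; exact: is_derive_continuous (dv x x0).
    - by move=> x _; exact: cst_continuous.
  have h : P 0 * g 0 <= e / (4 * (m + 1)).
    apply: le_trans (ler_wpM2l (ltW (P0 0 (lexx 0))) gup) _.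
    by rewrite mulrA PW// add0r.
  have h' : e / (4 * (m + 1)) <= 4^-1 * e.
    by rewrite mulrC ler_pM2r// lef_pV2 ?posrE ?mulr_gt0//; have := m0; lra.
  rewrite (_ : (K + 2 * e) / (4 * m) = m^-1 * (4^-1 * e + 4^-1 * (K + e))); last by field.
  by rewrite ler_pM2l ?invr_gt0//; lra.
have c0 : 0 < e / (4 * m) by rewrite divr_gt0// mulr_gt0.
exists v, v1, v2, ((K + 2 * e) / (4 * m)), e; split => //.
- by move=> y y0; split; [exact: dv|exact: dv1|exact: cv2].
- by move=> y y0; rewrite vup// andbT (lt_le_trans c0)// vlow.
- move=> y y0; have Y0 : 0 < y + e by lra.
  have Yn : y + e != 0 by rewrite gt_eqF.
  have h1 : a y * (y + e) / (4 * (m + 1)) <= P y * g y.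
    have := ler_wpM2l (ltW (P0 y y0)) (glow y y0).
    have -> : P y * (a y * W y / (4 * (m + 1))) = a y * (P y * W y) / (4 * (m + 1)) by field.
    by rewrite PW.
  have h2 : (mu + e) * v y <= 1.
    apply: le_trans (ler_wpM2l _ (vup y y0)) _; first by rewrite addr_ge0 ?(ltW e0).
    by rewrite mulrA ler_pdivrMr ?mul1r// mulr_gt0.
  (* The Green potential contributes - a, which dominates (mu + e) a v by h2; the shift leaves an
     error whose sign is given by [glow]. *)
  have -> : 4 * (m + 1) * v1 y + 4 * y * v2 y + (mu + e) * a y * v y =
      a y * ((mu + e) * v y - 1) - 4 * (m + 1) * e / (y + e) ^+ 2 * (P y * g y - a y * (y + e) / (4 * (m + 1))).
    rewrite /v1 /v2; move: (P y * g y) (a y) (v y) => X Z V; field; rewrite Yn; lra.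
  have h3 : 0 <= 4 * (m + 1) * e / (y + e) ^+ 2 by rewrite !mulr_ge0 ?invr_ge0 ?sqr_ge0 ?(ltW e0) ?(ltW k0).
  have h4 : 0 <= 4 * (m + 1) * e / (y + e) ^+ 2 * (P y * g y - a y * (y + e) / (4 * (m + 1))).
    by rewrite mulr_ge0// subr_ge0.
  rewrite lerBlDr add0r; apply: le_trans h4.
  by rewrite mulr_ge0_le0 ?(ltW (a_gt0 y))// subr_le0.
Qed.

End inner.

Lemma indic_itvcc (R : realType) (a b y : R) :
  \1_(`[a, b]%classic) y = ((a <= y <= b)%R)%:R :> R.
Proof. by rewrite indicE mem_setE in_itv. Qed.

(** * Vanishing of subsolutions that are small at infinity *)

Section vanishing.
Context {R : realType} {N : nat}.
Notation E := 'rV[R]_N.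
Notation mu := (@lebesgue_rV R N).

Lemma bdd_indic_nsq (a b : R) : bdd (`|b| + 1) 1 (fun x : E => \1_(`[a, b]%classic) (nsq x) : R).
Proof.
split.
- apply: measurableT_comp => //; last exact: measurable_nsq.
- by move=> x; rewrite indic_itvcc; case: (a <= nsq x <= b); rewrite ?normr1 ?normr0.
- move=> x h; rewrite indic_itvcc; have [/andP[_ sb]|//] := boolP (a <= nsq x <= b); exfalso; apply: h.
  apply: nsq_cube; first by rewrite addr_ge0.
  apply: (le_trans sb); have := ler_norm b; have := normr_ge0 b; nra.
Qed.

(** Common to C_0 (h = 0) and L^r: the integrable part h contributes a bounded amount to any
    annulus, and is beaten by the factor S^(-N/2). *)
Definition vanishes_at_infinity (u : E -> R) := forall delta, 0 < delta ->
  exists h : E -> R, [/\ mu.-integrable setT (EFin \o h), forall x, 0 <= h x &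
    exists T, forall x, T <= nsq x -> `|u x| <= delta + h x].

(** The annulus lies in the cube of half-side sqrt(2 S), of volume (8 S)^(N/2) = (8 S)^(m+1). Hence
    the choice of delta, costing e/2; the integral of h costs at most e/2 once S >= 2 I / e, because
    S^(m+1) >= S. *)
Lemma annulus_decay (u : E -> R) (m e : R) : locint u -> 0 < m -> 2 * (m + 1) = N%:R ->
  vanishes_at_infinity u -> 0 < e ->
  exists2 S0, 1 <= S0 & forall S, S0 <= S ->
    S `^ (- m) / S * \int[mu]_x (`|u x| * \1_(`[S, 2 * S]%classic) (nsq x)) <= e.
Proof.
move=> lu m0 mN vu e0.
have p0 : 0 < 8 `^ (m + 1) :> R by rewrite powR_gt0.
have [|h [ih h0 [T hT]]] := vu (e / 2 / 8 `^ (m + 1)); first by rewrite !divr_gt0.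
set delta := e / 2 / _ in hT.
have d0 : 0 < delta by rewrite !divr_gt0.
pose I := \int[mu]_x h x.
have I0 : 0 <= I by apply: Rintegral_ge0 => x _; exact: h0.
exists (Num.max 1 (Num.max T (2 * I / e))); first by rewrite le_max lexx.
move=> S; rewrite !ge_max => /andP[S1 /andP[ST SI]].
have S0 : 0 < S by lra.
pose r := Num.sqrt (2 * S).
have r0 : 0 <= r by exact: sqrtr_ge0.
have r2 : r ^+ 2 = 2 * S by rewrite sqr_sqrtr//; lra.
have ic : mu.-integrable setT (EFin \o (fun x : E => \1_(cube r) x : R)).
  rewrite (_ : (fun x : E => _) = (fun x : E => cst 1 x * \1_(cube r) x)); last first.
    by apply/funext => x; rewrite /= mul1r.
  exact: locint_cube (locint_cst 1).
have Ic : \int[mu]_x (\1_(cube r) x : R) = (2 * r) ^+ N.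
  rewrite /Rintegral integral_indic//; last exact: measurable_cube.
  rewrite setIT -[RHS]/(fine ((2 * r) ^+ N)%:E); congr fine; exact: lebesgue_rV_cube.
have B : \int[mu]_x (`|u x| * \1_(`[S, 2 * S]%classic) (nsq x)) <= delta * (2 * r) ^+ N + I.
  rewrite -Ic /I -RintegralZl// -RintegralD//; last exact: integrableRZ.
  apply: le_Rintegral => //.
  - exact: locint_mul (locint_norm lu) (bdd_indic_nsq _ _).
  - by apply: integrableRD => //; exact: integrableRZ.
  - move=> x _; rewrite indic_itvcc; have [/andP[s1 s2]|_] := boolP (S <= nsq x <= 2 * S); last first.
      rewrite mulr0; apply: addr_ge0 => //; apply: mulr_ge0; first exact: ltW.
      by rewrite indicE.
    rewrite mulr1 indicE mem_set ?mulr1; first by apply: hT; exact: le_trans s1.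
    by apply: nsq_cube => //; rewrite r2.
have V : (2 * r) ^+ N = 8 `^ (m + 1) * S `^ (m + 1).
  rewrite -powR_mulrn ?mulr_ge0// -mN powRrM -powRM ?(ltW S0)//; congr (_ `^ _).
  by rewrite (powR_mulrn 2) ?mulr_ge0// exprMn r2; ring.
have q0 : 0 < S `^ (m + 1) by rewrite powR_gt0.
have qS : S `^ (- m) / S = (S `^ (m + 1))^-1.
  rewrite powRD ?powRr1 ?(ltW S0) ?gt_eqF ?implybT ?addr_gt0//.
  by rewrite powRN invfM.
rewrite qS; apply: (@le_trans _ _ ((S `^ (m + 1))^-1 * (delta * (2 * r) ^+ N + I))).
  by rewrite ler_pM2l ?invr_gt0.
rewrite ler_pdivrMl// V [in leRHS]mulrC.
have -> : delta * (8 `^ (m + 1) * S `^ (m + 1)) = e / 2 * S `^ (m + 1).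
  by rewrite /delta; move: (S `^ _) (8 `^ _) p0 => X Y Y0; field; rewrite gt_eqF.
have : S <= S `^ (m + 1).
  by rewrite -[leLHS]powRr1 ?(ltW S0)// ler_powR// lerDr ltW.
move: SI; rewrite ler_pdivrMr//; move: (S `^ _) => X; nra.
Qed.

Lemma ae_zero_of_integral (u : E -> R) (rho : R) : locint u ->
  \int[mu]_x (`|u x| * \1_(`[0, rho]%classic) (nsq x)) <= 0 ->
  {ae mu, forall x, nsq x <= rho -> u x = 0}.
Proof.
move=> lu h.
have i0 := locint_mul lu (bdd_indic_nsq 0 rho).
have i1 := locint_mul (locint_norm lu) (bdd_indic_nsq 0 rho).
have : (\int[mu]_x `|(u x * \1_(`[0%R, rho]%classic) (nsq x))%:E| = 0)%E.
  have e : (\int[mu]_x `|(u x * \1_(`[0%R, rho]%classic) (nsq x))%:E| =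
      \int[mu]_x ((EFin \o (fun x => `|u x|%R * \1_(`[0%R, rho]%classic) (nsq x))%R) x))%E.
    apply: eq_integral => x _ /=; rewrite normrM [X in (_ * X)%R]ger0_norm//.
  rewrite e; apply/eqP; rewrite eq_le integral_ge0 ?andbT; last first.
    by move=> x _; rewrite lee_fin mulr_ge0// indicE.
  rewrite -(fineK (integrable_fin_num measurableT i1)) lee_fin.
  exact: h.
move=> /(ae_eq_integral_abs _ measurableT) H.
have mi : measurable_fun setT (fun x => (u x * \1_(`[0%R, rho]%classic) (nsq x))%:E).
  exact: (measurable_int _ i0).
apply: filterS (H mi) => x /(_ I) [] + xr.
by rewrite indic_itvcc nsq_ge0 xr/= mulr1.
Qed.

Section supersolution.
Variables (u : E -> R) (G : 'I_N -> E -> R) (b m : R).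
Hypotheses (lu : locint u) (lG : forall i, locint (G i)).
Hypothesis weak : forall i, is_weak_partial [:: i; i] u (G i).
Hypothesis vu : vanishes_at_infinity u.
Hypotheses (b1 : 1 < b) (m0 : 0 < m) (mN : 2 * (m + 1) = N%:R).
(** Here [lambda] is the opposite of the eigenvalue, of either sign; the barriers are built for the
    nonnegative bound [mu_]. *)
Variables (lambda mu_ : R) (v v1 v2 : R -> R) (V0 eta : R).
Hypothesis eqG : (fun x => \sum_(i < N) G i x) =
  (fun x => - lambda * (1 + pospow b (nsq x))^-1 * u x) %[ae mu].
Hypotheses (mu0 : 0 <= mu_) (lmu : lambda <= mu_).
Hypothesis IB : inner_barrier b m mu_ v v1 v2 V0 eta.

(** [barrier_integral] weighs the ball against the annulus: k times the integral over the ball is at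
    most C W S^(-m-1) times the integral over the annulus, which [annulus_decay] makes arbitrarily
    small. *)
Lemma inner_barrier_ball (rho : R) : 0 <= rho ->
  \int[mu]_x (`|u x| * \1_(`[0, rho]%classic) (nsq x)) <= 0.
Proof.
move=> rho0; have [dv vV eta0 Lv] := IB.
pose a (y : R) := (1 + pospow b y)^-1.
have a0 y : 0 < a y by rewrite invr_gt0 ltr_wpDr// pospow_ge0.
have a1 y : a y <= 1 by rewrite invf_le1 ?lerDl ?pospow_ge0// ltr_wpDr// pospow_ge0.
have ca : continuous a.
  move=> y; apply: (@continuous_comp R R R (fun y => 1 + pospow b y) (fun x => x^-1)).
    by apply: continuousD; [exact: cst_continuous|exact: continuous_pospow].
  by apply: inv_continuous; rewrite gt_eqF// ltr_wpDr// pospow_ge0.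
have [k k0 hk] : exists2 k, 0 < k & forall y, 0 <= y <= rho -> k <= eta * a y * v y.
  have [|c c1 hc] := @EVT_min R (fun y => eta * a y * v y) 0 rho rho0.
    apply: within_continuous_pt => y /andP[y0 _]; apply: continuousM.
      by apply: continuousM; [exact: cst_continuous|exact: ca].
    by have [D _ _] := dv y y0; exact: is_derive_continuous D.
  exists (eta * a c * v c); last by move=> y hy; apply: hc; rewrite in_itv.
  have c0 : 0 <= c by move: c1; rewrite in_itv/= => /andP[].
  by rewrite !mulr_gt0// (andP (vV c c0)).1.
have [d d0 bd] : exists2 d, 0 < d & 1 + 2 * d = b.
  by exists ((b - 1) / 2); [rewrite divr_gt0// subr_gt0|field].
have V00 : 0 < V0 by have /andP[h1 h2] := vV 0 (lexx 0); exact: lt_le_trans h2.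
(* Beyond T^(1/d) one has y^-d <= 1/T, which yields both smallness conditions on y^-d asked by the
   outer barrier. *)
pose T := Num.max 2 (mu_ / (2 * d * (m + d))).
have T0 : 0 < T by rewrite lt_max ltr0n.
have dm0 : 0 < 2 * d * (m + d) by rewrite !mulr_gt0// addr_gt0.
pose S1 := Num.max (Num.max 1 rho) (T `^ d^-1).
have S11 : 1 <= S1 by rewrite !le_max lexx.
have S1r : rho <= S1 by rewrite !le_max lexx orbT.
have S10 : 0 < S1 by lra.
have Sd y : S1 <= y -> y `^ (- d) <= T^-1.
  move=> yS; have y0 : 0 < y by lra.
  rewrite powRN lef_pV2 ?posrE ?powR_gt0//.
  have TS : T `^ d^-1 <= y by apply: le_trans yS; rewrite le_max lexx orbT.
  have dn : d != 0 by rewrite gt_eqF.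
  rewrite -[leLHS](powRr1 (ltW T0)) -(mulVf dn) powRrM.
  by apply: (ge0_ler_powR (ltW d0)); rewrite ?nnegrE ?powR_ge0 ?(ltW y0).
have g2 y : S1 <= y -> y `^ (- d) <= 1 / 2.
  move=> /Sd/le_trans; apply; rewrite div1r lef_pV2 ?posrE//.
  by rewrite le_max lexx.
have g1 y : S1 <= y -> y `^ (- d) <= 1 by move=> /g2 h; lra.
have mg y : S1 <= y -> mu_ * y `^ (- d) <= 2 * d * (m + d).
  move=> /Sd h; apply: le_trans (ler_wpM2l mu0 h) _.
  rewrite ler_pdivrMr// mulrC -ler_pdivrMr//.
  by rewrite le_max lexx orbT.
(* Makes z >= V0 + 1 > v on [S1, S1 + 1]. Like [k] and [W], it is fixed before S, the only quantity
   depending on e. *)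
pose C := 2 * (V0 + 1) * (S1 + 1) `^ m.
have C0 : 0 < C.
  by apply: mulr_gt0; [rewrite mulr_gt0 ?addr_gt0|rewrite powR_gt0//; lra].
pose W := 72 * m + 432; have W0 : 0 < W by have h := m0; rewrite /W; lra.
pose J := \int[mu]_x (`|u x| * \1_(`[0, rho]%classic) (nsq x)).
suff H e : 0 < e -> k * J <= C * W * e.
  have J0 : J <= 0.
    apply/ler_addgt0Pr => e e0; rewrite add0r.
    have CW : 0 < C * W by exact: mulr_gt0.
    have ke : 0 < k * e by exact: mulr_gt0.
    have := H _ (divr_gt0 ke CW).
    by rewrite [leRHS]mulrC divfK ?gt_eqF// ler_pM2l.
  exact: J0.
move=> e0; have [S0 S01 hS0] := annulus_decay lu m0 mN vu e0.
pose S := Num.max S0 (S1 + 1).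
have SS1 : S1 + 1 <= S by rewrite le_max lexx orbT.
have Sp : 0 < S by lra.
have := hS0 S; rewrite le_max lexx => /(_ isT).
set D := \int[mu]_x _ => hD.
pose f := C * (W * (S `^ (- m) / S)).
have f0 : 0 < f.
  by do 2!apply: mulr_gt0 => //; rewrite divr_gt0// powR_gt0.
pose z := outer S m d C; pose z1 := outer1 S m d C; pose z2 := outer2 S m d C.
(* Gain of the inner barrier on the ball, cutoff error on the annulus; elsewhere both barriers are
   supersolutions and 0 suffices. *)
pose Fr y : R := - k * \1_(`[0, rho]%classic) y + f * \1_(`[S, 2 * S]%classic) y.
pose q y := - lambda * a y.
have Fr_ge y : rho < y -> 0 <= Fr y.
  move=> ry; rewrite /Fr indic_itvcc [y <= rho]leNgt ry andbF mulr0 add0r.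
  by apply: mulr_ge0; [exact: ltW|rewrite indicE].
have qle (g : R) y : 0 <= y -> 0 <= g -> - (q y * g) <= mu_ * a y * g.
  by move=> y0 g0; rewrite -mulNr ler_wpM2r// /q mulNr opprK ler_wpM2r// ltW.
have nN : 2 * N%:R = 4 * (m + 1) :> R by rewrite -mN; ring.
have K := @barrier_integral R N u G q (`|lambda| + (k + f)) lu lG weak _ _ _
  v v1 v2 z z1 z2 Fr S1 (2 * S) S10 _ _ _ _ _ _ _ _ _ _ _ _ _ _ _ _.
have : 0 <= \int[mu]_x (`|u x| * Fr (nsq x)).
  apply: K.
  - apply: measurableT_comp; last exact: measurable_nsq.
    by apply: continuous_measurable_fun => y; apply: (@continuousM _ _ (fun=> - lambda) a);
      [exact: cst_continuous|exact: ca].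
  - move=> y y0; rewrite /q normrM normrN (ger0_norm (ltW (a0 y))).
    apply: (@le_trans _ _ `|lambda|); first by rewrite ler_piMr.
    by rewrite lerDl addr_ge0// ltW.
  - exact: eqG.
  - by lra.
  - by move=> y /dv[].
  - by move=> y /dv[].
  - by move=> y /dv[].
  - by move=> y y0; exact: is_derive_outer.
  - by move=> y y0; exact: is_derive_outer1.
  - by move=> y y0; exact: continuous_outer2.
  - by move=> y /vV/andP[/ltW].
  - by move=> y yS; apply: outer_ge0 => //; [lra|exact: g2].
  - by move=> y yS; exact: outer_eq0.
  - move=> y /andP[y1 y2]; have yp : 0 < y by lra.
    have /andP[_ h1] := vV y (ltW yp).
    have h2 : C / 2 * y `^ (- m) <= z y by apply: outer_ge => //; [lra|exact: g2].
    apply: lt_le_trans h2; apply: (@lt_le_trans _ _ (V0 + 1)); first by lra.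
    rewrite /C; have -> : 2 * (V0 + 1) * (S1 + 1) `^ m / 2 * y `^ (- m) =
      (V0 + 1) * ((S1 + 1) `^ m * y `^ (- m)) by field.
    have V1 : 0 <= V0 + 1 by rewrite addr_ge0// ltW.
    apply: (ler_peMr V1).
    rewrite powRN ler_pdivlMr ?powR_gt0// mul1r.
    by apply: (ge0_ler_powR (ltW m0)); rewrite ?nnegrE//; lra.
  - apply: measurable_funD; apply: measurable_funM => //; apply: measurableT_comp => //; exact: measurable_nsq.
  - move=> y y0; rewrite /Fr; apply: le_trans (ler_normD _ _) _.
    rewrite -[leLHS]add0r lerD// 2!normrM normrN (gtr0_norm k0) (gtr0_norm f0).
    have one (A : set R) : `|\1_A y : R| <= 1.
      by rewrite indicE; case: (_ \in _); rewrite ?normr1 ?normr0.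
    by apply: lerD; rewrite ler_piMr ?one ?(ltW k0) ?(ltW f0).
  - move=> y yS; rewrite /Fr !indic_itvcc [y <= 2 * S]leNgt yS [y <= rho]leNgt.
    have -> : rho < y by lra.
    by rewrite !andbF !mulr0 addr0.
  - move=> y y0 _; have /andP[vp _] := vV y y0.
    have h1 := Lv y y0; have h2 := qle (v y) y y0 (ltW vp).
    rewrite nN; apply: (@le_trans _ _ (- (eta * a y * v y))).
      by move: h1 h2; rewrite -/(a y) [(mu_ + eta) * _]mulrDl [(_ + _) * v y]mulrDl; lra.
    have [yr|yr] := leP y rho; last first.
      by apply: le_trans (Fr_ge y yr); rewrite oppr_le0 !mulr_ge0// ltW.
    have h3 : k <= eta * a y * v y by apply: hk; rewrite y0.
    rewrite /Fr indic_itvcc y0 yr mulr1; apply: (@le_trans _ _ (- k)); first by rewrite lerN2.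
    by rewrite lerDl; apply: mulr_ge0; [exact: ltW|rewrite indicE].
  - move=> y yS _; have yp : 0 < y by lra.
    have y1 : S1 <= y by lra.
    have zp : 0 <= z y by apply: outer_ge0 => //; exact: g2.
    have Fy : 0 <= Fr y by apply: Fr_ge; lra.
    have h2 := qle (z y) y (ltW yp) zp.
    rewrite nN; apply: (@le_trans _ _ (4 * (m + 1) * z1 y + 4 * y * z2 y + mu_ * a y * z y)).
      by rewrite lerD2l.
    rewrite /a -bd; have [yS'|yS'] := ltP y S.
      apply: le_trans (outer_in Sp C0 yp (ltW yS') mu0 (g1 y y1) (mg y y1)) _.
      apply: le_trans Fy; rewrite oppr_le0 !mulr_ge0 ?powR_ge0 ?invr_ge0 ?addr_ge0//; exact: ltW.
    have [y2|y2] := leP y (2 * S).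
      have h3 : S <= y <= 2 * S by rewrite yS'.
      apply: le_trans (outer_transition Sp m0 d0 C0 h3 mu0 (g2 y y1) (mg y y1)) _.
      rewrite /Fr !indic_itvcc yS' y2 mulr1 [y <= rho]leNgt.
      have -> : rho < y by lra.
      by rewrite andbF mulr0 add0r.
    have [e1 e2] := outer_out Sp m d C (ltW y2).
    rewrite /z1 /z2 e1 e2 /z outer_eq0 ?(ltW y2)// !mulr0 !addr0.
    exact: Fy.
have iu := locint_norm lu.
have i1 := locint_mul iu (bdd_indic_nsq 0 rho).
have i2 := locint_mul iu (bdd_indic_nsq S (2 * S)).
rewrite (_ : (fun x => _) = (fun x => - k * (`|u x| * \1_(`[0, rho]%classic) (nsq x)) +
  f * (`|u x| * \1_(`[S, 2 * S]%classic) (nsq x)))); last by apply/funext => x; rewrite /Fr; ring.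
rewrite RintegralD//; [|exact: integrableRZ|exact: integrableRZ].
rewrite !RintegralZl// -/J -/D mulNr addrC subr_ge0 => /le_trans; apply.
rewrite /f !mulrA -[C * W * _ / _]mulrA -[C * W * _ * D]mulrA.
by rewrite ler_pM2l// mulr_gt0.
Qed.

Lemma supersolution_zero : u = cst 0 %[ae mu].
Proof.
have H n : {ae mu, forall x, nsq x <= n%:R -> u x = 0}.
  by apply: (ae_zero_of_integral lu); apply: inner_barrier_ball.
have : mu.-negligible (\bigcup_n ~` [set x | nsq x <= n%:R -> u x = 0]).
  by apply: negligible_bigcup => n; exact: H.
apply: negligibleS => x /= ux.
have [n hn] : exists n : nat, nsq x <= n%:R.
  by exists (Num.truncn (nsq x)).+1; rewrite ltW// truncnS_gt.
by exists n => // h; apply: ux => _; exact: h hn.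
Qed.

End supersolution.
End vanishing.

(* The library's monotonicity lemma asks for measurability, which is not at hand for restrictions to compact sets. *)
Lemma le_integral_nonneg d (T : measurableType d) (R : realType) (m : {measure set T -> \bar R})
    (f g : T -> \bar R) : (forall x, (0 <= f x)%E) -> (forall x, (f x <= g x)%E) ->
  (\int[m]_x f x <= \int[m]_x g x)%E.
Proof.
move=> f0 fg; have g0 x : (0 <= g x)%E by exact: le_trans (f0 x) (fg x).
rewrite !ge0_integralTE//.
by apply: ereal_sup_le => _ [h /= hf <-]; exists h => //= x; exact: le_trans (hf x) (fg x).
Qed.

(** * Eigenfunctions of L *)

Section extraction.
Context {R : realType} {N : nat}.
Notation E := 'rV[R]_N.
Notation mu := (@lebesgue_rV R N).

Lemma compact_sub_cube (K : set E) : compact K -> exists2 r, 0 <= r & K `<=` cube r.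
Proof.
move=> /compact_bounded[M [_ hM]].
exists (`|M| + 1 + 1) => [|x Kx]; first by rewrite !addr_ge0.
have h : `|x| <= `|M| + 1.
  by apply: hM Kx => //; rewrite (le_lt_trans (ler_norm _))// ltrDl.
apply/cubeP => i.
have : ball (0 : E) (`|M| + 1 + 1) x.
  by rewrite mx_norm_ball /ball_/= sub0r normrN (le_lt_trans h)// ltrDl.
by move=> [_ /(_ ord0 i)]; rewrite mxE /ball/= sub0r normrN => /ltW.
Qed.

Lemma locint_Lloc1 (f : E -> R) : locint f -> Lloc 1 f.
Proof.
move=> [mf lf]; split=> // K /compact_sub_cube[r r0 Kr].
rewrite /finite_norm Lnorm1.
have /integrableP[_ h] := (integrable_mkcond _ (measurable_cube r)).1 (lf r).
apply: le_lt_trans h; apply: le_integral_nonneg => x; first exact: abse_ge0.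
rewrite /= !patchE /=; case: ifPn => xK; last by rewrite normr0; exact: abse_ge0.
by rewrite mem_set//; apply: Kr; rewrite inE in xK.
Qed.

(** On a cube |f| <= 1 + |f|^q, and both terms are integrable there. *)
Lemma Lloc_locint (q : R) (f : E -> R) : 1 <= q -> Lloc q f -> locint f.
Proof.
move=> q1 [mf lf]; split=> // r; apply/integrable_mkcond; first exact: measurable_cube.
have mfr : measurable_fun setT (f \_ (cube r)).
  apply: (measurable_restrictT _ (measurable_cube r)).1.
  exact: measurable_funS mf.
have fL : f \_ (cube r) \in Lfun mu q%:E.
  by rewrite inE; apply/andP; split; rewrite inE//=; exact/lf/compact_cube.
have i1 := Lfun_integrable q1 fL.
have i2 : mu.-integrable setT (EFin \o (fun x : E => cst 1 x * \1_(cube r) x)).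
  exact: locint_cube (locint_cst 1).
have := le_integrableR mfr _ (integrableRD i2 i1); rewrite restrict_EFin; apply => x.
rewrite patchE; case: ifPn => xr; last by rewrite normr0 addr_ge0 ?powR_ge0// indicE /= mulr_ge0.
rewrite /= mul1r indicE xr; have [h|h] := leP `|f x| 1.
  by rewrite (le_trans h)// lerDl powR_ge0.
apply: (@le_trans _ _ (`|f x| `^ q)); last by rewrite lerDr.
by rewrite -[leLHS]powRr1// ler_powR// ltW.
Qed.

(** [weak_partial] chooses among L^1_loc representatives, so the L^q_loc derivative given by [Wloc]
    is first shown to be a candidate. *)
Lemma weak_partial_spec (k : nat) (q : R) (u : E -> R) (s : seq 'I_N) : 1 <= q -> Wloc k q u ->
  (size s <= k)%N -> locint (weak_partial s u) /\ is_weak_partial s u (weak_partial s u).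
Proof.
move=> q1 [_ W] sk; have [g lg wg] := W s sk.
have [|l w] := @getPex _ [set g | Lloc 1 g /\ is_weak_partial s u g].
  by exists g; split => //; exact/locint_Lloc1/Lloc_locint/lg.
by split => //; exact: Lloc_locint l.
Qed.

Lemma vanishes_C0 (u : E -> R) : C0 u -> vanishes_at_infinity u.
Proof.
move=> [_ hu] delta d0; have [K /compact_sub_cube[r r0 Kr] hK] := hu _ d0.
exists (fun=> 0); split => //; first exact: integrable0.
exists (N%:R * r ^+ 2 + 1) => x hx; rewrite addr0 ltW// hK// => /Kr/cube_nsq; lra.
Qed.

(** Where |u| > delta, |u| = |u|^(1-r) |u|^r <= delta^(1-r) |u|^r, an integrable function. *)
Lemma vanishes_Lfun (u : E -> R) (r : R) : 1 <= r -> u \in Lfun mu r%:E -> vanishes_at_infinity u.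
Proof.
move=> r1 uL delta d0; have iu := Lfun_integrable r1 uL.
exists (fun x => delta `^ (1 - r) * `|u x| `^ r); split.
- exact: integrableRZ.
- by move=> x; rewrite mulr_ge0 ?powR_ge0.
exists 0 => x _; have [h|h] := leP `|u x| delta.
  by rewrite (le_trans h)// lerDl mulr_ge0 ?powR_ge0.
have u0 : 0 < `|u x| by exact: lt_trans h.
apply: (@le_trans _ _ (delta `^ (1 - r) * `|u x| `^ r)); last by rewrite lerDr ltW.
have un : `|u x| != 0 by rewrite gt_eqF.
have -> : `|u x| `^ r = `|u x| / `|u x| `^ (1 - r).
  by rewrite -powRN -[X in X * _](powRr1 (ltW u0)) -powRD ?un ?implybT//; congr (_ `^ _); ring.
rewrite mulrCA ler_peMr ?(ltW u0)// ler_pdivlMr ?powR_gt0// mul1r.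
rewrite -(opprB r 1) !powRN lef_pV2 ?posrE ?powR_gt0//.
by apply: ge0_ler_powR; rewrite ?nnegrE ?subr_ge0 ?(ltW d0)// ltW.
Qed.

Lemma Dmax_regularity (alpha : R) (p : \bar R) (u : E -> R) : (1%:E < p)%E -> Dmax alpha p u ->
  (exists2 q, 1 <= q & Wloc 2 q u) /\ vanishes_at_infinity u.
Proof.
case: p => [r| |]//= r1.
- move=> [uL W _]; rewrite lte_fin in r1; split; first by exists r => //; exact: ltW.
  exact: vanishes_Lfun (ltW r1) uL.
- by move=> [uC W _]; split; [exists 1 => //; exact: W|exact: vanishes_C0].
Qed.

Lemma enorm_powR (alpha : R) (x : E) : enorm x `^ alpha = pospow (alpha / 2) (nsq x).
Proof.
by rewrite pospowE ?nsq_ge0// /enorm -powR12_sqrt ?nsq_ge0// -powRrM mulrC.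
Qed.

Lemma eigenvalue_le (alpha : R) (p : \bar R) (lambda B : R) :
  (3 <= N)%N -> 2 < alpha -> ((N%:R / (N%:R - 2))%:E < p)%E -> 0 < B ->
  (forall m, 0 <= m -> m < B ->
    exists v v1 v2 V0 eta, inner_barrier (alpha / 2) ((N%:R - 2) / 2) m v v1 v2 V0 eta) ->
  @L_eigenvalue R N alpha p lambda -> lambda <= - B.
Proof.
move=> N3 a2 pN B0 hB [u [Du unz eu]]; rewrite leNgt; apply/negP => lB.
have n3 : 3 <= N%:R :> R by rewrite ler_nat.
have p1 : (1%:E < p)%E.
  by apply: lt_trans pN; rewrite lte_fin ltr_pdivlMr; lra.
have [[q q1 W] vu] := Dmax_regularity p1 Du.
(* The maximum with 0 also disposes of a nonnegative lambda, with the barrier for 0. *)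
have [||v [v1 [v2 [V0 [eta IB]]]]] := hB (Num.max 0 (- lambda)).
- by rewrite le_max lexx.
- by rewrite gt_max B0 ltrNl.
apply: unz; have spec i := @weak_partial_spec 2 q u [:: i; i] q1 W isT.
apply: (@supersolution_zero R N u (fun i => weak_partial [:: i; i] u) (alpha / 2) ((N%:R - 2) / 2)
  (Lloc_locint q1 W.1) (fun i => (spec i).1) (fun i => (spec i).2) vu _ _ _ (- lambda) _ v v1 v2 V0 eta _ _ _ IB).
- by lra.
- by lra.
- by field.
- apply: filterS eu => x; rewrite /L_op /weak_laplacian enorm_powR => h.
  have n0 : 1 + pospow (alpha / 2) (nsq x) != 0 by rewrite gt_eqF// ltr_wpDr// pospow_ge0.
  by move=> xT; rewrite opprK -mulrA mulrCA -h// (mulKf n0).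
- by rewrite le_max lexx.
- by rewrite le_max lexx orbT.
Qed.

End extraction.

Theorem proposition8p6 (R : realType) (N : nat) (alpha : R) (p : \bar R)
  (lambda1 : R) :
  (3 <= N)%N -> 2 < alpha -> ((N%:R / (N%:R - 2))%:E < p)%E ->
  L_first_eigenvalue N alpha p lambda1 ->
  lambda1 <= - (((alpha - 2) / 2) `^ (2 / alpha) * (alpha / (alpha - 2)) *
                ((N%:R - 2) ^+ 2 / 4))
  /\
  lambda1 <= - ((N%:R - 2) * (alpha * sin (2 / alpha * pi) / pi)).
Proof.
move=> N3 a2 pN [ev _].
have n3 : 3 <= N%:R :> R by rewrite ler_nat.
have a0 : 0 < alpha by lra.
have b1 : 1 < alpha / 2 by lra.
have m0 : 0 < (N%:R - 2) / 2 :> R by lra.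
have an : alpha != 0 by rewrite gt_eqF.
have p0 := pi_gt0 R.
have s0 : 0 < sin (2 / alpha * pi) :> R.
  have h1 : 2 / alpha < 1 by rewrite ltr_pdivrMr// mul1r.
  apply: sin_gt0_pi; rewrite mulr_gt0 ?divr_gt0//=.
  by rewrite -[ltRHS]mul1r ltr_pM2r.
split; apply: eigenvalue_le N3 a2 pN _ _ ev.
- by rewrite !mulr_gt0 ?powR_gt0 ?invr_gt0 ?exprn_gt0//; lra.
- move=> m h0 h1; apply: inner_barrier_hardy => //; apply: lt_le_trans h1 _.
  have -> : alpha / 2 - 1 = (alpha - 2) / 2 by field.
  have -> : (alpha / 2)^-1 = 2 / alpha by field.
  move: (((alpha - 2) / 2) `^ (2 / alpha)) => X; rewrite le_eqVlt; apply/orP; left; apply/eqP; field.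
  by rewrite gt_eqF//; lra.
- by rewrite mulr_gt0 ?divr_gt0 ?mulr_gt0 ?pi_gt0//; lra.
- move=> m h0 h1; apply: inner_barrier_kernel => //.
  have -> : pi / (alpha / 2) = 2 / alpha * pi :> R by field.
  have pn : pi != 0 :> R by rewrite gt_eqF.
  rewrite -ltr_pdivlMr; last by rewrite divr_gt0// mulr_gt0// divr_gt0.
  apply: lt_le_trans h1 _; rewrite le_eqVlt; apply/orP; left; apply/eqP.
  move: (sin _) s0 => s s0; move: (pi : R) pn => P pn; field.
  by rewrite pn an gt_eqF.
Qed.
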